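(* Let $\omega$ be a modulus of continuity. Let $\lambda_1,\lambda_2\in\mathbb{R}$ with $0<|\lambda_1|<1<|\lambda_2|$ be any prescribed numbers, and put $\Lambda:=\begin{pmatrix}\lambda_1&0\\0&\lambda_2\end{pmatrix}$. Then: (I) If $\int_0^1\frac{\omega(t)}{t}\,dt<+\infty$, then every planar $C_{1,\omega}$ diffeomorphism $F:(\mathbb{R}^2,O)\to(\mathbb{R}^2,O)$ with $DF(O)=\Lambda$ is locally $C^1$ linearizable. (II) If $\int_0^1\frac{\omega(t)}{t}\,dt=+\infty$, then there exists a planar $C_{1,\omega}$ diffeomorphism $F:(\mathbb{R}^2,O)\to(\mathbb{R}^2,O)$ with $DF(O)=\Lambda$ that is not locally $C^1$ linearizable. Equivalently, all planar $C_{1,\omega}$ diffeomorphisms $F$ with $F(O)=O$ and $DF(O)=\Lambda$ are locally $C^1$ linearizable if and only if $\int_0^1\frac{\omega(t)}{t}\,dt<+\infty$. Moreover, in (I), the linearizing diffeomorphism $\Phi$ and its inverse can be chosen of class $C_{1,\omega_{\mathrm D}}$, where $$\delta:=\frac{\min\{-\log|\lambda_1|,\log|\lambda_2|\}}{\log|\lambda_2|-\log|\lambda_1|}\in(0,1/2]$$ and, for sufficiently small $t>0$, $$\omega_{\mathrm D}(t):=\int_0^{t^\delta}\frac{\omega(s)}{s}\,ds .$$ This estimate is optimal for each prescribed pair $(\lambda_1,\lambda_2)$: whenever $\int_0^1\frac{\omega(t)}{t}\,dt<+\infty$, there exists a planar $C_{1,\omega}$ diffeomorphism $F$ with $F(O)=O$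 and $DF(O)=\Lambda$ such that, for every modulus of continuity $\eta$, if $\Phi\in C_{1,\eta}$ is a normalized local linearizing diffeomorphism of $F$, then $\omega_{\mathrm D}(t)=\mathcal O(\eta(t))$ as $t\to0^+$.
   Context: $O=(0,0)^\top$ is the origin of $\mathbb{R}^2$; $|\cdot|$ is the supremum norm on $\mathbb{R}^2$ and the induced operator norm on matrices. A modulus of continuity is a continuous, strictly increasing, concave function $\omega:[0,\infty)\to[0,\infty)$ with $\omega(0)=0$ (only its values near $0$ matter). All diffeomorphisms are understood locally: $F:(\mathbb{R}^2,O)\to(\mathbb{R}^2,O)$ denotes a $C^1$ diffeomorphism from a neighborhood of $O$ onto a neighborhood of $O$ with $F(O)=O$. For a function $\nu$ defined near $0$, we write $F\in C_{1,\nu}$ if there are a neighborhood of $O$ and a constant $L>0$ such that $|DF(x)-DF(y)|\leqslant L\,\nu(|x-y|)$ for all $x,y$ in that neighborhood. For $F$ with $DF(O)=\Lambda$, a (normalized) local linearizing diffeomorphism is a local $C^1$ diffeomorphism $\Phi:(\mathbb{R}^2,O)\to(\mathbb{R}^2,O)$ with $\Phi(O)=O$, $D\Phi(O)=\mathrm{Id}$ and $\Phi\circ F=\Lambda\circ\Phi$ near $O$; $F$ is locally $C^1$ linearizable if one exists. *)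

(* Defs.v *)
From HB Require Import structures.
From mathcomp Require Import all_boot all_order all_algebra.
From mathcomp Require Import all_classical all_reals all_analysis.

Set Implicit Arguments.
Unset Strict Implicit.
Unset Printing Implicit Defensive.

Import Order.TTheory GRing.Theory Num.Theory.
Import numFieldNormedType.Exports.

Local Open Scope classical_set_scope.
Local Open Scope ring_scope.

(* Points of the plane are row vectors, so that
   [jacobian] applies: a matrix M stands for the linear map v |-> v *m M, and
   [jacobian F x] is the transpose of the usual Jacobian matrix.  The norm
   `|v| on 'rV[R]_2 is the supremum norm.  Germs at the origin are represented
   by total maps whose values are only constrained near the origin. *)

Section Planar.
Variable R : realType.
Implicit Types (F G Phi : 'rV[R]_2 -> 'rV[R]_2) (U V : set 'rV[R]_2).
Implicit Types (omega nu : R -> R) (M Lambda : 'M[R]_2).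

(* A function [0, +oo) -> [0, +oo) is a total function R -> R whose values on
   the negative half-line are irrelevant. *)
Definition modulus_of_continuity omega : Prop :=
  [/\ omega 0 = 0,
      (forall t, 0 <= t -> 0 <= omega t),
      {within `[0, +oo[, continuous omega},
      (forall s t, 0 <= s -> s < t -> omega s < omega t) &
      (forall s t p, 0 <= s -> 0 <= t -> 0 <= p -> p <= 1 ->
         p * omega s + (1 - p) * omega t <= omega (p * s + (1 - p) * t))].

(* Not the canonical norm of 'M[R]_2, which is the largest absolute value of
   an entry. *)
Definition opnorm M : R :=
  sup [set `|v *m M| | v in [set v : 'rV[R]_2 | `|v| <= 1]].

Definition C1_on U F : Prop :=
  forall x, U x -> differentiable F x /\ {for x, continuous (jacobian F)}.

Definition local_C1_inverse F G : Prop :=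
  F 0 = 0 /\
  exists U V,
    [/\ open_nbhs (0 : 'rV[R]_2) U, open_nbhs (0 : 'rV[R]_2) V, F @` U = V /\ G @` V = U,
      (forall x, U x -> G (F x) = x) /\ (forall y, V y -> F (G y) = y) &
      C1_on U F /\ C1_on V G].

Definition local_C1_diffeo F : Prop := exists G, local_C1_inverse F G.

Definition C1_modulus nu F : Prop :=
  exists U L, [/\ nbhs (0 : 'rV[R]_2) U, 0 < L, (forall x, U x -> differentiable F x) &
    forall x y, U x -> U y ->
      opnorm (jacobian F x - jacobian F y) <= L * nu `|x - y|].

Definition C1_modulus_diffeo nu F : Prop :=
  local_C1_diffeo F /\ C1_modulus nu F.

Definition saddle (l1 l2 : R) : 'M[R]_2 :=
  diag_mx (\row_(i < 2) if i == ord0 then l1 else l2).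

Definition linearizing Lambda F Phi : Prop :=
  [/\ local_C1_diffeo Phi, jacobian Phi 0 = 1%:M &
      \forall x \near (0 : 'rV[R]_2), Phi (F x) = Phi x *m Lambda].

(* Meant for F with [jacobian F 0 = Lambda]. *)
Definition C1_linearizable Lambda F : Prop :=
  exists Phi, linearizing Lambda F Phi.

Definition dini_integral omega (a : R) : \bar R :=
  (\int[lebesgue_measure]_(t in `]0%R, a]) (omega t / t)%:E)%E.

Definition Dini omega : Prop := (dini_integral omega 1 < +oo)%E.

Definition delta (l1 l2 : R) : R :=
  Num.min (- ln `|l1|) (ln `|l2|) / (ln `|l2| - ln `|l1|).

(* Used only when [Dini omega] holds, in which case the integral is finite. *)
Definition omegaD (l1 l2 : R) omega (t : R) : R :=
  fine (dini_integral omega (t `^ delta l1 l2)).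

End Planar.

(* Main.v *)
(* Write a = |l1| and b = |l2|.  A linearization is a pair of eigenfunctions, one
   for each eigenvalue; exchanging the coordinates and inverting F turns the second
   into the first, so only phi o F = l1 phi has to be solved.  After F has been made
   global and linear at infinity, an orbit of G = F^-1 approaches the origin and
   leaves it at geometric speed, so that the distances of DG from its linear part
   have a sum bounded by the Dini sum S(t) = sum_k omega(kap^k t), uniformly over
   orbits.  This yields the C1 stable manifold, and phi as the limit of l1^n h(G^n z),
   where h linearizes F on the stable manifold.  The modulus of D phi comes from
   comparing backward orbits up to the time at which the separation a^-k of points
   and the decay b^-k towards the stable manifold balance, which produces the
   exponent delta; S(t^delta) is comparable with omega_D(t).

   For the converse and the optimality take F(x, y) = (l1 x, l2 (y + H(y, x))) where
   H vanishes on the axes and dH/dy (x, 0) = omega(|x|).  If phi is the second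
   component of a linearization, q(x) = d phi/dy (x, 0) satisfies
   q(x) = (1 + omega(|x|)) q(l1 x), hence q(x) >= prod_k (1 + omega(a^k |x|)), which
   diverges when the Dini integral does.  When it converges, the difference between
   q(x) and phi(x, t) / t is at least half of the tail of the Dini sum from the time
   at which the orbit of (x, t) crosses the diagonal, and this tail is of order
   omega_D(t). *)
Require Import Defs.
From HB Require Import structures.
From mathcomp Require Import all_boot all_order all_algebra.
From mathcomp Require Import all_classical all_reals all_analysis.
From mathcomp Require Import measurable_realfun ring lra.
Import Order.TTheory GRing.Theory Num.Theory.
Import numFieldNormedType.Exports.
Local Open Scope classical_set_scope.
Local Open Scope ring_scope.

Set Implicit Arguments.
Unset Strict Implicit.

(** * Norms, moduli and Taylor estimates *)

(** Regularity is carried by pairs (f, D) with |f y - f x - D x (y - x)| <= nu |y - x| |y - x|. Such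
    bounds survive composition, inversion and pointwise limits, and convergence of the functions
    then forces that of the derivatives; Jacobians occur only on entering and leaving this
    framework. The obstacle is uniformity in the number n of iterations, because the Taylor
    constants of G^n grow with n. They serve only to justify a mean value inequality; uniform moduli
    are then read off from products of derivatives. After multiplication by l1 the factors are close
    to diag(1, l1 / l2), of norm 1, so that a product is controlled by the sum of the deviations of
    its factors. Of the Dini sum, only its monotonicity, its sublinear growth, its smallness at 0
    and the inequality om t + S (kap t) <= S t are used there; the last makes every sum along an
    orbit telescope. The exponent delta is reached only if separations and distances to the stable
    manifold are estimated with the exact rates a^-1 and b^-1, up to bounded factors; the auxiliary
    rate kap serves for summability alone. *)

Section MatrixNorm.
Variable R : realType.

Lemma mx_norm_le (m n : nat) (M : 'M[R]_(m, n)) (k : R) :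
  0 <= k -> (forall i j, `|M i j| <= k) -> `|M| <= k.
Proof.
move=> k0 h; rewrite /Num.norm/= mx_normrE; apply/bigmax_leP; split => //= -[i j] _.
Qed.

Lemma le_mx_norm (m n : nat) (M : 'M[R]_(m, n)) i j : `|M i j| <= `|M|.
Proof.
rewrite [leRHS]/Num.norm/= mx_normrE.
exact: (le_bigmax _ (fun ij : 'I_m * 'I_n => `|M ij.1 ij.2|) (i, j)).
Qed.

Lemma mx_norm_mul (m p n : nat) (A : 'M[R]_(m, p)) (B : 'M[R]_(p, n)) :
  `|A *m B| <= p%:R * `|A| * `|B|.
Proof.
apply: mx_norm_le => [|i j]; first by rewrite !mulr_ge0.
rewrite mxE (le_trans (ler_norm_sum _ _ _))//.
apply: (@le_trans _ _ (\sum_(k < p) (`|A| * `|B|))).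
  by apply: ler_sum => k _; rewrite normrM ler_pM// le_mx_norm.
by rewrite sumr_const card_ord -mulrA mulr_natl.
Qed.

Lemma mul2E (m n : nat) (A : 'M[R]_(m, 2)) (B : 'M[R]_(2, n)) i j :
  (A *m B) i j = A i 0 * B 0 j + A i 1 * B 1 j.
Proof.
rewrite mxE !big_ord_recl big_ord0 addr0.
by congr (_ + A i _ * B _ j); apply: val_inj.
Qed.

Lemma ord2E (i : 'I_2) : i = 0 \/ i = 1.
Proof. by case: i => -[|[|//]] h; [left|right]; apply: val_inj. Qed.

Lemma rv2P (u v : 'rV[R]_2) : u 0 0 = v 0 0 -> u 0 1 = v 0 1 -> u = v.
Proof.
move=> h0 h1; apply/rowP => j.
by case: (ord2E j) => ->.
Qed.

Lemma norm_rv2 (u : 'rV[R]_2) : `|u| = Num.max `|u 0 0| `|u 0 1|.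
Proof.
apply/le_anti/andP; split.
  apply: mx_norm_le; first by rewrite le_max normr_ge0.
  by move=> i j; rewrite ord1 le_max; case: (ord2E j) => ->; rewrite lexx ?orbT.
by rewrite ge_max !le_mx_norm.
Qed.

End MatrixNorm.

Section Moduli.
Variable R : realType.

(* Weaker than [modulus_of_continuity]: unlike concavity, these conditions are
   inherited at once by t |-> nu (t `^ d) and by Dini sums. *)
Definition wmod (nu : R -> R) : Prop :=
  [/\ forall t, 0 <= t -> 0 <= nu t,
      forall s t, 0 <= s -> s <= t -> nu s <= nu t,
      forall C t, 1 <= C -> 0 <= t -> nu (C * t) <= C * nu t &
      forall e, 0 < e -> exists2 d, 0 < d & nu d <= e].

Lemma wmod0 nu : wmod nu -> nu 0 = 0.
Proof.
move=> [h1 h2 h3 h4]; apply/eqP; rewrite eq_le h1// andbT.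
apply/ler_addgt0Pl => e e0; rewrite addr0.
have [d d0 hd] := h4 e e0; apply: le_trans hd; apply: h2 => //; exact: ltW.
Qed.

Lemma wmod_scale nu c : wmod nu -> 0 <= c -> wmod (fun t => c * nu t).
Proof.
move=> [h1 h2 h3 h4] c0; split.
- by move=> t t0; rewrite mulr_ge0// h1.
- by move=> s t s0 st; rewrite ler_wpM2l// h2.
- by move=> C t C1 t0; rewrite mulrCA ler_wpM2l// h3.
- move=> e e0; have [|d d0 hd] := h4 (e / (c + 1)); first by rewrite divr_gt0// ltr_wpDl.
  exists d => //; apply: (@le_trans _ _ (c * (e / (c + 1)))); first by rewrite ler_wpM2l.
  rewrite mulrA ler_pdivrMr ?ltr_wpDl//; nra.
Qed.

Lemma wmod_powR (nu : R -> R) (d : R) : wmod nu -> 0 < d -> d <= 1 ->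
  wmod (fun t => nu (t `^ d)).
Proof.
move=> [h1 h2 h3 h4] d0 d1; split.
- by move=> t t0; rewrite h1// powR_ge0.
- move=> s t s0 st; apply: h2; first exact: powR_ge0.
  by apply: ge0_ler_powR; rewrite ?nnegrE ?(ltW d0)// (le_trans s0).
- move=> C t C1 t0; have C0 : 0 < C by rewrite (lt_le_trans ltr01).
  rewrite powRM ?(ltW C0)//.
  apply: (@le_trans _ _ (C `^ d * nu (t `^ d))).
    by apply: h3; rewrite ?powR_ge0// -(powRr0 C) ler_powR// ltW.
  rewrite ler_wpM2r ?h1 ?powR_ge0//.
  by rewrite -[leRHS]powRr1 ?ler_powR// ltW.
- move=> e e0; have [r r0 hr] := h4 e e0.
  exists (r `^ d^-1); first exact: powR_gt0.
  by rewrite -powRrM mulVf ?gt_eqF// powRr1// ltW.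
Qed.

(** If t < s, then s is the multiple s / t of t, and sublinear growth gives nu s <= (s / t) nu t.
    This is what allows a cutoff with derivative of order 1 / s, applied to a perturbation of size
    nu s, to keep the modulus nu. *)
Lemma wmod_le_scale (nu : R -> R) s t : wmod nu -> 0 < s -> 0 <= t ->
  Num.min 1 (t / s) * nu s <= nu t.
Proof.
move=> [h1 h2 h3 h4] s0 t0.
case: (leP s t) => st.
  have: 1 <= t / s by rewrite ler_pdivlMr// mul1r.
  by move=> /min_idPl ->; rewrite mul1r h2// ltW.
have [->|tN0] := eqVneq t 0.
  by rewrite mul0r min_r// mul0r h1.
have t0' : 0 < t by rewrite lt_def tN0.
rewrite min_r; last by rewrite ler_pdivrMr// mul1r ltW.
rewrite mulrAC ler_pdivrMr// mulrC.
have -> : s = s / t * t by rewrite divfK.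
apply: (@le_trans _ _ ((s / t * nu t) * t)); last by rewrite divfK// mulrAC divfK// mulrC.
by rewrite ler_wpM2r//; apply: h3 => //; rewrite ler_pdivlMr// mul1r ltW.
Qed.

End Moduli.

Section Convergence.
Variable R : realType.

(** The non-strict form lets a bound valid along the sequence pass to the limit unchanged, by
    [conv_le]. *)
Definition conv (W : normedModType R) (u : nat -> W) (l : W) : Prop :=
  forall e : R, 0 < e -> exists N, forall n, (N <= n)%N -> `|u n - l| <= e.

Definition cauchyc (W : normedModType R) (u : nat -> W) : Prop :=
  forall e : R, 0 < e -> exists N, forall n m, (N <= n)%N -> (N <= m)%N ->
    `|u n - u m| <= e.

Lemma cauchyc_conv (u : nat -> R^o) : cauchyc u -> exists l : R^o, conv u l.
Proof.
move=> hu.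
have : cvg (u @ \oo).
  apply: R_complete; apply/cauchy_ballP => e e0.
  have [N hN] := hu (e / 2) (divr_gt0 e0 (ltr0n R 2)).
  exists ([set u n | n in [set n | (N <= n)%N]], [set u n | n in [set n | (N <= n)%N]]).
    by split; exists N => //= n /= Nn; exists n.
  move=> [x y]/= [[n Nn <-] [m Nm <-]]; rewrite /ball/= (le_lt_trans (hN _ _ Nn Nm))//.
  lra.
move=> /cvg_ex[l /= /cvgrPdist_le hl]; exists l => e e0.
have [N _ hN] := hl e e0; exists N => n Nn.
by rewrite distrC; exact: hN.
Qed.

Lemma cauchyc_conv_mx (m n : nat) (u : nat -> 'M[R]_(m, n)) :
  cauchyc u -> exists l : 'M[R]_(m, n), conv u l.
Proof.
move=> hu.
have h i j : exists l : R^o, conv (fun k => u k i j : R^o) l.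
  apply: cauchyc_conv => e e0; have [N hN] := hu e e0; exists N => p q Np Nq.
  apply: le_trans (hN p q Np Nq).
  by have := le_mx_norm (u p - u q) i j; rewrite !mxE.
pose L := \matrix_(i, j) (projT1 (cid (h i j)) : R).
exists L => e e0.
have hc i j : exists N, forall k, (N <= k)%N -> `|u k i j - L i j| <= e.
  by rewrite mxE; case: cid => l /= /(_ e e0).
pose N i j := projT1 (cid (hc i j)).
exists (\max_i \max_j N i j)%N => k hk.
apply: mx_norm_le; first exact: ltW.
move=> i j; have := projT2 (cid (hc i j)) k.
have -> : (u k - L) i j = u k i j - L i j by rewrite !mxE.
apply.
apply: leq_trans hk.
by apply: leq_trans (leq_bigmax (F := fun i => (\max_j N i j)%N) i); exact: (leq_bigmax (F := N i)).
Qed.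

Lemma conv_le (W : normedModType R) (u : nat -> W) (l x : W) (K : R) :
  conv u l -> (exists N, forall n, (N <= n)%N -> `|u n - x| <= K) -> `|l - x| <= K.
Proof.
move=> hu [N hN]; apply/ler_addgt0Pl => e e0; have [M hM] := hu e e0.
have := ler_distD (u (maxn N M)) l x; move=> /le_trans; apply.
rewrite (distrC l); apply: lerD; [apply: hM|apply: hN]; by rewrite ?leq_maxl ?leq_maxr.
Qed.

Lemma conv_uniq (W : normedModType R) (u : nat -> W) (l l' : W) :
  conv u l -> conv u l' -> l = l'.
Proof.
move=> h h'; apply/eqP; rewrite -subr_eq0 -normr_le0; apply/ler_addgt0Pl => e e0.
by rewrite addr0; apply: (conv_le h); apply: h'.
Qed.

Lemma convD (W : normedModType R) (u v : nat -> W) (l m : W) :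
  conv u l -> conv v m -> conv (fun n => u n + v n) (l + m).
Proof.
move=> hu hv e e0; have e2 : 0 < e / 2 by rewrite divr_gt0.
have [N hN] := hu _ e2; have [M hM] := hv _ e2.
exists (maxn N M) => n; rewrite geq_max => /andP[Nn Mn].
rewrite opprD addrACA (le_trans (ler_normD _ _))//.
rewrite [leRHS](splitr e); apply: lerD; [exact: hN|exact: hM].
Qed.

Lemma conv_lip (W W' : normedModType R) (g : W -> W') (u : nat -> W) (l : W) (K : R) :
  (forall x, `|g x - g l| <= K * `|x - l|) -> conv u l -> conv (fun n => g (u n)) (g l).
Proof.
move=> hg hu e e0.
have K0 : 0 < Num.max K 1 by rewrite lt_max ltr01 orbT.
have [N hN] := hu (e / Num.max K 1) (divr_gt0 e0 K0); exists N => n Nn.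
apply: (le_trans (hg _)); apply: (@le_trans _ _ (Num.max K 1 * `|u n - l|)).
  by rewrite ler_wpM2r// le_max lexx.
by rewrite mulrC -ler_pdivlMr// hN.
Qed.

Lemma conv_shift (W : normedModType R) (u : nat -> W) (l : W) :
  conv u l -> conv (fun n => u n.+1) l.
Proof. by move=> h e /h [N hN]; exists N => n Nn; apply: hN; rewrite (leq_trans Nn). Qed.

Lemma conv_cst (W : normedModType R) (l : W) : conv (fun=> l) l.
Proof. by move=> e e0; exists 0%N => n _; rewrite subrr normr0 ltW. Qed.

Lemma cauchyc_series (W : normedModType R) (u : nat -> W) (s : nat -> R) (K : R) :
  (forall n, 0 <= s n) -> (forall n, `|u n.+1 - u n| <= s n) ->
  (forall n, \sum_(k < n) s k <= K) -> cauchyc u.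
Proof.
move=> s0 us sK e e0.
pose T (n : nat) : R := \sum_(k < n) s k.
have dist n m : (n <= m)%N -> `|u m - u n| <= T m - T n.
  elim: m => [|m ih]; first by rewrite leqn0 => /eqP ->; rewrite !subrr normr0.
  rewrite leq_eqVlt => /predU1P[->|]; first by rewrite !subrr normr0.
  rewrite ltnS => nm; have -> : u m.+1 - u n = (u m.+1 - u m) + (u m - u n).
    by rewrite addrA subrK.
  rewrite (le_trans (ler_normD _ _))// /T big_ord_recr/= -/(T m) (addrC (T m)) -addrA.
  by rewrite lerD// ih.
have Tmon n m : (n <= m)%N -> T n <= T m.
  by move=> /dist h; rewrite -subr_ge0 (le_trans _ h).
pose A := [set T n | n in [set: nat]].
have hA : has_sup A.
  by split; [exists (T 0%N), 0%N|exists K => _ [n _ <-]; exact: sK].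
have [_ [N _ <-] hN] := sup_adherent e0 hA.
have up n : (N <= n)%N -> T n - T N <= e.
  move=> Nn; have : T n <= sup A by apply: ub_le_sup; [case: hA|exists n].
  lra.
exists N => n m Nn Nm; wlog nm : n m Nn Nm / (n <= m)%N.
  move=> H; case: (leqP n m) => nm; first exact: H.
  by rewrite distrC; apply: H => //; exact: ltnW.
rewrite distrC (le_trans (dist _ _ nm))// (le_trans _ (up _ Nm))// lerB// Tmon//.
Qed.

End Convergence.

(** * Taylor pairs: mean value inequalities and limits *)

Section TaylorPairs.
Variable R : realType.
Variables (U W : normedModType R).
Implicit Types (f : U -> W) (D : U -> U -> W) (P : set U) (nu : R -> R).

(** [D] plays the derivative of [f]; linearity and continuity are not built in, so that each lemma
    asks for what it uses. A common [nu] for a whole sequence of pairs expresses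
    equidifferentiability. *)
Definition taylor P nu f D : Prop :=
  forall x y, P x -> P y -> `|f y - f x - D x (y - x)| <= nu `|y - x| * `|y - x|.

Definition seg_in P x y : Prop := forall s : R, 0 <= s <= 1 -> P (x + s *: (y - x)).

(** The segment is cut into N pieces so short that on each of them [nu] is at most e / d. The pieces
    add up to (K + e / d) d = K d + e. The modulus [nu] enters only qualitatively and leaves no
    trace in the conclusion. *)
Lemma taylor_lip P nu f D x y (K : R) :
  wmod nu -> taylor P nu f D -> seg_in P x y ->
  (forall z, P z -> `|z - x| <= `|y - x| -> forall v, `|D z v| <= K * `|v|) ->
  `|f y - f x| <= K * `|y - x|.
Proof.
move=> [n1 n2 n3 n4] tf sg hD.
have [->|xy] := eqVneq x y; first by rewrite !subrr !normr0 mulr0.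
set d := `|y - x|; have d0 : 0 < d by rewrite normr_gt0 subr_eq0 eq_sym.
apply/ler_addgt0Pl => e e0; have ed0 : 0 < e / d by rewrite divr_gt0.
have [r r0 hr] := n4 _ ed0.
pose N := (Num.truncn (d / r)).+1.
have N0 : (0 : R) < N%:R by rewrite ltr0n.
have hN : d / N%:R <= r.
  rewrite ler_pdivrMr// mulrC -ler_pdivrMr//.
  by apply: ltW; rewrite truncnS_gt.
pose z (k : nat) := x + (k%:R / N%:R) *: (y - x).
have zS k : z k.+1 - z k = N%:R^-1 *: (y - x).
  rewrite /z opprD addrACA subrr add0r -scalerBl -mulrBl -natr1.
  by congr (_ *: _); ring.
have zP k : (k <= N)%N -> P (z k).
  move=> kN; apply: sg; rewrite divr_ge0//= ler_pdivrMr// mul1r ler_nat//.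
have step k : (k < N)%N -> `|f (z k.+1) - f (z k)| <= (K + e / d) * (d / N%:R).
  move=> kN; have := tf (z k) (z k.+1) (zP _ (ltnW kN)) (zP _ kN).
  rewrite zS normrZ normfV (ger0_norm (ler0n _ _)) -/d mulrC => h.
  rewrite -[f _ - _](subrK (D (z k) (N%:R^-1 *: (y - x)))) (le_trans (ler_normD _ _))//.
  rewrite mulrDl addrC lerD//.
    apply: le_trans (hD _ (zP _ (ltnW kN)) _ _) _; last first.
      by rewrite normrZ normfV (ger0_norm (ler0n _ _)) -/d (mulrC N%:R^-1).
    rewrite /z addrAC subrr add0r normrZ -/d.
    rewrite ger0_norm ?divr_ge0// -[leRHS]mul1r ler_wpM2r ?ltW//.
    by rewrite ltr_pdivrMr// mul1r ltr_nat.
  rewrite (le_trans h)// (mulrC _ d) mulrC ler_wpM2r ?divr_ge0 ?(ltW d0)//.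
  by apply: le_trans hr; apply: n2; rewrite ?divr_ge0 ?(ltW d0).
have tot k : (k <= N)%N -> `|f (z k) - f (z 0%N)| <= k%:R * ((K + e / d) * (d / N%:R)).
  elim: k => [|k ih] kN; first by rewrite subrr normr0 mul0r.
  rewrite -(subrK (f (z k)) (f (z k.+1))) -addrA (le_trans (ler_normD _ _))//.
  rewrite -natr1 mulrDl mul1r [leRHS]addrC; apply: lerD; [exact: step|exact: ih (ltnW kN)].
have := tot N (leqnn _).
rewrite /z mul0r scale0r addr0 divff ?gt_eqF// scale1r addrCA subrr addr0 => /le_trans; apply.
rewrite le_eqVlt; apply/orP; left; apply/eqP; field.
by rewrite !gt_eqF.
Qed.

(** [taylor_lip] applied to f minus its affine part at x. It trades a remainder with a poor constant
    for the oscillation of [D] along the segment; this is how n-dependent Taylor constants become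
    uniform. *)
Lemma taylor_osc P nu f D x y (K : R) :
  wmod nu -> taylor P nu f D -> seg_in P x y ->
  (forall z u v, D z (u - v) = D z u - D z v) ->
  (forall z, P z -> `|z - x| <= `|y - x| -> forall v, `|D z v - D x v| <= K * `|v|) ->
  `|f y - f x - D x (y - x)| <= K * `|y - x|.
Proof.
move=> wn tf sg DB hD.
pose g z := f z - D x (z - x).
have D0 z : D z 0 = 0 by rewrite -(subrr 0) DB subrr.
have -> : f y - f x - D x (y - x) = g y - g x.
  by rewrite /g subrr D0 subr0 addrAC.
apply: (@taylor_lip P nu g (fun z v => D z v - D x v)) => //.
move=> u v Pu Pv; rewrite /g.
suff -> : f v - D x (v - x) - (f u - D x (u - x)) - (D u (v - u) - D x (v - u)) =
          f v - f u - D u (v - u) by exact: tf.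
have -> : D x (v - u) = D x (v - x) - D x (u - x) by rewrite -DB opprB addrA subrK.
set a := D x _; set b := D x _; set c := D u _.
by rewrite (opprB (f u)) (opprB c) (addrC b) (addrACA (f v)) (addrC (- a)) -(opprB a b) addrA addrNK.
Qed.

Lemma seg_in_ball (r : R) (x y : U) : `|x| < r -> `|y| < r ->
  seg_in [set z : U | `|z| < r] x y.
Proof.
move=> Px Py s /andP[s0 s1] /=.
have -> : x + s *: (y - x) = (1 - s) *: x + s *: y.
  by rewrite scalerBl scale1r scalerBr addrCA addrC.
rewrite (le_lt_trans (ler_normD _ _))// !normrZ (ger0_norm s0) ger0_norm ?subr_ge0//.
have [s0'|s0'] := eqVneq s 0; first by rewrite s0' subr0 mul1r mul0r addr0.
have s00 : 0 < s by rewrite lt_def s0'.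
have q1 : (1 - s) * `|x| <= (1 - s) * r by rewrite ler_wpM2l ?subr_ge0// ltW.
have q2 : s * `|y| < s * r by rewrite ltr_pM2l.
lra.
Qed.

End TaylorPairs.

Section TaylorLimits.
Variable R : realType.
Variables (U W : normedModType R).
Hypothesis Wcomplete : forall u : nat -> W, cauchyc u -> exists l, conv u l.

(** For a fixed small step s, the difference quotients of [f n] at x are Cauchy in n, and they
    approximate [D n x v] uniformly in n because the remainder is common. The four quarters of s * e
    are two Taylor remainders and two Cauchy errors. *)
Lemma taylor_limit_deriv (P : set U) nu (f : nat -> U -> W) (D : nat -> U -> U -> W) x v :
  wmod nu -> (forall n, taylor P nu (f n) (D n)) ->
  (forall z, P z -> cauchyc (fun n => f n z)) -> P x ->
  (exists2 r, 0 < r & forall s : R, 0 < s <= r -> P (x + s *: v)) ->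
  (forall n s, D n x (s *: v) = s *: D n x v) ->
  exists l, conv (fun n => D n x v) l.
Proof.
move=> [n1 n2 n3 n4] tf cf Px [r r0 hr] DZ; apply: Wcomplete => e e0.
have k0 : 0 < 4 * (`|v| + 1) :> R by rewrite mulr_gt0// ltr_wpDl.
have [d d0 hd] := n4 (e / (4 * (`|v| + 1))) (divr_gt0 e0 k0).
have v1 : 0 < `|v| + 1 :> R by rewrite ltr_wpDl.
pose s := Num.min r (d / (`|v| + 1)).
have s0 : 0 < s by rewrite lt_min r0 divr_gt0.
have sr : s <= r by rewrite ge_min lexx.
have sv : s * `|v| <= d.
  apply: (@le_trans _ _ (d / (`|v| + 1) * `|v|)).
    by rewrite ler_wpM2r// ge_min lexx orbT.
  rewrite mulrAC ler_pdivrMr// ler_wpM2l ?(ltW d0)//; lra.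
have Psv : P (x + s *: v) by apply: hr; rewrite s0 sr.
have se : 0 < s * e / 4 by rewrite divr_gt0// mulr_gt0.
have [N1 h1] := cf _ Px _ se; have [N2 h2] := cf _ Psv _ se.
exists (maxn N1 N2) => n m; rewrite !geq_max => /andP[n1N n2N] /andP[m1N m2N].
have key k : `|f k (x + s *: v) - f k x - s *: D k x v| <= s * e / 4.
  have := tf k x (x + s *: v) Px Psv.
  have -> : x + s *: v - x = s *: v by rewrite addrAC subrr add0r.
  rewrite normrZ (gtr0_norm s0) DZ => /le_trans; apply.
  apply: (@le_trans _ _ (e / (4 * (`|v| + 1)) * (s * `|v|))).
    rewrite ler_wpM2r ?mulr_ge0 ?(ltW s0)//; apply: le_trans hd.
    by apply: n2; rewrite ?mulr_ge0 ?(ltW s0).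
  have -> : e / (4 * (`|v| + 1)) * (s * `|v|) = s * e / 4 * (`|v| / (`|v| + 1)).
    by field; rewrite gt_eqF.
  rewrite -[leRHS]mulr1 ler_wpM2l ?(ltW se)// ler_pdivrMr//; lra.
rewrite -(ler_pM2l s0) -{1}(gtr0_norm s0) -normrZ scalerBr.
have A := key n; have B := key m; have C := h1 _ _ n1N m1N; have E := h2 _ _ n2N m2N.
set p := f n _ in A E; set p' := f m _ in B E; set q := f n x in A C; set q' := f m x in B C.
set y := s *: D n x v in A *; set y' := s *: D m x v in B *.
rewrite (le_trans (ler_distD (p - q) _ _))// distrC.
have := ler_distD (p' - q') (p - q) y'.
have : `|p - q - (p' - q')| <= s * e / 4 + s * e / 4.
  have -> : p - q - (p' - q') = (p - p') - (q - q') by rewrite !opprD !opprK addrACA.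
  by apply: (le_trans (ler_normB _ _)); rewrite lerD.
lra.
Qed.

End TaylorLimits.

Section Saddle.
Variable R : realType.

Lemma taylor_limit (U W : normedModType R) (P : set U) nu (f : nat -> U -> W) (D : nat -> U -> U -> W) g E :
  (forall n, taylor P nu (f n) (D n)) ->
  (forall z, P z -> conv (fun n => f n z) (g z)) ->
  (forall z v, P z -> conv (fun n => D n z v) (E z v)) -> taylor P nu g E.
Proof.
move=> tf cf cD x y Px Py.
have cN (u : nat -> W) (l : W) : conv u l -> conv (fun n => - u n) (- l).
  by move=> h e /h[N hN]; exists N => n /hN; rewrite -opprD normrN.
rewrite -[X in `|X| <= _]subr0.
apply: (@conv_le _ _ (fun n => f n y - f n x - D n x (y - x))).
  apply: convD; [apply: convD|]; [exact: cf|by apply: cN; exact: cf|by apply: cN; exact: cD].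
by exists 0%N => n _; rewrite subr0; exact: tf.
Qed.


Lemma addMxE (m n : nat) (A C : 'M[R]_(m, n)) i j : (A + C) i j = A i j + C i j.
Proof. by rewrite !mxE. Qed.

Lemma scaleMxE (m n : nat) (k : R) (A : 'M[R]_(m, n)) i j : (k *: A) i j = k * A i j.
Proof. by rewrite !mxE. Qed.

Lemma subMxE (m n : nat) (A C : 'M[R]_(m, n)) i j : (A - C) i j = A i j - C i j.
Proof. by rewrite !mxE. Qed.

Lemma mul_saddle0 (m : nat) (p q : R) (v : 'M[R]_(m, 2)) i :
  (v *m saddle p q) i 0 = v i 0 * p.
Proof. by rewrite /saddle mul_mx_diag !mxE. Qed.

Lemma mul_saddle1 (m : nat) (p q : R) (v : 'M[R]_(m, 2)) i :
  (v *m saddle p q) i 1 = v i 1 * q.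
Proof. by rewrite /saddle mul_mx_diag !mxE. Qed.

Lemma saddle_mul0 (m : nat) (p q : R) (v : 'M[R]_(2, m)) i :
  (saddle p q *m v) 0 i = p * v 0 i.
Proof. by rewrite /saddle mul_diag_mx !mxE. Qed.

Lemma saddle_mul1 (m : nat) (p q : R) (v : 'M[R]_(2, m)) i :
  (saddle p q *m v) 1 i = q * v 1 i.
Proof. by rewrite /saddle mul_diag_mx !mxE. Qed.

Lemma saddleV (p q : R) : p != 0 -> q != 0 ->
  saddle p q *m saddle p^-1 q^-1 = 1%:M.
Proof.
move=> p0 q0; apply/matrixP => i j; case: (ord2E i) => ->;
 case: (ord2E j) => ->; rewrite ?saddle_mul0 ?saddle_mul1 !mxE/=;
 by rewrite ?mulr1n ?mulr0n ?mulr0 ?divff.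
Qed.

End Saddle.

Section ConvMatrix.
Variable R : realType.

Lemma conv_wmod (W W' : normedModType R) (nu : R -> R) (g : W -> W') (u : nat -> W) (l : W) :
  wmod nu -> (forall x, `|g x - g l| <= nu `|x - l|) -> conv u l ->
  conv (fun n => g (u n)) (g l).
Proof.
move=> [_ n2 _ n4] hg hu e e0; have [d d0 hd] := n4 e e0; have [N hN] := hu d d0.
exists N => n Nn; apply: (le_trans (hg _)); apply: le_trans hd; apply: n2 => //; exact: hN.
Qed.

Lemma conv_bound (W : normedModType R) (u : nat -> W) (l : W) : conv u l ->
  exists N, forall n, (N <= n)%N -> `|u n| <= `|l| + 1.
Proof.
move=> /(_ 1 ltr01)[N hN]; exists N => n Nn.
by rewrite -{1}(subrK l (u n)) addrC (le_trans (ler_normD _ _))// lerD2l hN.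
Qed.

Lemma conv_mulmx (m p n : nat) (u : nat -> 'M[R]_(m, p)) (v : nat -> 'M[R]_(p, n)) U V :
  conv u U -> conv v V -> conv (fun k => u k *m v k) (U *m V).
Proof.
move=> hu hv e e0; have [N1 h1] := conv_bound hu.
pose K : R := p%:R * (`|U| + 1) + p%:R * `|V| + 1.
have K0 : 0 < K by rewrite ltr_wpDl// addr_ge0// mulr_ge0// addr_ge0.
have [N2 h2] := hu _ (divr_gt0 e0 K0); have [N3 h3] := hv _ (divr_gt0 e0 K0).
exists (maxn N1 (maxn N2 N3)) => k; rewrite !geq_max => /and3P[k1 k2 k3].
have -> : u k *m v k - U *m V = u k *m (v k - V) + (u k - U) *m V.
  by rewrite mulmxBr mulmxBl addrA subrK.
rewrite (le_trans (ler_normD _ _))//.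
apply: (@le_trans _ _ (p%:R * (`|U| + 1) * (e / K) + p%:R * (e / K) * `|V|)).
  rewrite lerD// (le_trans (mx_norm_mul _ _))//.
    by apply: ler_pM; rewrite ?mulr_ge0 ?ler_wpM2l ?h1 ?h3.
  by rewrite ler_wpM2r// ler_wpM2l// h2.
have -> : p%:R * (`|U| + 1) * (e / K) + p%:R * (e / K) * `|V| = (K - 1) / K * e.
  by rewrite /K; field; rewrite -/K gt_eqF.
by rewrite ler_piMl ?(ltW e0)// ler_pdivrMr// mul1r gerBl.
Qed.

Lemma conv_entry (m n : nat) (u : nat -> 'M[R]_(m, n)) U i j :
  conv u U -> conv (fun k => u k i j : R^o) (U i j).
Proof.
move=> hu e /hu[N hN]; exists N => k /hN; apply: le_trans.
by have := le_mx_norm (u k - U) i j; rewrite !mxE.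
Qed.

Lemma conv_ge (u : nat -> R^o) (l K : R) : conv u l -> (forall n, K <= u n) -> K <= l.
Proof.
move=> hu uK; apply/ler_addgt0Pr => e /hu[N /(_ N (leqnn N))].
by have := uK N; rewrite ler_norml => h /andP[h1 h2]; move: h h1 h2; rewrite /=; lra.
Qed.

(** A derivative in [0, K] is within K / 2 of K / 2, so f - (K / 2) t is K / 2-Lipschitz by
    [taylor_lip]; this is monotonicity of f. *)
Lemma nondecreasing_of_deriv (nu : R -> R) (f : R^o -> R^o) (df : R -> R) K :
  wmod nu -> taylor setT nu f (fun t s => s * df t) ->
  (forall t, 0 <= df t <= K) -> forall t t', t <= t' -> f t <= f t'.
Proof.
move=> wn tf hdf t t' tt'.
pose g (s : R^o) : R^o := f s - K / 2 * s.
have tg : taylor setT nu g (fun t s => s * (df t - K / 2)).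
  move=> x y _ _; have -> : g y - g x - (y - x) * (df x - K / 2) = f y - f x - (y - x) * df x.
    by rewrite /g; ring.
  exact: tf.
have : `|g t' - g t| <= K / 2 * `|t' - t|.
  apply: (taylor_lip wn tg) => // z _ _ v; rewrite normrM mulrC ler_wpM2r//.
  by rewrite ler_norml; have := hdf z; lra.
rewrite (ger0_norm (_ : 0 <= t' - t)) ?subr_ge0// ler_norml /g; lra.
Qed.

End ConvMatrix.

(** * The eigenfunction of the stable eigenvalue *)

Section Core.
Variable R : realType.
Variables (om S : R -> R) (kap l1 l2 L ep rho : R).
Local Notation V := 'rV[R]_2.
Variables (F G : V -> V) (B : V -> 'M[R]_2).
Local Notation a := `|l1|.
Local Notation b := `|l2|.
Local Notation Li := (saddle l1^-1 l2^-1).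
Hypotheses (wom : wmod om) (wS : wmod S).
Hypotheses (kap0 : 0 < kap) (kap1 : kap < 1).
Hypothesis S_step : forall t, 0 <= t -> om t + S (kap * t) <= S t.
Hypotheses (l10 : 0 < a) (l11 : a < 1) (l21 : 1 < b).
Hypotheses (FK : cancel F G) (GK : cancel G F) (F0 : F 0 = 0).
Hypothesis L0 : 0 <= L.
Hypothesis tG : forall x y, `|G y - G x - (y - x) *m B x| <= L * om `|y - x| * `|y - x|.
Hypothesis Bmod : forall x y, `|B x - B y| <= L * om `|x - y|.
Hypothesis B0 : B 0 = Li.
Hypothesis Beps : forall z, `|B z - Li| <= ep.
Hypothesis Bsupp : forall z, rho <= `|z| -> B z = Li.
Hypotheses (rho0 : 0 <= rho) (ep0 : 0 <= ep).
Hypothesis Flip : forall x y, `|F y - F x - (y - x) *m saddle l1 l2| <= 2 * ep * `|y - x|.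
Hypothesis Glip : forall x y, `|G y - G x - (y - x) *m Li| <= 2 * ep * `|y - x|.
(** One rate [kap] for three facts: G expands horizontally by at least 1 / kap, F expands vertically
    by at least 1 / kap, and G contracts vertically by kap, each with a margin of 8 * ep for the
    nonlinear part. *)
Hypothesis he1 : 1 <= (a^-1 - 8 * ep) * kap.
Hypothesis he2 : 1 <= (b - 8 * ep) * kap.
Hypothesis he3 : b^-1 + 8 * ep <= kap.

Local Notation e z := `|B z - Li|.

Let om_ge0 t : 0 <= t -> 0 <= om t. Proof. by case: wom => h _ _ _; exact: h. Qed.
Let om_le s t : 0 <= s -> s <= t -> om s <= om t.
Proof. by case: wom => _ h _ _; exact: h. Qed.
Let S_ge0 t : 0 <= t -> 0 <= S t. Proof. by case: wS => h _ _ _; exact: h. Qed.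
Let S_le s t : 0 <= s -> s <= t -> S s <= S t.
Proof. by case: wS => _ h _ _; exact: h. Qed.
Let S_C C t : 1 <= C -> 0 <= t -> S (C * t) <= C * S t.
Proof. by case: wS => _ _ h _; exact: h. Qed.
Let om_S t : 0 <= t -> om t <= S t.
Proof.
move=> t0; apply: le_trans (S_step t0); rewrite lerDl S_ge0// mulr_ge0//; exact: ltW.
Qed.

Let ai1 : 1 < a^-1. Proof. by rewrite invf_gt1. Qed.
Let bi0 : 0 < b^-1. Proof. by rewrite invr_gt0 (lt_trans ltr01). Qed.
Let bi1 : b^-1 < 1. Proof. by rewrite invf_lt1// (lt_trans ltr01). Qed.
Let ep8 : 8 * ep < 1. Proof. by have := he3; have := bi0; have := kap1; lra. Qed.
Let ai8 : 1 < a^-1 - 8 * ep.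
Proof. by have := he1; have := kap1; have := kap0; nra. Qed.
Let b8 : 1 < b - 8 * ep.
Proof. by have := he2; have := kap1; have := kap0; nra. Qed.
Let l1N0 : l1 != 0. Proof. by rewrite -normr_gt0. Qed.
Let G0 : G 0 = 0. Proof. by rewrite -{1}F0 FK. Qed.

(** * Backward orbits and the summability of the distances to the linear part *)

Lemma G_diff x y :
  [/\ `|(G y - G x) 0 0 - (y - x) 0 0 * l1^-1| <= 2 * ep * `|y - x| &
      `|(G y - G x) 0 1 - (y - x) 0 1 * l2^-1| <= 2 * ep * `|y - x|].
Proof.
split; apply: le_trans (Glip x y).
  have := le_mx_norm (G y - G x - (y - x) *m Li) 0 0.
  by rewrite (subMxE (_ - _)) mul_saddle0.
have := le_mx_norm (G y - G x - (y - x) *m Li) 0 1.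
by rewrite (subMxE (_ - _)) mul_saddle1.
Qed.

Lemma F_diff x y :
  [/\ `|(F y - F x) 0 0 - (y - x) 0 0 * l1| <= 2 * ep * `|y - x| &
      `|(F y - F x) 0 1 - (y - x) 0 1 * l2| <= 2 * ep * `|y - x|].
Proof.
split; apply: le_trans (Flip x y).
  have := le_mx_norm (F y - F x - (y - x) *m saddle l1 l2) 0 0.
  by rewrite (subMxE (_ - _)) mul_saddle0.
have := le_mx_norm (F y - F x - (y - x) *m saddle l1 l2) 0 1.
by rewrite (subMxE (_ - _)) mul_saddle1.
Qed.

Let absl (p q r : R) : `|p - q| <= r -> `|q| - r <= `|p| /\ `|p| <= `|q| + r.
Proof.
move=> h; have := ler_distD q p 0; have := ler_distD p q 0; rewrite !subr0 (distrC q); lra.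
Qed.

(** In the sector around the stable axis the new first coordinate is at least (a^-1 - 2 ep) |z 0 0|
    and the new second one at most (b^-1 + 2 ep) |z 0 0|, which is smaller. *)
Lemma horiz_step (z : V) : `|z 0 1| <= `|z 0 0| ->
  `|G z 0 1| <= `|G z 0 0| /\ `|z| <= kap * `|G z|.
Proof.
move=> hz; have nz : `|z| = `|z 0 0| by rewrite norm_rv2 max_l.
have [/absl[h1 _] /absl[_ h2]] := G_diff 0 z; move: h1 h2; rewrite G0 !subr0 !normrM !normfV.
rewrite nz => h1 h2.
have X0 := normr_ge0 (z 0 0); have Y0 := normr_ge0 (z 0 1).
have x1 : (a^-1 - 2 * ep) * `|z 0 0| <= `|G z 0 0| by move: h1; rewrite mulrC; lra.
have y1 : `|G z 0 1| <= (b^-1 + 2 * ep) * `|z 0 0|.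
  by apply: (le_trans h2); rewrite [leRHS]mulrDl; apply: lerD => //; rewrite mulrC ler_wpM2l// ltW.
have c1 : b^-1 + 2 * ep <= a^-1 - 2 * ep.
  by have := ai8; have := he3; have := kap1; have := ep0; lra.
split; first by apply: (le_trans y1); apply: le_trans x1; rewrite ler_wpM2r.
apply: (@le_trans _ _ (kap * `|G z 0 0|)); last by rewrite ler_pM2l// le_mx_norm.
apply: (@le_trans _ _ (kap * ((a^-1 - 2 * ep) * `|z 0 0|))); last by rewrite ler_pM2l.
rewrite mulrA -{1}(mul1r `|z 0 0|) ler_wpM2r//.
by apply: (le_trans he1); rewrite mulrC ler_pM2l//; have := ep0; lra.
Qed.

(** The sector condition bears on the image: the contraction is read from F, which expands the
    vertical part of [G z] on the way back to z. *)
Lemma vert_step (z : V) : `|G z 0 0| <= `|G z 0 1| -> `|G z| <= kap * `|z|.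
Proof.
move=> hz; have nz : `|G z| = `|G z 0 1| by rewrite norm_rv2 max_r.
have [_ /absl[h1 _]] := F_diff 0 (G z); move: h1; rewrite F0 !subr0 !normrM GK nz => h1.
have Y0 := normr_ge0 (G z 0 1).
have c : `|z 0 1| <= `|z| by exact: le_mx_norm.
have d : (b - 8 * ep) * `|G z 0 1| <= `|z|.
  have : (b - 8 * ep) * `|G z 0 1| <= (b - 2 * ep) * `|G z 0 1|.
    by rewrite ler_wpM2r//; have := ep0; lra.
  by move: h1; rewrite mulrC; lra.
apply: (@le_trans _ _ (kap * ((b - 8 * ep) * `|G z 0 1|))); last by rewrite ler_pM2l.
by rewrite mulrA -{1}(mul1r `|G z 0 1|) ler_wpM2r// mulrC.
Qed.

Lemma e_le z : e z <= L * om `|z|.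
Proof. by have := Bmod z 0; rewrite B0 subr0. Qed.

Lemma e_le_min z : e z <= L * om (Num.min `|z| rho) \/ e z = 0.
Proof.
case: (leP rho `|z|) => h; first by right; rewrite Bsupp// subrr normr0.
by left; rewrite e_le.
Qed.

Lemma e_step z t : 0 <= t -> t <= kap * Num.min `|z| rho ->
  e z + L * S t <= L * S (Num.min `|z| rho).
Proof.
move=> t0 ht; set r := Num.min _ _ in ht *.
have r0 : 0 <= r by rewrite le_min rho0 normr_ge0.
have h1 : L * S t <= L * S (kap * r) by rewrite ler_wpM2l// S_le.
have h2 : L * om r + L * S (kap * r) <= L * S r by rewrite -mulrDr ler_wpM2l// S_step.
have h3 : 0 <= L * om r by rewrite mulr_ge0// om_ge0.
by have [h|h] := e_le_min z; rewrite -/r in h; lra.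
Qed.

(** Norms grow along this part of the orbit, so the sum telescopes from its last point: each term is
    at most L (S |w| - S (kap |w|)), and |w| <= kap |G w|. The cap [rho] takes care of points
    outside the support of the perturbation, where the term vanishes. *)
Lemma e_sum_horiz n (z : V) : `|z 0 1| <= `|z 0 0| ->
  `|iter n G z 0 1| <= `|iter n G z 0 0| /\
  \sum_(k < n) e (iter k G z) <= L * S (Num.min (kap * `|iter n G z|) rho).
Proof.
move=> hz; elim: n => [|n [ih1 ih2]].
  split=> //; rewrite big_ord0 mulr_ge0// S_ge0// le_min rho0 mulr_ge0//; exact: ltW.
have [h1 h2] := horiz_step ih1; split; first by rewrite iterS.
rewrite big_ord_recr/= addrC.
set w := iter n G z in ih1 ih2 h1 h2 *.
have [hw|hw] := e_le_min w; last first.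
  rewrite hw add0r; apply: (le_trans ih2); rewrite ler_wpM2l// S_le//.
    by rewrite le_min rho0 mulr_ge0//; exact: ltW.
  rewrite le_min !ge_min lexx orbT andbT; apply/orP; left.
  rewrite ler_pM2l// (le_trans h2)// ler_piMl//; exact: ltW.
have [rw|rw] := leP rho `|w|.
  have -> : e w = 0 by rewrite Bsupp// subrr normr0.
  rewrite add0r; apply: (le_trans ih2); rewrite ler_wpM2l// S_le//.
    by rewrite le_min rho0 mulr_ge0//; exact: ltW.
  rewrite le_min !ge_min lexx orbT andbT; apply/orP; left.
  rewrite ler_pM2l// (le_trans h2)// ler_piMl//; exact: ltW.
have wm : Num.min `|w| rho = `|w| by rewrite min_l// ltW.
have : e w + L * S (Num.min (kap * `|w|) rho) <= L * S (Num.min `|w| rho).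
  apply: e_step; first by rewrite le_min rho0 mulr_ge0//; exact: ltW.
  by rewrite wm ge_min lexx.
rewrite wm; move: ih2; set s := \sum_(k < n) _; move=> ih2 h.
apply: (@le_trans _ _ (e w + L * S (Num.min (kap * `|w|) rho))); first by rewrite lerD2l.
apply: (le_trans h); rewrite ler_wpM2l// S_le// le_min h2 ltW//.
Qed.

(** As long as the next point lies above the diagonal the norm shrinks by kap, and the sum
    telescopes in S |z|. Once the orbit enters the horizontal sector it stays there and
    [e_sum_horiz] applies. Each phase costs at most L * S rho, which bounds the sum independently of
    n and z. *)
Lemma e_sum n z : \sum_(k < n) e (iter k G z) <= 2 * L * S rho.
Proof.
suff h : \sum_(k < n) e (iter k G z) <= L * S (Num.min `|z| rho) + L * S rho.
  apply: (le_trans h); have : L * S (Num.min `|z| rho) <= L * S rho.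
    by rewrite ler_wpM2l// S_le ?le_min ?rho0 ?normr_ge0// ge_min lexx orbT.
  lra.
elim: n z => [|n ih] z.
  by rewrite big_ord0 addr_ge0// mulr_ge0// S_ge0// le_min rho0 normr_ge0.
rewrite big_ord_recl/=.
have -> : \sum_(i < n) e (iter (bump 0 i) G z) = \sum_(i < n) e (iter i G (G z)).
  by apply: eq_bigr => i _; rewrite iterSr.
have r0 : 0 <= Num.min `|z| rho by rewrite le_min rho0 normr_ge0.
case: (leP `|G z 0 1| `|G z 0 0|) => hz; last first.
  have hk := vert_step (ltW hz).
  rewrite addrC; apply: (@le_trans _ _ (L * S (Num.min `|G z| rho) + L * S rho + e z)).
    by rewrite lerD2r.
  have [hw|hw] := leP rho `|z|.
    have -> : e z = 0 by rewrite Bsupp// subrr normr0.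
    rewrite addr0 lerD2r ler_wpM2l// S_le ?le_min ?normr_ge0 ?rho0//.
    by rewrite ge_min lexx orbT.
  have : e z + L * S (Num.min `|G z| rho) <= L * S (Num.min `|z| rho).
    apply: e_step; first by rewrite le_min rho0 normr_ge0.
    by rewrite (min_l (ltW hw)) ge_min hk.
  rewrite (min_l (ltW hw)); lra.
have [_ hs] := e_sum_horiz n hz.
rewrite lerD//.
  have : e z + L * S 0 <= L * S (Num.min `|z| rho).
    by apply: e_step => //; rewrite mulr_ge0// ltW.
  by rewrite (wmod0 wS) mulr0 addr0.
apply: (le_trans hs); rewrite ler_wpM2l// S_le//; last by rewrite ge_min lexx orbT.
by rewrite le_min rho0 mulr_ge0//; exact: ltW.
Qed.

(** * Products of derivatives along backward orbits *)

Local Notation C1 := (expR (2 * (2 * L * S rho))).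
Let M z := l1 *: B z.

(** This is l1^n times the derivative of G^n; as vectors are rows, the factor at the starting point
    stands on the left. The factor l1 in [M] turns [Li] into diag(1, l1 / l2), which does not
    expand. *)
Fixpoint Pi n (z : V) : 'M[R]_2 := if n is m.+1 then M z *m Pi m (G z) else 1%:M.

Lemma C1_ge1 : 1 <= C1.
Proof. by rewrite -expR0 ler_expR !mulr_ge0// S_ge0. Qed.

Lemma M_mul_le (k : nat) z (q : 'M[R]_(2, k)) : `|M z *m q| <= (1 + 2 * e z) * `|q|.
Proof.
have -> : M z = l1 *: Li + l1 *: (B z - Li) by rewrite -scalerDr addrC subrK.
rewrite mulmxDl mulrDl mul1r (le_trans (ler_normD _ _))// lerD//; last first.
  rewrite (le_trans (mx_norm_mul _ _))// ler_wpM2r// ler_wpM2l// normrZ.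
  by rewrite ler_piMl// ltW.
rewrite -scalemxAl; apply: mx_norm_le => // i j; rewrite mxE.
case: (ord2E i) => ->; rewrite ?saddle_mul0 ?saddle_mul1 mulrA normrM.
  by have -> : l1 / l1 = 1 by [rewrite mulfV]; rewrite normr1 mul1r le_mx_norm.
rewrite normrM normfV (le_trans _ (le_mx_norm q 1 j))// ler_piMl//.
by rewrite mulr_ile1// ?ltW// normr_ge0.
Qed.

Let Pe n z := expR (2 * \sum_(k < n) e (iter k G z)).

Lemma Pe_ge1 n z : 1 <= Pe n z.
Proof. by rewrite -expR0 ler_expR mulr_ge0// sumr_ge0. Qed.

Let Pe_ge0 n z : 0 <= Pe n z. Proof. exact: expR_ge0. Qed.

Lemma Pe_le n z : Pe n z <= C1.
Proof. by rewrite ler_expR ler_pM2l// e_sum. Qed.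

Lemma Pe_step n z : (1 + 2 * e z) * Pe n (G z) <= Pe n.+1 z.
Proof.
rewrite /Pe big_ord_recl/= mulrDr expRD.
have -> : \sum_(i < n) e (G (iter i G z)) = \sum_(i < n) e (iter i G (G z)).
  by apply: eq_bigr => i _; rewrite -iterS iterSr.
by rewrite ler_wpM2r ?expR_ge0// expR_ge1Dx.
Qed.

Lemma Pi_mul_Pe (k : nat) n z (q : 'M[R]_(2, k)) : `|Pi n z *m q| <= Pe n z * `|q|.
Proof.
elim: n z => [|n ih] z; first by rewrite mul1mx ler_peMl// Pe_ge1.
rewrite /= -mulmxA (le_trans (M_mul_le _ _))//.
apply: (@le_trans _ _ ((1 + 2 * e z) * (Pe n (G z) * `|q|))).
  by rewrite ler_wpM2l// addr_ge0// mulr_ge0.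
by rewrite mulrA ler_wpM2r// Pe_step.
Qed.

Lemma Pi_mul_le (k : nat) n z (q : 'M[R]_(2, k)) : `|Pi n z *m q| <= C1 * `|q|.
Proof. by apply: (le_trans (Pi_mul_Pe _ _ _)); rewrite ler_wpM2r// Pe_le. Qed.

Let norm1 : `|1%:M : 'M[R]_2| <= 1.
Proof.
apply: mx_norm_le => // i j; rewrite mxE; case: (i == j); by rewrite ?normr1 ?normr0.
Qed.

Lemma Pi_le_Pe n z : `|Pi n z| <= Pe n z.
Proof.
have := Pi_mul_Pe n z (1%:M : 'M[R]_2); rewrite mulmx1 => /le_trans; apply.
by rewrite ler_piMr ?expR_ge0.
Qed.

Lemma Pi_le n z : `|Pi n z| <= C1.
Proof. exact: (le_trans (Pi_le_Pe _ _) (Pe_le _ _)). Qed.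

Lemma PiD n m z : Pi (n + m) z = Pi n z *m Pi m (iter n G z).
Proof.
elim: n z => [|n ih] z; first by rewrite mul1mx.
by rewrite addSn /= ih mulmxA -iterSr.
Qed.

Lemma PiSr n z : Pi n.+1 z = Pi n z *m M (iter n G z).
Proof. by rewrite -[in LHS](addn1 n) PiD/= mulmx1. Qed.

(** Replacing one factor at a time leaves a difference of single factors between a prefix along the
    orbit of z' and a suffix along that of z. Both are bounded by the full exponentials, because
    [Pe] is at least 1 and absorbs each further factor. *)
Lemma Pi_diff_Pe n z z' : `|Pi n z - Pi n z'| <=
  Pe n z * Pe n z' * \sum_(k < n) (2 * `|M (iter k G z) - M (iter k G z')|).
Proof.
elim: n z z' => [|n ih] z z'; first by rewrite subrr normr0 big_ord0 mulr0.
rewrite /=; have -> : M z *m Pi n (G z) - M z' *m Pi n (G z') =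
  (M z - M z') *m Pi n (G z) + M z' *m (Pi n (G z) - Pi n (G z')).
  by rewrite mulmxBl mulmxBr addrA subrK.
rewrite big_ord_recl/=.
have -> : \sum_(i < n) 2 * `|M (G (iter i G z)) - M (G (iter i G z'))| =
  \sum_(i < n) 2 * `|M (iter i G (G z)) - M (iter i G (G z'))|.
  by apply: eq_bigr => i _; rewrite -!iterS !iterSr.
move: (ih (G z) (G z')); set s := \sum_(i < n) _ => hs.
have s0 : 0 <= s by apply: sumr_ge0 => i _; rewrite mulr_ge0.
have p1 := Pe_ge1 n (G z); have p2 := Pe_ge1 n (G z').
have q1 := Pe_step n z; have q2 := Pe_step n z'.
have E0 := normr_ge0 (B z - Li); have E0' := normr_ge0 (B z' - Li).
have r1 := Pe_ge1 n.+1 z; have r2 := Pe_ge1 n.+1 z'.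
have t1 : Pe n (G z) <= Pe n.+1 z.
  by apply: le_trans q1; rewrite ler_peMl ?Pe_ge0// lerDl mulr_ge0.
rewrite (le_trans (ler_normD _ _))// [leRHS]mulrDr lerD//.
  rewrite (le_trans (mx_norm_mul _ _))// mulrC ler_wpM2r ?mulr_ge0//.
  apply: (le_trans (Pi_le_Pe _ _)); apply: (le_trans t1).
  by rewrite ler_peMr ?Pe_ge0.
rewrite (le_trans (M_mul_le _ _))//.
apply: (@le_trans _ _ ((1 + 2 * e z') * (Pe n (G z) * Pe n (G z') * s))).
  by rewrite ler_wpM2l// addr_ge0// mulr_ge0.
rewrite mulrA ler_wpM2r//.
apply: (@le_trans _ _ (Pe n (G z) * ((1 + 2 * e z') * Pe n (G z')))).
  by rewrite mulrCA.
have w0 : 0 <= (1 + 2 * e z') * Pe n (G z') by rewrite mulr_ge0 ?Pe_ge0// addr_ge0// mulr_ge0.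
exact: ler_pM (Pe_ge0 _ _) w0 t1 q2.
Qed.

Local Notation C3 := (C1 * C1 * (2 * L)).

Lemma Pi_diff n z z' : `|Pi n z - Pi n z'| <=
  C3 * \sum_(k < n) om `|iter k G z - iter k G z'|.
Proof.
apply: (le_trans (Pi_diff_Pe _ _ _)).
have h : \sum_(k < n) (2 * `|M (iter k G z) - M (iter k G z')|) <=
   2 * L * \sum_(k < n) om `|iter k G z - iter k G z'|.
  rewrite mulr_sumr ler_sum// => k _; rewrite -mulrA ler_pM2l//.
  rewrite /M -scalerBr normrZ; apply: le_trans (Bmod _ _).
  by rewrite ler_piMl// ltW.
have s0 : 0 <= \sum_(k < n) (2 * `|M (iter k G z) - M (iter k G z')|).
  by apply: sumr_ge0 => k _; rewrite mulr_ge0.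
rewrite -[leRHS]mulrA; apply: ler_pM => //; first by rewrite mulr_ge0 ?Pe_ge0.
by apply: ler_pM; rewrite ?Pe_ge0 ?Pe_le.
Qed.

Local Notation li := l1^-1.

Lemma G_step_le x y : `|G y - G x| <= (a^-1 + 1) * `|y - x|.
Proof.
have -> : G y - G x = (y - x) *m Li + (G y - G x - (y - x) *m Li) by rewrite [RHS]addrC subrK.
rewrite (le_trans (ler_normD _ _))// mulrDl mul1r lerD//.
  apply: mx_norm_le; first by rewrite mulr_ge0// ltW// invr_gt0.
  move=> i j; case: (ord2E j) => ->; rewrite ?mul_saddle0 ?mul_saddle1 normrM normfV mulrC.
    by rewrite ler_pM2l ?invr_gt0// le_mx_norm.
  apply: ler_pM => //; last exact: le_mx_norm.
  by rewrite (le_trans (ltW bi1))// ltW.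
apply: (le_trans (Glip _ _)); rewrite ler_piMl//; have := ep8; have := ep0; lra.
Qed.

Lemma iter_taylor n : exists2 C, 0 <= C &
  taylor setT (fun t => C * om t) (iter n G) (fun z v => li ^+ n *: (v *m Pi n z)).
Proof.
elim: n => [|n [C C0 ih]].
  exists 0 => // x y _ _; rewrite /= expr0 scale1r mulmx1 subrr normr0 mulr_ge0//.
  by rewrite mulr_ge0// om_ge0.
set K := a^-1 + 1.
have K1 : 1 <= K by rewrite lerDr ltW// invr_gt0.
have K0 : 0 <= K by rewrite (le_trans ler01).
exists (C * K * K + a^-1 ^+ n * (2 * L * C1)).
  by rewrite addr_ge0// !mulr_ge0// ?exprn_ge0 ?expR_ge0// ltW// invr_gt0.
move=> x y _ _; rewrite !iterSr /=.
have -> : li ^+ n.+1 *: ((y - x) *m (M x *m Pi n (G x))) =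
          li ^+ n *: ((y - x) *m B x *m Pi n (G x)).
  by rewrite /M exprSr -scalemxAl -!scalemxAr scalerA -mulrA mulVf// mulr1 mulmxA.
have -> : iter n G (G y) - iter n G (G x) - li ^+ n *: ((y - x) *m B x *m Pi n (G x)) =
  (iter n G (G y) - iter n G (G x) - li ^+ n *: ((G y - G x) *m Pi n (G x)))
  + li ^+ n *: ((G y - G x - (y - x) *m B x) *m Pi n (G x)).
  by rewrite (mulmxBl (G y - G x)) scalerBr addrA subrK.
have d0 := normr_ge0 (y - x).
rewrite (le_trans (ler_normD _ _))// mulrDl mulrDl lerD//.
  apply: (le_trans (ih _ _ I I)); have hK := G_step_le x y.
  have o1 : om `|G y - G x| <= K * om `|y - x|.
    apply: (@le_trans _ _ (om (K * `|y - x|))); first exact: om_le.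
    by case: wom => _ _ h _; apply: h.
  have -> : C * K * K * om `|y - x| * `|y - x| = C * (K * om `|y - x|) * (K * `|y - x|) by ring.
  by apply: ler_pM => //; rewrite ?mulr_ge0 ?om_ge0// ler_wpM2l.
rewrite normrZ normrX normfV -[leRHS]mulrA -[leRHS]mulrA ler_wpM2l ?exprn_ge0 ?invr_ge0//.
apply: (le_trans (mx_norm_mul _ _)); rewrite mulr_natl -mulr_natl.
have -> : 2 * L * C1 * (om `|y - x| * `|y - x|) = 2 * (L * om `|y - x| * `|y - x|) * C1 by ring.
by apply: ler_pM; rewrite ?mulr_ge0//; [rewrite ler_pM2l// tG|exact: Pi_le].
Qed.

Local Notation C2 := (2 * C1).

Lemma iter_lip n x y : `|iter n G y - iter n G x| <= C2 * a^-1 ^+ n * `|y - x|.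
Proof.
have [C C0 tC] := iter_taylor n.
apply: (taylor_lip (wmod_scale wom C0) tC) => // z _ _ v.
rewrite normrZ normrX normfV.
apply: (@le_trans _ _ (a^-1 ^+ n * (2 * `|v| * C1))).
  rewrite ler_wpM2l ?exprn_ge0 ?invr_ge0//.
  by apply: (le_trans (mx_norm_mul _ _)); rewrite ler_wpM2l ?mulr_ge0// Pi_le.
by rewrite le_eqVlt; apply/orP; left; apply/eqP; ring.
Qed.

Let kai : 1 <= kap * a^-1.
Proof. by apply: (le_trans he1); rewrite mulrC ler_pM2l//; have := ep0; lra. Qed.

Lemma sum_om_growing n c : 0 <= c ->
  \sum_(k < n) om (c * a^-1 ^+ k) <= S (c * a^-1 ^+ n).
Proof.
move=> c0; have ap k : 0 <= a^-1 ^+ k by rewrite exprn_ge0// ltW// invr_gt0.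
(* The extra kap in the argument is what makes the induction close: the next term joins through
   [S_step], and kap * a^-1 >= 1 restores the form. *)
suff h : \sum_(k < n) om (c * a^-1 ^+ k) <= S (kap * (c * a^-1 ^+ n)).
  apply: (le_trans h); rewrite S_le ?mulr_ge0 ?(ltW kap0)//.
  by rewrite ler_piMl ?mulr_ge0// ltW.
elim: n => [|n ih].
  by rewrite big_ord0 S_ge0 ?mulr_ge0// ltW.
rewrite big_ord_recr/= addrC.
apply: (@le_trans _ _ (om (c * a^-1 ^+ n) + S (kap * (c * a^-1 ^+ n)))).
  by rewrite lerD2l.
apply: (le_trans (S_step _)); first by rewrite mulr_ge0.
rewrite S_le ?mulr_ge0// exprS.
have -> : kap * (c * (a^-1 * a^-1 ^+ n)) = kap * a^-1 * (c * a^-1 ^+ n) by ring.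
by rewrite ler_peMl// mulr_ge0.
Qed.

Lemma sum_om_decaying n c : 0 <= c -> \sum_(k < n) om (c * kap ^+ k) <= S c.
Proof.
elim: n c => [|n ih] c c0; first by rewrite big_ord0 S_ge0.
rewrite big_ord_recl/= expr0 mulr1; apply: le_trans (S_step c0); rewrite lerD2l.
apply: le_trans (ih (kap * c) _); last by rewrite mulr_ge0// ltW.
by rewrite ler_sum// => i _; rewrite exprS mulrCA mulrA.
Qed.

(** Separations grow at most like a^-k, so the moduli along the two orbits form a geometric sum
    dominated by [S] at the last separation. *)
Lemma Pi_S n z z' : `|Pi n z - Pi n z'| <= C3 * C2 * S (a^-1 ^+ n * `|z - z'|).
Proof.
have d0 := normr_ge0 (z - z').
have C20 : 1 <= C2 by have := C1_ge1; lra.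
have ap k : 0 <= a^-1 ^+ k by rewrite exprn_ge0// ltW// invr_gt0.
have C30 : 0 <= C3 by rewrite !mulr_ge0 ?expR_ge0.
apply: (le_trans (Pi_diff _ _ _)); rewrite -[leRHS]mulrA ler_wpM2l//.
apply: (@le_trans _ _ (\sum_(k < n) om (C2 * `|z - z'| * a^-1 ^+ k))).
  rewrite ler_sum// => k _; apply: om_le => //.
  by have := iter_lip k z' z; rewrite mulrAC.
apply: (le_trans (sum_om_growing _ _)); first by rewrite mulr_ge0// (le_trans ler01).
have -> : C2 * `|z - z'| * a^-1 ^+ n = C2 * (a^-1 ^+ n * `|z - z'|) by ring.
by rewrite S_C// mulr_ge0.
Qed.

(** * The stable manifold as a limit of curves *)

Local Notation e1 := (delta_mx 0 0 : V).
Local Notation Cc := (C3 * C2).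

Let Cc0 : 0 <= Cc. Proof. by rewrite !mulr_ge0 ?expR_ge0. Qed.

Let norm_e1 : `|e1| = 1.
Proof.
by rewrite norm_rv2 !mxE/= normr1 normr0 max_l.
Qed.

Let e1_mul_le (m : nat) (X : 'M[R]_(2, m)) : `|e1 *m X| <= `|X|.
Proof.
apply: mx_norm_le => // i j; rewrite mul2E !mxE/= !ord1 mul1r mul0r addr0.
exact: le_mx_norm.
Qed.

(* The limit [c] of these curves parametrizes the stable manifold by
   F (c t) = c (l1 * t). *)
Definition cn n (t : R^o) : V := iter n G ((l1 ^+ n * t) *: e1).
Definition dcn n (t : R^o) : V := e1 *m Pi n ((l1 ^+ n * t) *: e1).

(** The growth a^-n in [Pi_S] is cancelled exactly by the factor l1^n in the parameter, hence a
    modulus uniform in n. *)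
Lemma dcn_mod n t t' : `|dcn n t - dcn n t'| <= Cc * S `|t - t'|.
Proof.
rewrite /dcn -mulmxBr (le_trans (e1_mul_le _))// (le_trans (Pi_S _ _ _))//.
have -> : a^-1 ^+ n * `|(l1 ^+ n * t) *: e1 - (l1 ^+ n * t') *: e1| = `|t - t'| => //.
rewrite -scalerBl -mulrBr normrZ norm_e1 mulr1 normrM normrX mulrA -exprMn.
by rewrite mulVf ?expr1n ?mul1r// gt_eqF.
Qed.

(** A Taylor bound with a constant depending on n first, then [taylor_osc] with the uniform modulus
    of [dcn]. *)
Lemma cn_taylor n : taylor setT (fun d => Cc * S d) (cn n) (fun t s => s *: dcn n t).
Proof.
have [C C0 tC] := iter_taylor n.
have t0 : taylor setT (fun d => C * om d) (cn n) (fun (t : R^o) s => s *: dcn n t).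
  move=> x y _ _.
  have := tC ((l1 ^+ n * x) *: e1) ((l1 ^+ n * y) *: e1) I I.
  rewrite -scalerBl -mulrBr -scalemxAl scalerA -/(dcn n x) mulrA -exprMn mulVf// expr1n mul1r.
  rewrite normrZ norm_e1 mulr1 normrM normrX => /le_trans; apply.
  have an : a ^+ n <= 1 by rewrite exprn_ile1// ltW.
  have dn : a ^+ n * `|y - x| <= `|y - x| by rewrite ler_piMl.
  apply: ler_pM => //; rewrite ?mulr_ge0 ?om_ge0 ?mulr_ge0 ?exprn_ge0//.
  by rewrite ler_wpM2l// om_le// mulr_ge0// exprn_ge0.
move=> x y _ _.
apply: (taylor_osc (wmod_scale wom C0) t0) => //.
  by move=> z u v; rewrite scalerBl.
move=> z _ zx v; rewrite -scalerBr normrZ mulrC ler_wpM2r//.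
by rewrite (le_trans (dcn_mod _ _ _))// ler_wpM2l// S_le.
Qed.

(** Both points are n-th images under G, of [G z] and of its linearization [z *m Li], which differ
    by at most L om |z| |z|. The amplification a^-n is compensated by |z| = a^(n+1) |t|, and what
    remains is summable. *)
Lemma cn_step n t : `|cn n.+1 t - cn n t| <= C2 * L * `|t| * om (`|t| * kap ^+ n).
Proof.
rewrite /cn iterSr (le_trans (iter_lip _ _ _))//.
set z := (l1 ^+ n.+1 * t) *: e1.
have zn : `|z| = a ^+ n.+1 * `|t| by rewrite normrZ norm_e1 mulr1 normrM normrX.
have -> : (l1 ^+ n * t) *: e1 = z *m Li.
  rewrite -scalemxAl; have -> : e1 *m Li = l1^-1 *: e1.
    by apply: rv2P; rewrite ?mul_saddle0 ?mul_saddle1 !mxE/= ?mul1r ?mulr1 ?mul0r ?mulr0.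
  by rewrite scalerA exprS; congr (_ *: _); field.
have : `|G z - z *m Li| <= L * om `|z| * `|z|.
  by have := tG 0 z; rewrite G0 !subr0 B0.
rewrite zn => h.
have ak : a <= kap by move: kai; rewrite ler_pdivlMr// mul1r.
have an : a ^+ n.+1 * `|t| <= `|t| * kap ^+ n.
  rewrite mulrC ler_wpM2l// exprS (@le_trans _ _ (a ^+ n))//.
    by rewrite ler_piMl ?exprn_ge0// ltW.
  by rewrite lerXn2r// nnegrE ltW.
apply: (@le_trans _ _ (C2 * a^-1 ^+ n * (L * om (`|t| * kap ^+ n) * (a ^+ n * `|t|)))).
  rewrite ler_wpM2l ?mulr_ge0 ?expR_ge0 ?exprn_ge0 ?invr_ge0//.
  apply: (le_trans h); apply: ler_pM; rewrite ?mulr_ge0 ?om_ge0 ?mulr_ge0 ?exprn_ge0//.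
    by rewrite ler_wpM2l// om_le// mulr_ge0// exprn_ge0.
  by rewrite ler_wpM2r// exprS ler_piMl ?exprn_ge0// ltW.
have -> : C2 * a^-1 ^+ n * (L * om (`|t| * kap ^+ n) * (a ^+ n * `|t|)) =
  (a^-1 * a) ^+ n * (C2 * L * `|t| * om (`|t| * kap ^+ n)) by rewrite exprMn; ring.
by rewrite mulVf ?gt_eqF// expr1n mul1r.
Qed.

Lemma cn_cauchy t : cauchyc (fun n => cn n t).
Proof.
have k0 n : 0 <= `|t| * kap ^+ n by rewrite mulr_ge0// exprn_ge0// ltW.
have c20 : 0 <= C2 * L * `|t| by rewrite !mulr_ge0 ?expR_ge0.
apply: (@cauchyc_series _ _ _ (fun n => C2 * L * `|t| * om (`|t| * kap ^+ n)) (C2 * L * `|t| * S `|t|)).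
- by move=> n; rewrite mulr_ge0// om_ge0.
- exact: (fun n => cn_step n t).
- by move=> n; rewrite -mulr_sumr ler_wpM2l// sum_om_decaying.
Qed.

Lemma ex_c : exists cdc : (R^o -> V) * (R^o -> V), forall t,
  conv (fun n => cn n t) (cdc.1 t) /\ conv (fun n => dcn n t) (cdc.2 t).
Proof.
have h1 t := cauchyc_conv_mx (cn_cauchy t).
have h2 t : exists l, conv (fun n => dcn n t) l.
  have [||||l hl] := @taylor_limit_deriv R _ _ (@cauchyc_conv_mx R 1 2) setT _ cn
    (fun n t s => s *: dcn n t) t (1 : R^o) (wmod_scale wS Cc0) cn_taylor.
  - by move=> z _; exact: cn_cauchy.
  - by [].
  - by exists 1.
  - by move=> n s; rewrite scalerA /GRing.scale/= mulr1.
  by exists l => e' /hl [N hN]; exists N => n /hN; rewrite scale1r.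
exists (fun t => projT1 (cid (h1 t)), fun t => projT1 (cid (h2 t))) => t /=.
by split; case: cid.
Qed.

Let c := (projT1 (cid ex_c)).1.
Let dc := (projT1 (cid ex_c)).2.

Lemma c_lim t : conv (fun n => cn n t) (c t). Proof. by have [] := projT2 (cid ex_c) t. Qed.
Lemma dc_lim t : conv (fun n => dcn n t) (dc t). Proof. by have [] := projT2 (cid ex_c) t. Qed.

Lemma c_taylor : taylor setT (fun d => Cc * S d) c (fun t s => s *: dc t).
Proof.
have := @taylor_limit R R^o V setT (fun d => Cc * S d) cn (fun n t s => s *: dcn n t) c
  (fun t s => s *: dc t) cn_taylor.
apply=> [z _|z v _]; first exact: c_lim.
apply: (conv_lip (g := fun w : V => v *: w) (K := `|v|)); last exact: dc_lim.
by move=> x; rewrite -scalerBr normrZ.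
Qed.

Lemma dc_mod t t' : `|dc t - dc t'| <= Cc * S `|t - t'|.
Proof.
rewrite -[X in `|X|]subr0; apply: (conv_le (u := fun n => dcn n t - dcn n t')).
  apply: convD; first exact: dc_lim.
  apply: (conv_lip (g := fun w : V => - w) (K := 1)); last exact: dc_lim.
  by move=> x; rewrite -opprD normrN mul1r.
by exists 0%N => n _; rewrite subr0 dcn_mod.
Qed.

Lemma c0 : c 0 = 0.
Proof.
apply: (conv_uniq (c_lim 0)) => e' e0; exists 0%N => n _.
suff -> : cn n 0 = 0 by rewrite subrr normr0 ltW.
rewrite /cn mulr0 scale0r; elim: n => //= n ->; exact: G0.
Qed.

Let D0E : M 0 = saddle 1 (l1 / l2).
Proof.
rewrite /M B0; apply/matrixP => i j; rewrite /saddle !mxE.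
by case: (ord2E i) => ->; rewrite /= mulrnAr ?mulfV.
Qed.

Lemma dc0 : dc 0 = e1.
Proof.
apply: (conv_uniq (dc_lim 0)) => e' e0; exists 0%N => n _.
suff -> : dcn n 0 = e1 by rewrite subrr normr0 ltW.
rewrite /dcn mulr0 scale0r; elim: n => [|n ih]; first by rewrite mulmx1.
rewrite /= G0 D0E mulmxA; have -> : e1 *m saddle 1 (l1 / l2) = e1 => //.
by apply: rv2P; rewrite ?mul_saddle0 ?mul_saddle1 !mxE/= ?mulr1 ?mul0r.
Qed.

Lemma c_G t : G (c (l1 * t)) = c t.
Proof.
have h : conv (fun n => G (cn n (l1 * t))) (G (c (l1 * t))).
  apply: (conv_lip (K := a^-1 + 1)); last exact: c_lim.
  by move=> x; exact: G_step_le.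
apply: (conv_uniq h) => e' e0; have [N hN] := conv_shift (c_lim t) e0.
by exists N => n /hN; rewrite /cn iterS mulrA exprSr.
Qed.

Lemma dc_G t : dc (l1 * t) *m M (c (l1 * t)) = dc t.
Proof.
have h : conv (fun n => dcn n (l1 * t) *m M (cn n (l1 * t))) (dc (l1 * t) *m M (c (l1 * t))).
  apply: conv_mulmx; first exact: dc_lim.
  apply: (conv_wmod (wmod_scale wom L0)); last exact: c_lim.
  move=> x; rewrite /M -scalerBr normrZ (le_trans _ (Bmod _ _))// ler_piMl// ltW//.
apply: (conv_uniq h) => e' e0; have [N hN] := conv_shift (dc_lim t) e0.
exists N => n /hN; rewrite /dcn PiSr -mulmxA /cn.
by rewrite mulrA exprSr.
Qed.

(** The cone of slope 1 / 2 around the stable axis is preserved by [M]. The first entry loses at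
    most a factor 1 - 2 e at each step, and 1 <= (1 - 2 e)(1 + 4 e) because 8 e <= 1; the
    exponential of 4 times the sum of the e is at most C1 * C1 by [e_sum]. *)
Lemma dcn_cone n t :
  [/\ 2 * `|dcn n t 0 1| <= dcn n t 0 0 & (C1 * C1)^-1 <= dcn n t 0 0].
Proof.
rewrite /dcn; move: ((l1 ^+ n * t) *: e1) => z.
suff [h1 h2] : 2 * `|(e1 *m Pi n z) 0 1| <= (e1 *m Pi n z) 0 0 /\
   1 <= (e1 *m Pi n z) 0 0 * expR (4 * \sum_(k < n) e (iter k G z)).
  split=> //; have x0 : 0 <= (e1 *m Pi n z) 0 0 by apply: le_trans h1; rewrite mulr_ge0.
  rewrite -[leLHS]mul1r ler_pdivrMr ?mulr_gt0 ?expR_gt0//.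
  apply: (le_trans h2); rewrite ler_wpM2l// -expRD ler_expR.
  by have := e_sum n z; lra.
elim: n => [|n [ih1 ih2]].
  by rewrite mulmx1 big_ord0 mulr0 expR0 !mxE/= normr0 mulr0 mulr1; split.
rewrite PiSr mulmxA; set v := e1 *m Pi n z in ih1 ih2 *; set w := iter n G z.
rewrite big_ord_recr/= -/w mulrDr expRD; set s := expR _ in ih2 *.
have s0 : 0 < s by exact: expR_gt0.
have Y0 := normr_ge0 (v 0 1); have X0 : 0 <= v 0 0 by lra.
have nv : `|v| = v 0 0.
  by rewrite norm_rv2 (ger0_norm X0) max_l//; lra.
have Ew := Beps w; have Ew0 := normr_ge0 (B w - Li).
have -> : v *m M w = v *m M 0 + l1 *: (v *m (B w - Li)).
  by rewrite {2}/M B0 scalemxAr -mulmxDr -scalerDr addrC subrK.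
rewrite D0E; set r := l1 *: _.
have rn : `|r| <= 2 * v 0 0 * e w.
  rewrite normrZ (le_trans (_ : _ <= `|v *m (B w - Li)|))// ?ler_piMl//; first exact: ltW.
  by rewrite -nv mx_norm_mul.
have r0 : `|r 0 0| <= 2 * v 0 0 * e w by apply: le_trans rn; exact: le_mx_norm.
have r1 : `|r 0 1| <= 2 * v 0 0 * e w by apply: le_trans rn; exact: le_mx_norm.
rewrite !addMxE mul_saddle0 mul_saddle1 mulr1.
have x1 : v 0 0 * (1 - 2 * e w) <= v 0 0 + r 0 0.
  by move: r0; rewrite ler_norml => /andP[+ _]; lra.
have lb : `|l1 / l2| <= b^-1.
  by rewrite normrM normfV ler_piMl ?(ltW bi0)// ltW.
have y1 : `|v 0 1 * (l1 / l2) + r 0 1| <= `|v 0 1| * b^-1 + 2 * v 0 0 * e w.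
  rewrite (le_trans (ler_normD _ _))// lerD// normrM ler_wpM2l//.
have ep' := ep0; have bi' := bi0; have h3 := he3; have k1 := kap1.
split.
  apply: le_trans x1; apply: (@le_trans _ _ (2 * (`|v 0 1| * b^-1 + 2 * v 0 0 * e w))).
    by rewrite ler_pM2l.
  have t1 : 2 * `|v 0 1| * b^-1 <= v 0 0 * b^-1 by rewrite ler_wpM2r// ltW.
  have t2 : v 0 0 * e w <= v 0 0 * ep by rewrite ler_wpM2l.
  have t3 : v 0 0 * (b^-1 + 8 * ep) <= v 0 0 * 1 by rewrite ler_wpM2l//; lra.
  have t4 : 0 <= v 0 0 * ep by rewrite mulr_ge0.
  lra.
have ex1 : 1 + 4 * e w <= expR (4 * e w) by exact: expR_ge1Dx.
have p1 : 1 <= (1 - 2 * e w) * (1 + 4 * e w).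
  have : 8 * e w <= 1 by lra.
  by move: Ew0; set E := e w; nra.
apply: (le_trans ih2).
apply: (@le_trans _ _ (v 0 0 * (1 - 2 * e w) * (s * (1 + 4 * e w)))).
  have -> : v 0 0 * (1 - 2 * e w) * (s * (1 + 4 * e w)) = v 0 0 * s * ((1 - 2 * e w) * (1 + 4 * e w)) by ring.
  by rewrite ler_peMr// mulr_ge0// ltW.
have q0 : 0 <= 1 - 2 * e w by lra.
have g1 : 0 <= v 0 0 * (1 - 2 * e w) by rewrite mulr_ge0.
have g2 : 0 <= s * (1 + 4 * e w) by rewrite mulr_ge0 ?(ltW s0)//; lra.
have g3 : s * (1 + 4 * e w) <= s * expR (4 * e w) by rewrite ler_pM2l.
exact: ler_pM g1 g2 x1 g3.
Qed.

Local Notation c00 := ((C1 * C1)^-1).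

Lemma dc_cone t : [/\ 2 * `|dc t 0 1| <= dc t 0 0, c00 <= dc t 0 0 & `|dc t| <= C1].
Proof.
have h0 := conv_entry 0 0 (dc_lim t); have h1 := conv_entry 0 1 (dc_lim t).
split.
- rewrite -subr_ge0; apply: (conv_ge (u := fun n => dcn n t 0 0 - 2 * `|dcn n t 0 1|)).
    apply: convD => //; apply: (conv_lip (g := fun x : R^o => - (2 * `|x|) : R^o) (K := 2)) => // x.
    rewrite -opprD normrN -mulrBr normrM (ger0_norm (ler0n _ _)) ler_pM2l//.
    exact: ler_dist_dist.
  by move=> n; rewrite subr_ge0; case: (dcn_cone n t).
- by apply: (conv_ge h0) => n; case: (dcn_cone n t).
- rewrite -[X in `|X|]subr0; apply: (conv_le (dc_lim t)); exists 0%N => n _.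
  by rewrite subr0 (le_trans (e1_mul_le _))// Pi_le.
Qed.

(** Used for three linear forms: the first coordinate minus c00 t, which gives expansion of the
    parametrization, and the first coordinate plus or minus twice the second, which gives slope at
    most 1 / 2. *)
Lemma c_mono (p q r : R) : (forall t, 0 <= p * dc t 0 0 + q * dc t 0 1 + r) ->
  forall t t', t <= t' -> p * c t 0 0 + q * c t 0 1 + r * t <= p * c t' 0 0 + q * c t' 0 1 + r * t'.
Proof.
move=> h t t' tt'.
pose K := (`|p| + `|q|) * C1 + `|r|.
have wn := wmod_scale (wmod_scale wS Cc0) (addr_ge0 (normr_ge0 p) (normr_ge0 q)).
apply: (@nondecreasing_of_deriv _ _ (fun t => p * c t 0 0 + q * c t 0 1 + r * t)
  (fun t => p * dc t 0 0 + q * dc t 0 1 + r) K wn) => //; last first.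
  move=> s; rewrite h/= /K.
  have [_ _ dC] := dc_cone s.
  have d0 := le_trans (le_mx_norm (dc s) 0 0) dC; have d1 := le_trans (le_mx_norm (dc s) 0 1) dC.
  apply: lerD; last exact: ler_norm.
  rewrite mulrDl; apply: lerD; apply: (le_trans (ler_norm _)); rewrite normrM ler_wpM2l//.
move=> x y _ _; have := c_taylor I I (x := x) (y := y).
set d := `|y - x|; set w := c y - _ - _ => hw.
have -> : p * c y 0 0 + q * c y 0 1 + r * y - (p * c x 0 0 + q * c x 0 1 + r * x) -
   (y - x) * (p * dc x 0 0 + q * dc x 0 1 + r) = p * w 0 0 + q * w 0 1.
  by rewrite /w !mxE; ring.
rewrite (le_trans (ler_normD _ _))// !normrM.
have -> : (`|p| + `|q|) * (Cc * S d) * d = `|p| * (Cc * S d * d) + `|q| * (Cc * S d * d) by ring.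
by apply: lerD; rewrite ler_wpM2l// (le_trans (le_mx_norm _ _ _)).
Qed.

Let c000 : 0 < c00. Proof. by rewrite invr_gt0 mulr_gt0 ?expR_gt0. Qed.

Lemma c_incr t t' : t <= t' -> c00 * (t' - t) <= c t' 0 0 - c t 0 0.
Proof.
move=> /(@c_mono 1 0 (- c00)) h; have := h _; rewrite !mul1r !mul0r !addr0.
move=> H; suff : c t 0 0 + - c00 * t <= c t' 0 0 + - c00 * t' by lra.
by apply: H => s; have [_ + _] := dc_cone s; lra.
Qed.

Lemma c_flat t t' : 2 * `|c t' 0 1 - c t 0 1| <= `|c t' 0 0 - c t 0 0|.
Proof.
wlog tt' : t t' / t <= t'.
  by move=> H; case: (leP t t') => tt'; [exact: H|rewrite distrC (distrC (c t' 0 0)) H// ltW].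
have h1 := @c_mono 1 2 0 _ _ _ tt'; have h2 := @c_mono 1 (-2) 0 _ _ _ tt'.
have {}h1 : c t 0 0 + 2 * c t 0 1 <= c t' 0 0 + 2 * c t' 0 1.
  suff : 1 * c t 0 0 + 2 * c t 0 1 + 0 * t <= 1 * c t' 0 0 + 2 * c t' 0 1 + 0 * t' by lra.
  apply: h1 => s; have [+ _ _] := dc_cone s; have := ler_norm (- dc s 0 1); rewrite normrN; lra.
have {}h2 : c t 0 0 - 2 * c t 0 1 <= c t' 0 0 - 2 * c t' 0 1.
  suff : 1 * c t 0 0 + -2 * c t 0 1 + 0 * t <= 1 * c t' 0 0 + -2 * c t' 0 1 + 0 * t' by lra.
  by apply: h2 => s; have [+ _ _] := dc_cone s; have := ler_norm (dc s 0 1); lra.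
apply: le_trans (ler_norm _).
by rewrite -[2]ger0_norm// -normrM ler_norml; lra.
Qed.

Lemma c_lip t t' : `|c t' - c t| <= C1 * `|t' - t|.
Proof.
apply: (taylor_lip (wmod_scale wS Cc0) c_taylor) => // z _ _ v.
by rewrite normrZ mulrC ler_wpM2r//; case: (dc_cone z).
Qed.

Lemma c_surj x : exists t, c t 0 0 = x.
Proof.
pose T := `|x| / c00.
have T0 : 0 <= T by rewrite divr_ge0// ltW.
have cT : c00 * T = `|x| by rewrite /T mulrC divfK// gt_eqF.
have h1 : x <= c T 0 0.
  by have := c_incr T0; rewrite c0 mxE !subr0 cT; have := ler_norm x; lra.
have h2 : c (- T) 0 0 <= x.
  have NT : - T <= 0 by rewrite oppr_le0.
  have := c_incr NT; rewrite c0 mxE sub0r opprK cT sub0r; have := ler_norm (- x); rewrite normrN; lra.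
have cont : continuous (fun t : R^o => c t 0 0 : R^o).
  move=> t; apply/cvgrPdist_le => e' e0; near=> s.
  have -> : c t 0 0 - c s 0 0 = (c t - c s) 0 0 by rewrite subMxE.
  rewrite (le_trans (le_mx_norm _ _ _))// (le_trans (c_lip _ _))//.
  rewrite mulrC -ler_pdivlMr ?expR_gt0//.
  near: s; apply/nbhs_ballP; exists (e' / C1) => /=; first by rewrite divr_gt0// expR_gt0.
  by move=> s /ltW.
have [|||t _ <-] := @IVT R (fun t => c t 0 0) (- T) T x; last by exists t.
- by rewrite ge0_cp.
- by apply: continuous_subspaceT.
- by rewrite ge_min h2 le_max h1 orbT.
Unshelve. all: by end_near.
Qed.

(** * The linearization on the stable manifold and its rescaled pullbacks *)

Local Notation K := (C1 * C1).
Let K1 : 1 <= K. Proof. by rewrite mulr_ege1// C1_ge1. Qed.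
Let K0 : 0 <= K. Proof. exact: le_trans ler01 K1. Qed.

Definition hinv (x : R) : R := projT1 (cid (c_surj x)).

Lemma c_hinv x : c (hinv x) 0 0 = x.
Proof. by rewrite /hinv; case: cid. Qed.

Lemma c_expand t t' : `|t' - t| <= K * `|c t' 0 0 - c t 0 0|.
Proof.
wlog tt' : t t' / t <= t'.
  by move=> H; case: (leP t t') => tt'; [exact: H|rewrite distrC (distrC (c t' 0 0)) H// ltW].
rewrite ger0_norm ?subr_ge0//.
have := c_incr tt'; rewrite ler_pdivrMl ?mulr_gt0 ?expR_gt0// => /le_trans; apply.
by rewrite ler_wpM2l// ler_norm.
Qed.

Lemma hinv_c t : hinv (c t 0 0) = t.
Proof.
apply/eqP; rewrite -subr_eq0 -normr_le0 (le_trans (c_expand _ _))//.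
by rewrite c_hinv subrr normr0 mulr0.
Qed.

Lemma hinv_lip x y : `|hinv x - hinv y| <= K * `|x - y|.
Proof. by have := c_expand (hinv y) (hinv x); rewrite !c_hinv. Qed.

Lemma hinv0 : hinv 0 = 0.
Proof. by have := hinv_c 0; rewrite c0 mxE. Qed.

Definition dh (x : R) : R := (dc (hinv x) 0 0)^-1.

Lemma dc00_gt0 t : 0 < dc t 0 0.
Proof. by have [_ h _] := dc_cone t; exact: lt_le_trans h. Qed.

Lemma dh_le x : `|dh x| <= K.
Proof.
rewrite /dh normfV gtr0_norm ?dc00_gt0// -[leRHS]invrK lef_pV2 ?posrE ?dc00_gt0//.
by have [_ h _] := dc_cone (hinv x).
Qed.

Local Notation Ch := (K * K * K * Cc).
Let Ch0 : 0 <= Ch. Proof. by rewrite !mulr_ge0 ?expR_ge0. Qed.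

Lemma hinv_taylor x y : `|hinv y - hinv x - (y - x) * dh x| <= Ch * S `|y - x| * `|y - x|.
Proof.
set d := dc (hinv x) 0 0; have d0 : 0 < d by exact: dc00_gt0.
have := c_taylor I I (x := hinv x) (y := hinv y).
set r := c _ - _ - _ => hr.
have r00 : r 0 0 = (y - x) - (hinv y - hinv x) * d by rewrite /r !mxE !c_hinv.
have -> : hinv y - hinv x - (y - x) * dh x = - (r 0 0 * dh x).
  by rewrite r00 /dh -/d; field; rewrite gt_eqF.
rewrite normrN normrM.
have l := hinv_lip y x; have n0 := normr_ge0 (y - x).
have hS : S `|hinv y - hinv x| <= K * S `|y - x|.
  by apply: (le_trans (S_le _ l)) => //; exact: S_C.
apply: (@le_trans _ _ ((Cc * (K * S `|y - x|) * (K * `|y - x|)) * K)).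
  apply: ler_pM => //; last exact: dh_le.
  apply: (le_trans (le_mx_norm _ _ _)); apply: (le_trans hr).
  apply: ler_pM => //; first by rewrite mulr_ge0// S_ge0.
  by rewrite ler_wpM2l.
by rewrite le_eqVlt; apply/orP; left; apply/eqP; ring.
Qed.

Lemma inv_diff_le (p q k : R) : 0 < k -> k <= p -> k <= q ->
  `|p^-1 - q^-1| <= k^-1 * k^-1 * `|p - q|.
Proof.
move=> k0 kp kq; have p0 := lt_le_trans k0 kp; have q0 := lt_le_trans k0 kq.
have -> : p^-1 - q^-1 = p^-1 * q^-1 * (q - p) by field; rewrite !gt_eqF.
rewrite normrM distrC ler_wpM2r// normrM !gtr0_norm ?invr_gt0//.
by apply: ler_pM; rewrite ?invr_ge0 ?(ltW p0) ?(ltW q0)// lef_pV2 ?posrE.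
Qed.

Lemma dh_mod x y : `|dh x - dh y| <= Ch * S `|x - y|.
Proof.
have n0 := normr_ge0 (x - y).
have [_ hx _] := dc_cone (hinv x); have [_ hy _] := dc_cone (hinv y).
apply: (le_trans (inv_diff_le c000 hx hy)); rewrite invrK.
apply: (@le_trans _ _ (K * K * (Cc * (K * S `|x - y|)))); last first.
  by rewrite le_eqVlt; apply/orP; left; apply/eqP; ring.
rewrite ler_wpM2l ?mulr_ge0 ?expR_ge0//.
rewrite -subMxE (le_trans (le_mx_norm _ _ _))// (le_trans (dc_mod _ _))// ler_wpM2l//.
by apply: (le_trans (S_le _ (hinv_lip x y))) => //; exact: S_C.
Qed.

Local Notation f1 := (delta_mx 0 0 : 'cV[R]_2).
Let norm_f1 : `|f1| = 1.
Proof.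
apply/le_anti/andP; split; last by have := le_mx_norm f1 0 0; rewrite mxE/= normr1.
apply: mx_norm_le => // i j; rewrite mxE; case: (_ && _); by rewrite ?normr1 ?normr0.
Qed.

(** The derivative of z |-> hinv (z 0 0), a column because vectors are rows. *)
Definition Qv (z : V) : 'cV[R]_2 := dh (z 0 0) *: f1.

Lemma Qv_le z : `|Qv z| <= K.
Proof. by rewrite normrZ norm_f1 mulr1 dh_le. Qed.

Lemma Qv_mod z z' : `|Qv z - Qv z'| <= Ch * S `|z - z'|.
Proof.
rewrite /Qv -scalerBl normrZ norm_f1 mulr1 (le_trans (dh_mod _ _))// ler_wpM2l//.
by rewrite S_le// -subMxE le_mx_norm.
Qed.

Let mulQv (v : V) z : (v *m Qv z) 0 0 = v 0 0 * dh (z 0 0).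
Proof. by rewrite /Qv -scalemxAr mxE mul2E !mxE/= mulr1 mulr0 addr0 mulrC. Qed.

(* On the stable manifold [hinv] of the first coordinate linearizes F exactly;
   the eigenfunction is the limit of its rescaled pullbacks under G. *)
Definition phin n (z : V) : R^o := l1 ^+ n * hinv (iter n G z 0 0).
Definition qn n (z : V) : 'cV[R]_2 := Pi n z *m Qv (iter n G z).

Lemma qn_le n z : `|qn n z| <= C1 * K.
Proof.
by rewrite (le_trans (Pi_mul_le _ _ _))// ler_wpM2l ?expR_ge0// Qv_le.
Qed.

Lemma qnS n z : qn n.+1 z = M z *m qn n (G z).
Proof. by rewrite /qn /= mulmxA -iterS iterSr. Qed.

Lemma qnD n m z : qn (n + m) z = Pi n z *m qn m (iter n G z).
Proof. by rewrite /qn PiD -mulmxA addnC iterD. Qed.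

Lemma phin_taylor n : exists2 C, 0 <= C &
  taylor setT (fun d => C * S d) (phin n) (fun z v => (v *m qn n z) 0 0).
Proof.
have [C C0 tC] := iter_taylor n.
set k := C2 * a^-1 ^+ n.
have k1 : 1 <= k.
  have c1 := C1_ge1; apply: mulr_ege1; first by lra.
  by rewrite exprn_ege1// ltW.
have k0 : 0 <= k by exact: le_trans ler01 k1.
exists (Ch * k * k + 2 * C * K); first by rewrite addr_ge0// !mulr_ge0 ?expR_ge0.
move=> x y _ _.
have dl := iter_lip n x y; rewrite -/k in dl.
have := tC x y I I; have := hinv_taylor (iter n G x 0 0) (iter n G y 0 0).
set X := iter n G x in dl *; set Y := iter n G y in dl *.
set r := Y - X - _; set r1 := hinv _ - _ - _; set d := `|y - x|.
move=> h1 h2; have d0 : 0 <= d by exact: normr_ge0.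
have -> : phin n y - phin n x - ((y - x) *m qn n x) 0 0 =
    l1 ^+ n * (r1 + (r *m Qv X) 0 0).
  have -> : (r *m Qv X) 0 0 = (Y 0 0 - X 0 0) * dh (X 0 0) - li ^+ n * ((y - x) *m Pi n x *m Qv X) 0 0.
    by rewrite /r (mulmxBl (Y - X)) -scalemxAl subMxE mulQv scaleMxE subMxE.
  rewrite /phin /qn mulmxA -/X -/Y /r1.
  set p := ((y - x) *m _ *m _) 0 0.
  have pE : p = l1 ^+ n * (li ^+ n * p) by rewrite mulrA -exprMn mulfV// expr1n mul1r.
  by rewrite {1}pE; ring.
rewrite normrM normrX (@le_trans _ _ (1 * `|r1 + (r *m Qv X) 0 0|))//.
  by rewrite ler_wpM2r// exprn_ile1// ltW.
rewrite mul1r (le_trans (ler_normD _ _))// mulrDl mulrDl lerD//.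
  apply: (le_trans h1).
  have dx : `|Y 0 0 - X 0 0| <= k * d.
    by rewrite -subMxE (le_trans (le_mx_norm _ _ _)).
  have -> : Ch * k * k * S d * d = Ch * (k * S d) * (k * d) by ring.
  apply: ler_pM => //; first by rewrite mulr_ge0// S_ge0.
  rewrite ler_wpM2l//; apply: (le_trans (S_le _ dx)) => //; exact: S_C.
rewrite (le_trans (le_mx_norm _ _ _))// (le_trans (mx_norm_mul _ _))//.
have -> : 2 * C * K * S d * d = 2 * (C * S d * d) * K by ring.
apply: ler_pM; rewrite ?mulr_ge0 ?Qv_le// ler_pM2l// (le_trans h2)// ler_wpM2r//.
by rewrite ler_wpM2l// om_S.
Qed.

(** * Shadowing by points of the stable manifold *)

Let vert (u : V) := 2 * `|u 0 0| <= `|u 0 1|.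

Let vert_norm u : vert u -> `|u| = `|u 0 1|.
Proof.
rewrite /vert => h; rewrite norm_rv2 max_r//; have := normr_ge0 (u 0 0); lra.
Qed.

(** The steep cone is invariant and expanded under F; with the hypothesis on the images under G,
    this reads as a contraction of G. Steepness thus passes from later backward images to earlier
    ones. *)
Lemma vert_F u v : vert (G u - G v) -> vert (u - v) /\ `|G u - G v| <= kap * `|u - v|.
Proof.
move=> hv; have nv := vert_norm hv.
have [/absl[_ h1] /absl[h2 _]] := F_diff (G v) (G u); move: h1 h2.
rewrite !GK !normrM nv; move: hv; rewrite /vert => hv h1 h2.
set X := `|(G u - G v) 0 0| in hv h1 *; set Y := `|(G u - G v) 0 1| in hv h1 h2 *.
have Y0 : 0 <= Y by exact: normr_ge0.
have ep' := ep0; have b8' := b8.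
have aX : X * a <= X by rewrite ler_piMr ?normr_ge0// ltW.
have bY : (1 + 8 * ep) * Y <= b * Y by rewrite ler_wpM2r//; lra.
have eY : 0 <= ep * Y by rewrite mulr_ge0.
have vuv : vert (u - v) by rewrite /vert; lra.
split=> //; rewrite (vert_norm vuv).
apply: (@le_trans _ _ (kap * ((b - 8 * ep) * Y))).
  by rewrite mulrA ler_peMl// mulrC.
by rewrite ler_pM2l//; lra.
Qed.

(** The crude rate [kap] would spoil the exponent [delta]. Here the rate is exactly b^-1, up to a
    factor whose deviation from 1 is summable along the orbit. *)
Lemma vert_sharp u w : vert (G u - G w) ->
  `|G u - G w| <= b^-1 * (1 + b * (2 * e w + L * om `|u - w|)) * `|u - w|.
Proof.
move=> /vert_norm ->; set d := `|u - w|; have d0 : 0 <= d by exact: normr_ge0.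
have b0 : b != 0 by rewrite gt_eqF// (lt_trans ltr01).
have -> : b^-1 * (1 + b * (2 * e w + L * om d)) * d =
   b^-1 * d + 2 * d * e w + L * om d * d by field.
have -> : G u - G w = (u - w) *m Li + (u - w) *m (B w - Li) + (G u - G w - (u - w) *m B w).
  by rewrite -mulmxDr (addrC Li) subrK [RHS]addrC subrK.
rewrite (addMxE (_ + _)) (addMxE (_ *m Li)) mul_saddle1 (le_trans (ler_normD _ _))// lerD//; last first.
  by rewrite (le_trans (le_mx_norm _ _ _))// tG.
rewrite (le_trans (ler_normD _ _))// lerD//.
  by rewrite normrM normfV mulrC ler_pM2l// le_mx_norm.
by rewrite (le_trans (le_mx_norm _ _ _))// mx_norm_mul.
Qed.

(* The point of the stable manifold whose m-th backward image has the same first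
   coordinate as that of z: the two backward orbits differ by vertical vectors,
   which G contracts, so z may be replaced by a point where [qn] is controlled. *)
Definition wm m (z : V) : V := c (l1 ^+ m * hinv (iter m G z 0 0)).
(** [wm 0 z] has the same first coordinate as z, so this is the vertical distance to the stable
    manifold. *)
Definition vdist (z : V) : R := `|z - wm 0 z|.

Lemma vdist_ge0 z : 0 <= vdist z. Proof. exact: normr_ge0. Qed.

Lemma wm_G m z : G (wm m.+1 z) = wm m (G z).
Proof. by rewrite /wm iterSr exprS -mulrA c_G. Qed.

Lemma iter_wm k m z : iter k G (wm (k + m) z) = wm m (iter k G z).
Proof. by elim: k z => [|k ih] z //; rewrite addSn iterSr wm_G ih -iterSr. Qed.

Lemma wm0_00 z : wm 0 z 0 0 = z 0 0.
Proof. by rewrite /wm expr0 mul1r c_hinv. Qed.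

(** The m-th backward images differ exactly vertically, having the same first coordinate; [vert_F]
    carries the cone condition back to time 0. *)
Lemma vert_wm m z : vert (z - wm m z).
Proof.
elim: m z => [|m ih] z.
  by rewrite /vert subMxE wm0_00 subrr normr0 mulr0.
by have [] := @vert_F z (wm m.+1 z); rewrite // wm_G.
Qed.

Lemma wm_decay k m z :
  `|iter k G z - iter k G (wm (k + m) z)| <= `|z - wm (k + m) z| * kap ^+ k.
Proof.
elim: k z => [|k ih] z; first by rewrite expr0 mulr1.
rewrite !iterSr addSn wm_G (le_trans (ih _))// exprS mulrA ler_wpM2r ?exprn_ge0 ?(ltW kap0)//.
have [|_ h] := @vert_F z (wm (k + m).+1 z); first by rewrite wm_G vert_wm.
by move: h; rewrite wm_G mulrC.
Qed.

(** A bootstrap: the crude decay [wm_decay] makes the moduli of the distances summable with total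
    [S d], and [vert_sharp] then yields the rate b^-1 with the exponential of these sums as a
    constant. *)
Lemma wm_decay_sharp n m z (d := `|z - wm (n + m) z|) :
  `|iter n G z - iter n G (wm (n + m) z)| <=
  b^-1 ^+ n * expR (b * (4 * L * S rho + L * S d)) * d.
Proof.
have d0 : 0 <= d by exact: normr_ge0.
have b0 : 0 < b by exact: lt_trans l21.
suff h k : (k <= n)%N -> `|iter k G z - iter k G (wm (n + m) z)| <=
    b^-1 ^+ k * expR (b * (2 * \sum_(j < k) e (iter j G (wm (n + m) z)) +
      L * \sum_(j < k) om (d * kap ^+ j))) * d.
  apply: (le_trans (h _ (leqnn n))); rewrite ler_wpM2r// ler_wpM2l ?exprn_ge0 ?invr_ge0//.
  rewrite ler_expR ler_pM2l// lerD//; last by rewrite ler_wpM2l// sum_om_decaying.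
  by have := e_sum n (wm (n + m) z); lra.
elim: k => [|k ih] kn.
  by rewrite !big_ord0 !mulr0 addr0 mulr0 expR0 expr0 !mul1r.
have := ih (ltnW kn); set w := wm (n + m) z; rewrite !iterS.
set u := iter k G z; set v := iter k G w => hk.
have nm : (n + m = k + (n - k + m))%N by rewrite addnA subnKC// ltnW.
have nm1 : (n + m = k.+1 + (n - k.+1 + m))%N by rewrite addnA subnKC.
have dk : `|u - v| <= d * kap ^+ k.
  by rewrite /u /v /w /d nm wm_decay.
have vv : vert (G u - G v).
  by rewrite /u /v /w -!iterS nm1 iter_wm vert_wm.
apply: (le_trans (vert_sharp vv)).
rewrite !big_ord_recr/=.
set s1 := \sum_(j < k) _; set s2 := \sum_(j < k) _.
have -> : b * (2 * (s1 + `|B v - Li|) + L * (s2 + om (d * kap ^+ k))) =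
  b * (2 * s1 + L * s2) + b * (2 * `|B v - Li| + L * om (d * kap ^+ k)) by ring.
rewrite expRD exprS.
set E1 := expR (b * (2 * s1 + L * s2)); set E2 := expR _.
have -> : b^-1 * b^-1 ^+ k * (E1 * E2) * d = b^-1 * E2 * (b^-1 ^+ k * E1 * d) by ring.
have o0 : 0 <= om `|u - v| by rewrite om_ge0.
apply: ler_pM => //.
  by rewrite mulr_ge0 ?invr_ge0 ?(ltW b0)// addr_ge0// mulr_ge0 ?(ltW b0)// addr_ge0// mulr_ge0.
rewrite ler_pM2l ?invr_gt0//; apply: (le_trans (expR_ge1Dx _)).
rewrite ler_expR ler_pM2l// lerD2l ler_wpM2l// om_le//.
Qed.

(** Both [wm m z] and [wm 0 z] lie on a curve of slope at most 1 / 2 while z - wm m z is steep, so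
    moving along the curve at most doubles the distance. *)
Lemma wm_le m z : `|z - wm m z| <= 2 * vdist z.
Proof.
have vz := vert_wm m z; rewrite (vert_norm vz) /vdist (vert_norm (vert_wm 0 z)).
have := c_flat (l1 ^+ m * hinv (iter m G z 0 0)) (l1 ^+ 0 * hinv (iter 0 G z 0 0)).
rewrite -/(wm m z) -/(wm 0 z) wm0_00; move: vz; rewrite /vert !subMxE => h1 h2.
have := ler_distD (wm 0 z 0 1) (z 0 1) (wm m z 0 1).
have := normr_ge0 (z 0 1 - wm 0 z 0 1); have := normr_ge0 (z 0 1 - wm m z 0 1); lra.
Qed.

Local Notation Dm := (1 + C1 * K).

Lemma vdist_le z : `|z| <= 1 -> vdist z <= Dm.
Proof.
move=> z1; rewrite /vdist (le_trans (ler_normB _ _))// lerD//.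
rewrite /wm expr0 mul1r /=; have := c_lip 0 (hinv (z 0 0)); rewrite c0 !subr0 => /le_trans; apply.
rewrite ler_wpM2l ?expR_ge0//; have := hinv_lip (z 0 0) 0; rewrite hinv0 !subr0 => /le_trans; apply.
by rewrite ler_piMr// (le_trans (le_mx_norm _ _ _)).
Qed.

Lemma vdist_iter n z : vdist (iter n G z) <=
  b^-1 ^+ n * (expR (b * (4 * L * S rho + L * S (2 * vdist z))) * (2 * vdist z)).
Proof.
have b0 : 0 < b by exact: lt_trans l21.
have := wm_decay_sharp n 0 z; rewrite iter_wm addn0 -/(vdist _) => /le_trans; apply.
have h := wm_le n z; rewrite -mulrA ler_wpM2l ?exprn_ge0 ?invr_ge0//.
apply: ler_pM => //; rewrite ?expR_ge0// ler_expR ler_pM2l// lerD2l ler_wpM2l//.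
by rewrite S_le.
Qed.

(** On the stable manifold G multiplies [hinv] of the first coordinate by l1^-1 exactly. Comparing u
    = G^n z with [wm 0 u], the increment is at most a^n times a multiple of [vdist u], which is
    bounded along the orbit; the series is geometric. *)
Lemma phin_cauchy z : cauchyc (fun n => phin n z).
Proof.
have b0 : 0 < b by exact: lt_trans l21.
pose E := expR (b * (4 * L * S rho + L * S (2 * vdist z))) * (2 * vdist z).
have E0 : 0 <= E by rewrite mulr_ge0 ?expR_ge0// mulr_ge0// vdist_ge0.
pose k := K * ((a^-1 + 1) * E).
have ai0 : 0 <= a^-1 + 1 by rewrite addr_ge0 ?invr_ge0.
have k0 : 0 <= k by rewrite mulr_ge0// mulr_ge0.
apply: (@cauchyc_series _ _ _ (fun n => k * a ^+ n) (k * (1 - a)^-1)).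
- by move=> n; rewrite mulr_ge0// exprn_ge0.
- move=> n; rewrite /phin iterS; set u := iter n G z.
  have -> : l1 ^+ n.+1 * hinv (G u 0 0) - l1 ^+ n * hinv (u 0 0) =
      l1 ^+ n * (l1 * (hinv (G u 0 0) - hinv (G (wm 0 u) 0 0))).
    have -> : hinv (G (wm 0 u) 0 0) = hinv (u 0 0) / l1.
      have := c_G (hinv (u 0 0) / l1); rewrite mulrC divfK// => h.
      by rewrite /wm expr0 mul1r /= h hinv_c.
    by rewrite exprSr; field.
  rewrite normrM normrX mulrC ler_wpM2r ?exprn_ge0// normrM.
  apply: (@le_trans _ _ (1 * (K * `|G u 0 0 - G (wm 0 u) 0 0|))).
    by apply: ler_pM => //; [exact: ltW|exact: hinv_lip].
  rewrite mul1r /k ler_wpM2l// -subMxE (le_trans (le_mx_norm _ _ _))//.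
  rewrite (le_trans (G_step_le _ _))// ler_wpM2l// -/(vdist u).
  apply: (le_trans (vdist_iter _ _)); rewrite -/E ler_piMl// exprn_ile1 ?invr_ge0// ltW//.
move=> n; rewrite -mulr_sumr ler_wpM2l//.
have a1 : 0 < 1 - a by rewrite subr_gt0.
rewrite -[leRHS]mul1r ler_pdivlMr// mulrC.
have := subrXX 1 a n; rewrite expr1n => h.
have -> : \sum_(i < n) a ^+ i = \sum_(i < n) 1 ^+ (n.-1 - i) * a ^+ i.
  by apply: eq_bigr => i _; rewrite expr1n mul1r.
by rewrite -h lerBlDr lerDl exprn_ge0.
Qed.

(** The chain rule for [phin m (c t) = t], carried out on the derivatives. *)
Lemma dc_qn m t : (dc t *m qn m (c t)) 0 0 = 1.
Proof.
elim: m t => [|m ih] t.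
  by rewrite /qn /= mul1mx mulQv /dh hinv_c mulfV// gt_eqF// dc00_gt0.
have tl : l1 * (t / l1) = t by field.
have := dc_G (t / l1); have := c_G (t / l1); rewrite !tl => h1 h2.
by rewrite qnS mulmxA h1 -[M (c t)]/(M (c t)) -{1}tl; have := ih (t / l1); rewrite -h2 tl.
Qed.

(** Bounded with modulus [S]: a class closed under sums, products and the substitution of t / l1 for
    t, which covers the coefficients of the recursion below. *)
Let bS (f : R -> R) (C : R) :=
  (forall t, `|f t| <= C) /\ (forall t t', `|f t - f t'| <= C * S `|t - t'|).

Let bS_ge0 f C : bS f C -> 0 <= C.
Proof. by move=> [h _]; exact: le_trans (h 0). Qed.

Let bSD f g C C' : bS f C -> bS g C' -> bS (fun t => f t + g t) (C + C').
Proof.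
move=> [f1 f2] [g1 g2]; split=> [t|t t'].
  by rewrite (le_trans (ler_normD _ _))// lerD.
by rewrite opprD addrACA mulrDl (le_trans (ler_normD _ _))// lerD.
Qed.

Let bSN f C : bS f C -> bS (fun t => - f t) C.
Proof. by move=> [h1 h2]; split=> *; rewrite -?opprD normrN. Qed.

Let bSM f g C C' : bS f C -> bS g C' -> bS (fun t => f t * g t) (2 * C * C').
Proof.
move=> hf hg; have C0 := bS_ge0 hf; have C0' := bS_ge0 hg; case: hf hg => [f1 f2] [g1 g2].
split=> [t|t t'].
  apply: (@le_trans _ _ (C * C')); first by rewrite normrM ler_pM.
  by rewrite -[leRHS]mulrA; have := mulr_ge0 C0 C0'; lra.
have -> : f t * g t - f t' * g t' = f t * (g t - g t') + (f t - f t') * g t' by ring.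
have -> : 2 * C * C' * S `|t - t'| = C * (C' * S `|t - t'|) + C * S `|t - t'| * C' by ring.
by rewrite (le_trans (ler_normD _ _))// lerD// normrM ler_pM.
Qed.

Let bS_scale f C : bS f C -> bS (fun t => f (t / l1)) (C * a^-1).
Proof.
move=> hf; have C0 := bS_ge0 hf; case: hf => f1 f2; split=> [t|t t'].
  by rewrite (le_trans (f1 _))// ler_peMr// ltW.
apply: (le_trans (f2 _ _)); rewrite -mulrA ler_wpM2l// -mulrBl normrM normfV mulrC.
by apply: S_C => //; exact: ltW.
Qed.

Let bS_c (X : V -> R) (k : R) : 0 <= k -> (forall z, `|X z| <= k) ->
  (forall z z', `|X z - X z'| <= k * om `|z - z'|) -> bS (fun t => X (c t)) (k * C1).
Proof.
move=> k0 h1 h2; split=> [t|t t']; first by rewrite (le_trans (h1 _))// ler_peMr// C1_ge1.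
apply: (le_trans (h2 _ _)); rewrite -mulrA ler_wpM2l//.
apply: (@le_trans _ _ (S (C1 * `|t - t'|))).
  by rewrite (le_trans (om_S _))// S_le// c_lip.
by rewrite S_C// C1_ge1.
Qed.

Let bS_dc i : bS (fun t => dc t 0 i) (C1 + Cc).
Proof.
have C10 : 0 <= C1 by exact: expR_ge0.
split=> [t|t t'].
  by have [_ _ h] := dc_cone t; rewrite (le_trans (le_mx_norm _ _ _))// (le_trans h)// lerDl.
rewrite -subMxE (le_trans (le_mx_norm _ _ _))// (le_trans (dc_mod _ _))//.
by rewrite ler_wpM2r ?S_ge0// lerDr.
Qed.

Let bS_dcV : exists C, bS (fun t => (dc t 0 0)^-1) C.
Proof.
exists (K + K * K * Cc); split=> [t|t t'].
  have := dh_le (c t 0 0); rewrite /dh hinv_c => /le_trans; apply.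
  by rewrite lerDl mulr_ge0// mulr_ge0.
have [_ hx _] := dc_cone t; have [_ hy _] := dc_cone t'.
apply: (le_trans (inv_diff_le c000 hx hy)); rewrite invrK.
apply: (@le_trans _ _ (K * K * (Cc * S `|t - t'|))).
  by rewrite ler_wpM2l ?mulr_ge0// -subMxE (le_trans (le_mx_norm _ _ _))// dc_mod.
by rewrite mulrA ler_wpM2r ?S_ge0// lerDr.
Qed.

(* Since dc t *m qn m (c t) = 1, along the stable manifold only the second entry
   of [qn] is free; it solves the twisted recursion [sgS], whose multiplier
   [beta] contracts enough to keep the modulus S. *)
Let sg m t := qn m (c t) 1 0.
Let alpha t := M (c t) 1 0 * (dc (t / l1) 0 0)^-1.
Let beta t := M (c t) 1 1 - alpha t * dc (t / l1) 0 1.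

Lemma c_div t : G (c t) = c (t / l1).
Proof. by have := c_G (t / l1); rewrite mulrC divfK. Qed.

Lemma qn_c00 m t : qn m (c t) 0 0 = (1 - dc t 0 1 * sg m t) * (dc t 0 0)^-1.
Proof.
have := dc_qn m t; rewrite mul2E -/(sg m t) => <-.
by field; rewrite gt_eqF// dc00_gt0.
Qed.

Lemma sgS m t : sg m.+1 t = alpha t + beta t * sg m (t / l1).
Proof. by rewrite {1}/sg qnS c_div mul2E qn_c00 -/(sg m (t / l1)) /beta /alpha; ring. Qed.

Let BE z i j : `|B z i j - Li i j| <= ep.
Proof. by rewrite -subMxE (le_trans (le_mx_norm _ _ _)). Qed.

(** The bound carries the factor a because replacing t by t / l1 costs a^-1 in the modulus [S]; the
    net contraction of the recursion is kap. *)
Lemma beta_le t : `|beta t| <= a * kap.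
Proof.
have h1 := BE (c t) 1 0; have h2 := BE (c t) 1 1; move: h1 h2.
rewrite /saddle !mxE/= subr0 => h1 h2.
have [g1 g2 _] := dc_cone (t / l1); have g0 := dc00_gt0 (t / l1).
have ha : `|alpha t * dc (t / l1) 0 1| <= a * ep * 2^-1.
  rewrite /alpha mxE -mulrA -[leRHS]mulrA 2!normrM -mulrA ler_pM2l//.
  apply: ler_pM => //; rewrite normrM normfV (gtr0_norm g0) mulrC ler_pdivrMr//; lra.
have hb : `|M (c t) 1 1| <= a * (b^-1 + ep).
  rewrite /M mxE normrM ler_pM2l// -normfV.
  by move: h2; rewrite mulr1n => /absl[].
rewrite /beta (le_trans (ler_normB _ _))//.
apply: (@le_trans _ _ (a * (b^-1 + 8 * ep))); last by rewrite ler_pM2l.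
have : 0 <= a * ep by rewrite mulr_ge0.
by rewrite mulrDr in hb *; lra.
Qed.

Let bS_M i j : exists C, bS (fun t => M (c t) i j) C.
Proof.
exists ((`|Li| + ep + L) * C1); apply: (bS_c (X := fun z => M z i j)); first by rewrite !addr_ge0.
  move=> z; rewrite /M mxE normrM (@le_trans _ _ (1 * `|B z i j|))//.
    by rewrite ler_wpM2r// ltW.
  rewrite mul1r -(subrK (Li i j) (B z i j)) (le_trans (ler_normD _ _))//.
  have := BE z i j; have := le_mx_norm Li i j; have := L0; lra.
move=> z z'; rewrite /M !mxE -mulrBr normrM (@le_trans _ _ (1 * `|B z i j - B z' i j|))//.
  by rewrite ler_wpM2r// ltW.
rewrite mul1r -subMxE (le_trans (le_mx_norm _ _ _))// (le_trans (Bmod _ _))//.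
by rewrite ler_wpM2r ?om_ge0// lerDr addr_ge0.
Qed.

Let sg_le m t : `|sg m t| <= C1 * K.
Proof. by rewrite (le_trans (le_mx_norm _ _ _))// qn_le. Qed.

Lemma sg_mod : exists C, forall m, bS (sg m) C.
Proof.
have [C10 h10] := bS_M 1 0; have [C11 h11] := bS_M 1 1; have [Cv hv] := bS_dcV.
have ha := bSM h10 (bS_scale hv).
have hb := bSD h11 (bSN (bSM ha (bS_scale (bS_dc 1)))).
set Ca := 2 * C10 * _ in ha; set Cb := C11 + _ in hb.
have Ca0 := bS_ge0 ha; have Cb0 := bS_ge0 hb.
have k1 : 0 < 1 - kap by rewrite subr_gt0.
(* The fixed point of C = Ca + Cb (C1 K) + kap C, the balance of one step of the recursion. *)
pose C := (Ca + Cb * (C1 * K)) / (1 - kap).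
have q0 : 0 <= C1 * K by rewrite mulr_ge0 ?expR_ge0.
have C0 : 0 <= C by rewrite divr_ge0 ?(ltW k1)// addr_ge0// mulr_ge0.
have CE : Ca + Cb * (C1 * K) = C * (1 - kap) by rewrite /C divfK// gt_eqF.
exists (C + C1 * K) => m; split=> [t|t t']; first by rewrite (le_trans (sg_le _ _))// lerDr.
apply: (@le_trans _ _ (C * S `|t - t'|)); last by rewrite ler_wpM2r ?S_ge0// lerDl.
elim: m t t' => [|m ih] t t'.
  by rewrite /sg /qn /= !mul1mx /Qv !mxE/= !mulr0 subrr normr0 mulr_ge0// S_ge0.
rewrite !sgS.
have -> : alpha t + beta t * sg m (t / l1) - (alpha t' + beta t' * sg m (t' / l1)) =
  (alpha t - alpha t') + (beta t - beta t') * sg m (t' / l1) +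
  beta t * (sg m (t / l1) - sg m (t' / l1)) by ring.
have S0 : 0 <= S `|t - t'| by rewrite S_ge0.
apply: (@le_trans _ _ (Ca * S `|t - t'| + Cb * S `|t - t'| * (C1 * K) +
   a * kap * (C * (a^-1 * S `|t - t'|)))).
  rewrite (le_trans (ler_normD _ _))// lerD//.
    rewrite (le_trans (ler_normD _ _))// lerD//; first by case: ha => _; exact.
    by rewrite normrM ler_pM//; case: hb => _; exact.
  rewrite normrM ler_pM// ?beta_le//.
  apply: (le_trans (ih _ _)); rewrite ler_wpM2l// -mulrBl normrM normfV mulrC.
  by apply: S_C => //; exact: ltW.
have -> : Ca * S `|t - t'| + Cb * S `|t - t'| * (C1 * K) + a * kap * (C * (a^-1 * S `|t - t'|)) =
  (Ca + Cb * (C1 * K) + (a * a^-1) * kap * C) * S `|t - t'| by ring.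
rewrite CE mulfV ?gt_eqF// ler_wpM2r// le_eqVlt; apply/orP; left; apply/eqP; ring.
Qed.

Lemma qn_c_mod : exists2 C, 0 <= C &
  forall m t t', `|qn m (c t) - qn m (c t')| <= C * S `|t - t'|.
Proof.
have [Cs hs] := sg_mod; have [Cv hv] := bS_dcV.
have h1 : bS (fun=> 1) 1.
  by split=> *; rewrite ?normr1// subrr normr0 mul1r S_ge0.
have hq m := bSM (bSD h1 (bSN (bSM (bS_dc 1) (hs m)))) hv.
set Cq := 2 * _ * Cv in hq.
have Cq0 := bS_ge0 (hq 0%N); have Cs0 := bS_ge0 (hs 0%N).
exists (Cq + Cs) => [|m t t']; first by rewrite addr_ge0.
have S0 : 0 <= S `|t - t'| by rewrite S_ge0.
apply: mx_norm_le; first by rewrite mulr_ge0// addr_ge0.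
move=> i j; rewrite (ord1 j) subMxE; case: (ord2E i) => ->.
  rewrite !qn_c00; case: (hq m) => _ /(_ t t')/le_trans; apply.
  by rewrite ler_wpM2r// lerDl.
by case: (hs m) => _ /(_ t t')/le_trans; apply; rewrite ler_wpM2r// lerDr.
Qed.

(** The m-th images of z and [wm m z] have the same first coordinate, hence the same [Qv]. Only the
    products [Pi] differ, along orbits whose distance decays like kap^k. *)
Lemma qn_shadow m z : `|qn m z - qn m (wm m z)| <= 2 * C3 * K * S (2 * vdist z).
Proof.
have eQ : Qv (iter m G (wm m z)) = Qv (iter m G z).
  by have := iter_wm m 0 z; rewrite addn0 /Qv => ->; rewrite wm0_00.
rewrite /qn eQ -mulmxBl (le_trans (mx_norm_mul _ _))//.
have -> : 2 * C3 * K * S (2 * vdist z) = 2 * (C3 * S (2 * vdist z)) * K by ring.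
apply: ler_pM; rewrite ?mulr_ge0 ?Qv_le// ler_pM2l// (le_trans (Pi_diff _ _ _))//.
have C30 : 0 <= C3 by rewrite !mulr_ge0 ?expR_ge0.
rewrite ler_wpM2l//; apply: le_trans (sum_om_decaying m _); last by rewrite mulr_ge0// vdist_ge0.
rewrite ler_sum// => k _; apply: om_le => //.
have km : (m = k + (m - k))%N by rewrite subnKC// ltnW.
have := wm_decay k (m - k) z; rewrite -km => /le_trans; apply.
by rewrite ler_wpM2r ?exprn_ge0 ?(ltW kap0)// wm_le.
Qed.

(** Through the shadowing points [wm m z] and [wm m z'], which lie on the stable manifold, where
    [qn_c_mod] holds uniformly in m. *)
Lemma qn_near : exists2 C, 0 <= C & forall m z z',
  `|qn m z - qn m z'| <= C * S (`|z - z'| + 2 * vdist z + 2 * vdist z').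
Proof.
have [Cq Cq0 hq] := qn_c_mod.
have C30 : 0 <= C3 by rewrite !mulr_ge0 ?expR_ge0.
exists (4 * C3 * K + Cq * K) => [|m z z'].
  by rewrite addr_ge0// !mulr_ge0.
set T := _ + _ + _; have v0 := vdist_ge0 z; have v0' := vdist_ge0 z'.
have n0 := normr_ge0 (z - z').
have T0 : 0 <= T by rewrite /T; lra.
have s1 : S (2 * vdist z) <= S T by apply: S_le; rewrite /T; lra.
have s2 : S (2 * vdist z') <= S T by apply: S_le; rewrite /T; lra.
have -> : (4 * C3 * K + Cq * K) * S T = 2 * C3 * K * S T + 2 * C3 * K * S T + Cq * (K * S T) by ring.
have -> : qn m z - qn m z' = (qn m z - qn m (wm m z)) + (qn m (wm m z') - qn m z') +
   (qn m (wm m z) - qn m (wm m z')).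
  by apply/matrixP => i j; rewrite !mxE; ring.
have c0' : 0 <= 2 * C3 * K by rewrite !mulr_ge0.
rewrite (le_trans (ler_normD _ _))// lerD//.
  rewrite (le_trans (ler_normD _ _))// lerD//.
    by rewrite (le_trans (qn_shadow _ _))// ler_wpM2l.
  by rewrite distrC (le_trans (qn_shadow _ _))// ler_wpM2l.
apply: (le_trans (hq _ _ _)); rewrite ler_wpM2l//.
apply: (@le_trans _ _ (S (K * T))); last by rewrite S_C.
apply: S_le => //; apply: (le_trans (c_expand _ _)); rewrite ler_wpM2l//.
rewrite -subMxE (le_trans (le_mx_norm _ _ _))// -/(wm m z) -/(wm m z').
have -> : wm m z - wm m z' = (z - z') - (z - wm m z) + (z' - wm m z').
  by apply/matrixP => i j; rewrite !mxE; ring.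
apply: (le_trans (ler_normD _ _)); apply: lerD; last exact: wm_le.
by apply: (le_trans (ler_normB _ _)); rewrite lerD2l wm_le.
Qed.

(** The product is split at time k. Up to k the orbits separate at most like a^-k and [Pi_S]
    compares the first factors; at time k both points are within a multiple of b^-k of the stable
    manifold and [qn_near] compares the rest. If n <= k, the rest is just [Qv]. *)
Lemma qn_main : exists2 C, 0 <= C & forall n k z z', `|z| <= 1 -> `|z'| <= 1 ->
  `|qn n z - qn n z'| <= C * S (a^-1 ^+ k * `|z - z'| + b^-1 ^+ k).
Proof.
have [Cn Cn0 hn] := qn_near.
have c1 := C1_ge1; have b0 : 0 < b by exact: lt_trans l21.
pose E := expR (b * (4 * L * S rho + L * S (2 * Dm))) * (2 * Dm).
have Dm0 : 0 <= Dm by rewrite addr_ge0// mulr_ge0 ?expR_ge0.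
have E0 : 0 <= E by rewrite mulr_ge0 ?expR_ge0// mulr_ge0.
(* At time k the separation is at most C2 times the first term of T, and each of the two summands 2
   vdist is at most 2 E times the second. *)
pose Q := C2 + 4 * E + 1.
have Q1 : 1 <= Q by rewrite /Q; lra.
exists (2 * Cc * (C1 * K) + C1 * (Ch * C2) + C1 * (Cn * Q)) => [|n k z z' z1 z1'].
  by rewrite !addr_ge0// !mulr_ge0 ?expR_ge0//; exact: le_trans ler01 Q1.
set d := `|z - z'|; have d0 : 0 <= d by exact: normr_ge0.
set T := a^-1 ^+ k * d + b^-1 ^+ k.
have ak : 0 <= a^-1 ^+ k * d by rewrite mulr_ge0// exprn_ge0// invr_ge0.
have bk : 0 <= b^-1 ^+ k by rewrite exprn_ge0// invr_ge0.
have T0 : 0 <= T by rewrite addr_ge0.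
have ST0 : 0 <= S T by rewrite S_ge0.
have pre j m : (j <= k)%N ->
    `|qn m (iter j G z) - qn m (iter j G z')| <= (Ch * C2 + Cn * Q) * S T ->
    `|qn (j + m) z - qn (j + m) z'| <=
    (2 * Cc * (C1 * K) + C1 * (Ch * C2) + C1 * (Cn * Q)) * S T.
  move=> jk h; rewrite !qnD.
  have -> : Pi j z *m qn m (iter j G z) - Pi j z' *m qn m (iter j G z') =
    (Pi j z - Pi j z') *m qn m (iter j G z) +
    Pi j z' *m (qn m (iter j G z) - qn m (iter j G z')).
    by rewrite mulmxBl mulmxBr addrA subrK.
  have -> : (2 * Cc * (C1 * K) + C1 * (Ch * C2) + C1 * (Cn * Q)) * S T =
    2 * (Cc * S T) * (C1 * K) + C1 * ((Ch * C2 + Cn * Q) * S T) by ring.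
  rewrite (le_trans (ler_normD _ _))// lerD//.
    rewrite (le_trans (mx_norm_mul _ _))//; apply: ler_pM; rewrite ?mulr_ge0 ?qn_le//.
    rewrite ler_pM2l// (le_trans (Pi_S _ _ _))// ler_wpM2l//.
    apply: S_le; first by rewrite mulr_ge0// exprn_ge0// invr_ge0.
    rewrite -/d (@le_trans _ _ (a^-1 ^+ k * d)) ?lerDl//.
    by rewrite ler_wpM2r// ler_weXn2l// ltW.
  by rewrite (le_trans (Pi_mul_le _ _ _))// ler_wpM2l// expR_ge0.
have dj j : (j <= k)%N -> `|iter j G z - iter j G z'| <= C2 * (a^-1 ^+ k * d).
  move=> jk; rewrite (le_trans (iter_lip _ _ _))// -mulrA ler_wpM2l ?mulr_ge0 ?expR_ge0//.
  by rewrite ler_wpM2r// ler_weXn2l// ltW.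
have Q0 : 0 <= Q by exact: le_trans ler01 Q1.
case: (leqP n k) => nk.
  have := pre n 0%N nk; rewrite addn0; apply; rewrite /qn !mul1mx (le_trans (Qv_mod _ _))// [leRHS]mulrDl.
  apply: (@le_trans _ _ (Ch * C2 * S T)); last by rewrite lerDl !mulr_ge0.
  rewrite -[leRHS]mulrA ler_wpM2l//; apply: (@le_trans _ _ (S (C2 * T))); last by rewrite S_C//; lra.
  apply: S_le => //; apply: (le_trans (dj _ nk)).
  by rewrite ler_wpM2l ?mulr_ge0 ?expR_ge0// lerDl.
rewrite -(subnKC (ltnW nk)); apply: pre => //.
rewrite (le_trans (hn _ _ _))// [leRHS]mulrDl.
apply: (@le_trans _ _ (Cn * Q * S T)); last by rewrite lerDr !mulr_ge0 ?expR_ge0.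
rewrite -[leRHS]mulrA ler_wpM2l//; apply: (@le_trans _ _ (S (Q * T))); last by rewrite S_C.
have vE y : `|y| <= 1 -> vdist (iter k G y) <= b^-1 ^+ k * E.
  move=> y1; apply: (le_trans (vdist_iter _ _)); rewrite ler_wpM2l//.
  have vy := vdist_le y1; have vy0 := vdist_ge0 y.
  apply: ler_pM; rewrite ?expR_ge0 ?mulr_ge0// ?ler_pM2l//.
  rewrite ler_expR ler_pM2l// lerD2l ler_wpM2l// S_le ?mulr_ge0// ler_pM2l//.
have v1 := vE z z1; have v2 := vE z' z1'; have v3 := dj k (leqnn k).
have v0 := vdist_ge0 (iter k G z); have v0' := vdist_ge0 (iter k G z').
apply: S_le; first by rewrite !addr_ge0// mulr_ge0.
have e1' : 0 <= E * (a^-1 ^+ k * d) by rewrite mulr_ge0.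
have e2' : 0 <= C2 * b^-1 ^+ k by rewrite !mulr_ge0 ?expR_ge0.
rewrite /Q /T; move: v1 v2 v3 ak bk e1' e2'; rewrite (mulrC _ E).
set A := a^-1 ^+ k * d; set Bk := b^-1 ^+ k; set X := iter k G z; set X' := iter k G z'.
have -> : (C2 + 4 * E + 1) * (A + Bk) = C2 * A + 4 * (E * A) + A + C2 * Bk + 4 * (E * Bk) + Bk by ring.
lra.
Qed.

(* Backward iteration separates points like a^-k while vertical distances decay
   like b^-k; the exponent ln b / (ln b - ln a) balances the two. *)
Lemma choose_time (dl d : R) : 0 < dl -> dl <= ln b / (ln b - ln a) -> 0 < d <= 1 ->
  exists k, a^-1 ^+ k * d <= d `^ dl /\ b^-1 ^+ k <= b * d `^ dl.
Proof.
move=> dl0 hdl /andP[d0 d1].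
have b0 : 0 < b by exact: lt_trans l21.
have lb : 0 < ln b by rewrite ln_gt0.
have la : ln a < 0 by rewrite ln_lt0// l10 l11.
set T := ln b - ln a; have T0 : 0 < T by rewrite /T; lra.
have ld : ln d <= 0 by rewrite ln_le0.
pose X := - ln d / T; have X0 : 0 <= X by rewrite divr_ge0 ?oppr_ge0// ltW.
have XT : X * T = - ln d by rewrite /X divfK// gt_eqF.
exists (Num.truncn X).
have /andP[k1 k2] := truncn_itv X0; set k := Num.truncn X in k1 k2 *.
have dd : 0 < d `^ dl by rewrite powR_gt0.
have hX : dl * (- ln d) <= X * ln b.
  have -> : X * ln b = ln b / T * - ln d by rewrite /X; ring.
  by rewrite ler_wpM2r// oppr_ge0.
split; rewrite -ler_ln ?posrE ?mulr_gt0 ?exprn_gt0 ?invr_gt0// !lnM ?posrE ?exprn_gt0 ?invr_gt0//.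
  rewrite lnXn ?invr_gt0// lnV ?posrE// ln_powR mulrC -mulr_natr.
  have h : k%:R * - ln a <= X * - ln a by rewrite ler_wpM2r//; lra.
  by move: XT; rewrite /T mulrBr; lra.
rewrite lnXn ?invr_gt0// lnV ?posrE// ln_powR -mulr_natr.
have h : X * ln b <= k.+1%:R * ln b by rewrite ler_wpM2r// ltW.
by move: h; rewrite -natr1 mulrDl; lra.
Qed.

(** The radius 2^-1 keeps |x - y| <= 1, the range of [choose_time]. For given points one time k
    serves all n, so [qn] has a modulus independent of n; [taylor_osc] turns it into a uniform
    Taylor bound for [phin], which passes to the limit together with the derivatives. *)
Theorem core_eigenfunction (dl : R) : 0 < dl -> dl <= ln b / (ln b - ln a) ->
  exists (phi : V -> R) (q : V -> 'cV[R]_2) (C : R),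
  [/\ 0 <= C,
      forall x y, `|x| < 2^-1 -> `|y| < 2^-1 ->
        `|phi y - phi x - ((y - x) *m q x) 0 0| <= C * S (`|y - x| `^ dl) * `|y - x|,
      forall x y, `|x| < 2^-1 -> `|y| < 2^-1 -> `|q x - q y| <= C * S (`|x - y| `^ dl),
      phi 0 = 0 /\ q 0 = f1 &
      forall z, phi (F z) = l1 * phi z].
Proof.
move=> dl0 hdl; have b0 : 0 < b by exact: lt_trans l21.
have dl1 : dl <= 1.
  apply: (le_trans hdl); have lb : 0 < ln b by rewrite ln_gt0.
  have la : ln a < 0 by rewrite ln_lt0// l10 l11.
  by rewrite ler_pdivrMr; lra.
have [Cm Cm0 hm] := qn_main.
have wdl := wmod_powR wS dl0 dl1.
(* With k from [choose_time], a^-k d + b^-k is at most (1 + b) d^dl; the 2 is the constant of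
   [mx_norm_mul]. *)
pose C := 2 * (Cm * (b + 1)).
have C0 : 0 <= C by rewrite !mulr_ge0// addr_ge0// ltW.
have qmod n x y : `|x| < 2^-1 -> `|y| < 2^-1 -> `|qn n x - qn n y| <= Cm * (b + 1) * S (`|x - y| `^ dl).
  move=> x1 y1; have [->|xy] := eqVneq x y.
    by rewrite !subrr normr0 !mulr_ge0// ?S_ge0 ?powR_ge0// addr_ge0// ltW.
  have d0 : 0 < `|x - y| <= 1.
    rewrite normr_gt0 subr_eq0 xy/= (le_trans (ler_normB _ _))//; lra.
  have [k [k1 k2]] := choose_time dl0 hdl d0.
  apply: (le_trans (hm n k x y _ _)); [by lra|by lra|].
  rewrite -mulrA ler_wpM2l//; apply: (@le_trans _ _ (S ((b + 1) * `|x - y| `^ dl))).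
    apply: S_le; last by rewrite mulrDl mul1r addrC lerD.
    by rewrite addr_ge0 ?mulr_ge0 ?exprn_ge0 ?invr_ge0.
  by apply: S_C; rewrite ?powR_ge0// lerDr ltW.
pose P : set V := [set z | `|z| < 2^-1].
have seg x y : P x -> P y -> seg_in P x y.
  by move=> Px Py; exact: seg_in_ball.
have tn n : taylor P (fun d => C * S (d `^ dl)) (phin n) (fun z v => (v *m qn n z) 0 0).
  move=> x y Px Py; have [Cn Cn0 tc] := phin_taylor n.
  have tP : taylor P (fun d => Cn * S d) (phin n) (fun z v => (v *m qn n z) 0 0 : R^o).
    by move=> u v _ _; exact: tc.
  apply: (taylor_osc (wmod_scale wS Cn0) tP); first exact: seg.
    by move=> z u v; rewrite mulmxBl subMxE.
  move=> z Pz zx v; rewrite -subMxE -mulmxBr (le_trans (le_mx_norm _ _ _))//.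
  rewrite (le_trans (mx_norm_mul _ _))// mulrAC ler_wpM2r// /C -mulrA ler_pM2l//.
  apply: (le_trans (qmod _ _ _ Pz Px)).
  have k0 : 0 <= Cm * (b + 1) by rewrite mulr_ge0// addr_ge0// ltW.
  rewrite ler_wpM2l//.
  by case: wdl => _ h _ _; exact: h.
have hphi z := cauchyc_conv (phin_cauchy z).
have [phi phiE] := choice hphi.
(* The derivatives converge entry by entry, as directional derivatives of the convergent functions
   [phin]. *)
have hq z : exists q : 'cV[R]_2, P z -> conv (fun n => qn n z) q.
  have [Pz|] := pselect (P z); last by exists 0.
  have hi i : exists l : R^o, conv (fun n => qn n z i 0 : R^o) l.
    have [||||l hl] := @taylor_limit_deriv R V R^o (@cauchyc_conv R) P
      (fun d => C * S (d `^ dl)) phin (fun n z v => (v *m qn n z) 0 0) z (delta_mx 0 i)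
      (wmod_scale wdl C0) tn.
    - by move=> y _; exact: phin_cauchy.
    - by [].
    - exists ((2^-1 - `|z|) / 2); first by rewrite divr_gt0// subr_gt0.
      move=> s /andP[s0 s1]; rewrite /P/=.
      have e1i : `|delta_mx 0 i : V| <= 1.
        by apply: mx_norm_le => // p r; rewrite mxE; case: (_ && _); rewrite ?normr1 ?normr0.
      rewrite (le_lt_trans (ler_normD _ _))// normrZ (gtr0_norm s0).
      have : s * `|delta_mx 0 i : V| <= s by rewrite ler_piMr// ltW.
      by move: Pz; rewrite /P/=; lra.
    - by move=> n s; rewrite -scalemxAl mxE.
    exists l => e' /hl [N hN]; exists N => n /hN.
    by rewrite -rowE mxE.
  have [l0 h0] := hi 0; have [l1' h1] := hi 1.
  exists (\col_i (if i == 0 then l0 else l1')) => _ e' e0.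
  have [N0 hN0] := h0 _ e0; have [N1 hN1] := h1 _ e0.
  exists (maxn N0 N1) => n; rewrite geq_max => /andP[n0 n1].
  apply: mx_norm_le; first exact: ltW.
  move=> i j; rewrite (ord1 j) subMxE [X in _ - X]mxE; case: (ord2E i) => ->.
    by rewrite eqxx; exact: hN0.
  by rewrite (_ : (1 == 0 :> 'I_2) = false)//; exact: hN1.
have [q qE] := choice hq.
have P0 : P 0 by rewrite /P/= normr0 invr_gt0.
exists phi, q, C; split=> //.
- move=> x y Px Py.
  have := @taylor_limit R V R^o P (fun d => C * S (d `^ dl)) phin (fun n z v => (v *m qn n z) 0 0)
    phi (fun z v => (v *m q z) 0 0) tn.
  move=> H; apply: H => // z v Pz.
  by apply: (conv_entry 0 0); apply: conv_mulmx; [exact: conv_cst|exact: qE].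
- move=> x y Px Py; rewrite -[X in `|X|]subr0.
  apply: (conv_le (u := fun n => qn n x - qn n y)).
    apply: convD; first exact: qE.
    apply: (conv_lip (g := fun w : 'cV[R]_2 => - w) (K := 1)); last exact: qE.
    by move=> w; rewrite -opprD normrN mul1r.
  exists 0%N => n _; rewrite subr0 (le_trans (qmod _ _ _ _ _))// /C.
  have : 0 <= Cm * (b + 1) * S (`|x - y| `^ dl).
    by rewrite !mulr_ge0// ?S_ge0 ?powR_ge0// addr_ge0// ltW.
  by rewrite -mulrA; lra.
- have it0 n : iter n G 0 = 0 by elim: n => //= n ->; exact: G0.
  split.
    apply: (conv_uniq (phiE 0)) => e' e0; exists 0%N => n _.
    by rewrite /phin it0 mxE hinv0 mulr0 subrr normr0 ltW.
  apply: (conv_uniq (qE 0 P0)) => e' e0; exists 0%N => n _.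
  suff -> : qn n 0 = f1 by rewrite subrr normr0 ltW.
  elim: n => [|n ih].
    by rewrite /qn /= mul1mx /Qv mxE /dh hinv0 dc0 mxE/= invr1 scale1r.
  rewrite qnS G0 ih D0E; apply/matrixP => i j; rewrite (ord1 j).
  by case: (ord2E i) => ->; rewrite ?saddle_mul0 ?saddle_mul1 !mxE/= ?mulr1 ?mulr0.
- move=> z; apply: (conv_uniq (conv_shift (phiE (F z)))).
  have h : conv (fun n => l1 * phin n z : R^o) (l1 * phi z).
    apply: (conv_lip (g := fun x : R^o => l1 * x : R^o) (K := a)); last exact: phiE.
    by move=> x; rewrite -mulrBr normrM.
  move=> e' /h[N hN]; exists N => n /hN.
  by rewrite /phin iterSr FK exprS mulrA.
Qed.

End Core.

(** * Jacobians and Taylor estimates *)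

Section Jacobian.
Variable R : realType.
Local Notation V := 'rV[R]_2.

Lemma opnorm_le (M : 'M[R]_2) : opnorm M <= 2 * `|M|.
Proof.
apply: ge_sup; first by exists `|(0 : V) *m M|, 0 => //=; rewrite normr0.
move=> _ [v /= v1 <-]; rewrite (le_trans (mx_norm_mul _ _))// ler_wpM2r//.
by rewrite ler_piMr.
Qed.

Lemma le_opnorm (M : 'M[R]_2) : `|M| <= opnorm M.
Proof.
have ub : has_ubound [set `|v *m M| | v in [set v : V | `|v| <= 1]].
  exists (2 * `|M|) => _ [v /= v1 <-]; rewrite (le_trans (mx_norm_mul _ _))// ler_wpM2r//.
  by rewrite ler_piMr.
apply: mx_norm_le => [|i j].
  apply: (@le_trans _ _ `|(0 : V) *m M|) => //; apply: ub_le_sup => //.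
  by exists 0 => //=; rewrite normr0.
apply: (@le_trans _ _ `|(delta_mx 0 i : V) *m M|).
  by have := le_mx_norm ((delta_mx 0 i : V) *m M) 0 j; rewrite -rowE mxE.
apply: ub_le_sup => //; exists (delta_mx 0 i) => //=.
by apply: mx_norm_le => // p r; rewrite mxE; case: (_ && _); rewrite ?normr1 ?normr0.
Qed.

Lemma differentiable_taylor (F : V -> V) (x : V) : differentiable F x ->
  forall e, 0 < e -> exists2 d, 0 < d & forall w, `|w| < d ->
    `|F (x + w) - F x - w *m jacobian F x| <= e * `|w|.
Proof.
move=> dF e e0; have /diff_locallyP[_ /eqaddoP/(_ e e0)] := dF.
move=> /nbhs_ballP[d /= d0 hd]; exists d => // w wd.
have := hd w; rewrite -ball_normE/= sub0r normrN => /(_ wd).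
rewrite /jacobian mul_rV_lin1 [(F \o shift x - _) w](_ : _ = F (x + w) - F x - 'd F x w)//.
by rewrite !fctE/= opprD addrA (addrC w).
Qed.

Lemma taylor_jacobian (F : V -> V) (x : V) (A : 'M[R]_2) :
  (forall e, 0 < e -> exists2 d, 0 < d & forall w, `|w| < d ->
    `|F (x + w) - F x - w *m A| <= e * `|w|) ->
  differentiable F x /\ jacobian F x = A.
Proof.
move=> hF.
pose W : normedModType R := V.
pose df : {linear W -> W} := mulmxr A.
have cont : continuous (df : W -> W).
  apply/linear_bounded_continuous.
  apply/linear_boundedP; exists (2 * `|A|); split; first exact: num_real.
  move=> k /ltW hk w /=.
  by rewrite (le_trans (mx_norm_mul _ _))// mulrAC ler_wpM2r.
have exp : (F : W -> W) \o shift (x : W) = cst (F x) + (df : W -> W) +o_0 (id : W -> W).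
  apply/eqaddoP => e e0; have [d d0 hd] := hF e e0.
  apply/nbhs_ballP; exists d => //= w; rewrite -ball_normE/= sub0r normrN => /hd.
  by rewrite !fctE/= opprD addrA (addrC w).
have dE := diff_unique cont exp.
split; first by apply/diff_locallyP; rewrite dE.
apply/row_matrixP => i; rewrite !rowE /jacobian mul_rV_lin1 dE//.
Qed.

Lemma is_derive_taylor (g : R -> R) (s dg : R) :
  (forall e, 0 < e -> exists2 d, 0 < d & forall h, `|h| < d ->
    `|g (s + h) - g s - h * dg| <= e * `|h|) -> is_derive s 1 g dg.
Proof.
move=> hg.
have C : h^-1 *: (g (h *: 1 + s) - g s) @[h --> 0^'] --> dg.
  apply/cvgrPdist_le => e e0; have [d d0 hd] := hg e e0.
  near=> h.
  have h0 : h != 0 by near: h; exact: nbhs_dnbhs_neq.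
  have hd' : `|h| < d.
    near: h; apply/nbhs_ballP; exists d => //= h; rewrite /ball/= sub0r normrN.
    by [].
  have := hd h hd'; rewrite (addrC s) => hh.
  rewrite [h *: 1]mulr1 distrC.
  have -> : h^-1 *: (g (h + s) - g s) - dg = h^-1 * (g (h + s) - g s - h * dg).
    by rewrite /GRing.scale/=; field.
  by rewrite normrM normfV ler_pdivrMl ?normr_gt0// [leRHS]mulrC.
apply: DeriveDef; first by apply/cvg_ex; exists dg.
exact: (cvg_lim _ C).
Unshelve. all: by end_near.
Qed.

(** The scalar mean value theorem along the segment, entry by entry, with a mean point that may
    depend on the entry; the 2 comes from [mx_norm_mul]. *)
Lemma mean_value_ball (F : V -> V) (r : R) (x y : V) (K : R) :
  (forall z, `|z| < r -> differentiable F z) -> `|x| < r -> `|y| < r ->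
  (forall s, 0 <= s <= 1 -> `|jacobian F (x + s *: (y - x)) - jacobian F x| <= K) ->
  `|F y - F x - (y - x) *m jacobian F x| <= 2 * K * `|y - x|.
Proof.
move=> dF xr yr hK.
have K0 : 0 <= K by apply: le_trans (hK 0 _); rewrite ?lexx ?ler01.
apply: mx_norm_le => [|i j]; first by rewrite mulr_ge0// mulr_ge0.
rewrite (ord1 i).
pose v := y - x.
pose g (s : R) : R := F (x + s *: v) 0 j.
pose dg (s : R) : R := (v *m jacobian F (x + s *: v)) 0 j.
have sb s : 0 <= s <= 1 -> `|x + s *: v| < r by exact: seg_in_ball.
have hder (s : R) : 0 <= s <= 1 -> is_derive s 1 g (dg s).
  move=> s01; apply: is_derive_taylor => e e0.
  have v1 : 0 < `|v| + 1 by rewrite ltr_wpDl.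
  have [d d0 hd] := differentiable_taylor (dF _ (sb s s01)) (divr_gt0 e0 v1).
  exists (d / (`|v| + 1)); first by rewrite divr_gt0.
  move=> h; rewrite ltr_pdivlMr// => hh.
  have hv : `|h *: v| < d.
    by rewrite normrZ (le_lt_trans _ hh)// ler_wpM2l// lerDl.
  have := hd _ hv; rewrite (_ : x + s *: v + h *: v = x + (s + h) *: v); last by rewrite scalerDl addrA.
  rewrite -scalemxAl => hF.
  have -> : g (s + h) - g s - h * dg s =
    (F (x + (s + h) *: v) - F (x + s *: v) - h *: (v *m jacobian F (x + s *: v))) 0 j.
    by rewrite subMxE subMxE scaleMxE.
  rewrite (le_trans (le_mx_norm _ _ _))// (le_trans hF)// normrZ mulrAC -mulrA.
  by rewrite ler_wpM2l ?(ltW e0)// ler_pdivrMr// ler_wpM2l// lerDl.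
have [c c01 hc] : exists2 c, c \in `]0, 1[ & g 1 - g 0 = dg c * (1 - 0).
  apply: MVT => //.
    move=> s; rewrite in_itv/= => /andP[s0 s1]; apply: hder; by rewrite !ltW.
  apply: derivable_within_continuous => s; rewrite in_itv/= => s01.
  by have [] := hder s s01.
have {}c01 : 0 <= c <= 1 by move: c01; rewrite in_itv/= => /andP[/ltW -> /ltW ->].
have -> : (F y - F x - (y - x) *m jacobian F x) 0 j = (v *m (jacobian F (x + c *: v) - jacobian F x)) 0 j.
  rewrite mulmxBr !subMxE; congr (_ - _); move: hc.
  by rewrite /g scale0r addr0 scale1r (_ : x + v = y) ?subr0 ?mulr1 ?[x + v]addrC ?subrK.
rewrite (le_trans (le_mx_norm _ _ _))// (le_trans (mx_norm_mul _ _))// mulrAC.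
by rewrite ler_wpM2r// ler_wpM2l// hK.
Qed.

(** The entrance to the Taylor framework: the oscillation of the Jacobian on a segment bounds the
    remainder. *)
Lemma C1_modulus_taylor nu (F : V -> V) : wmod nu -> C1_modulus nu F ->
  exists r L, [/\ 0 < r, 0 <= L,
    taylor [set z : V | `|z| < r] (fun t => L * nu t) F (fun x v => v *m jacobian F x) &
    forall x y, `|x| < r -> `|y| < r -> `|jacobian F x - jacobian F y| <= L * nu `|x - y|].
Proof.
move=> [n1 n2 n3 n4] [U [L [/nbhs_ballP[r /= r0 hr] L0 dF mF]]].
have rU z : `|z| < r -> U z.
  by move=> zr; apply: hr; rewrite -ball_normE/= sub0r normrN.
exists r, (2 * L); split=> //; first by rewrite mulr_ge0// ltW.
  move=> x y xr yr.
  have := @mean_value_ball F r x y (L * nu `|y - x|) (fun z zr => dF z (rU z zr)) xr yr.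
  rewrite mulrA; apply=> s s01.
  have sr : `|x + s *: (y - x)| < r by exact: seg_in_ball.
  apply: (le_trans (le_opnorm _)); apply: (le_trans (mF _ _ (rU _ sr) (rU _ xr))).
  rewrite ler_pM2l// addrAC subrr add0r; apply: n2 => //.
  by rewrite normrZ ler_piMl//; move: s01 => /andP[s0 s1]; rewrite ger0_norm.
move=> x y xr yr; apply: (le_trans (le_opnorm _)).
apply: (le_trans (mF _ _ (rU _ xr) (rU _ yr))).
by have := mulr_ge0 (ltW L0) (n1 _ (normr_ge0 (x - y))); lra.
Qed.

(** The exit from the Taylor framework: the remainder is o(|w|), so [A] must be the Jacobian. In 2 *
    L + 1 the 2 compares [opnorm] with the entrywise norm, and the 1 keeps the constant positive
    when L = 0. *)
Lemma taylor_C1_modulus nu (F : V -> V) (A : V -> 'M[R]_2) (r L : R) : wmod nu -> 0 < r -> 0 <= L ->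
  (forall x y, `|x| < r -> `|y| < r -> `|F y - F x - (y - x) *m A x| <= L * nu `|y - x| * `|y - x|) ->
  (forall x y, `|x| < r -> `|y| < r -> `|A x - A y| <= L * nu `|x - y|) ->
  [/\ C1_modulus nu F, (forall x, `|x| < r -> jacobian F x = A x) &
    C1_on [set z : V | `|z| < r] F].
Proof.
move=> wn r0 L0 tF mA; have [n1 n2 n3 n4] := wn.
have jF x : `|x| < r -> differentiable F x /\ jacobian F x = A x.
  move=> xr; apply: taylor_jacobian => e e0.
  have [d d0 hd] := n4 (e / (L + 1)) (divr_gt0 e0 (ltr_wpDl L0 ltr01)).
  exists (Num.min d (r - `|x|)); first by rewrite lt_min d0 subr_gt0.
  move=> w; rewrite lt_min => /andP[wd wr].
  have xw : `|x + w| < r by rewrite (le_lt_trans (ler_normD _ _))//; lra.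
  have := tF x (x + w) xr xw.
  rewrite (_ : x + w - x = w); last by rewrite addrAC subrr add0r.
  move=> /le_trans; apply.
  rewrite ler_wpM2r//; apply: (@le_trans _ _ (L * (e / (L + 1)))).
    by rewrite ler_wpM2l// (le_trans _ hd)// n2// ltW.
  rewrite mulrCA ler_piMr ?(ltW e0)// ler_pdivrMr ?ltr_wpDl//; lra.
split.
- exists [set z : V | `|z| < r], (2 * L + 1); split.
  + by apply/nbhs_ballP; exists r => // z; rewrite -ball_normE/= sub0r normrN.
  + by rewrite ltr_wpDl// mulr_ge0.
  + by move=> x /jF[].
  + move=> x y xr yr; have [_ ->] := jF x xr; have [_ ->] := jF y yr.
    apply: (le_trans (opnorm_le _)); have := mA x y xr yr.
    by have := n1 _ (normr_ge0 (x - y)); lra.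
- by move=> x /jF[].
- move=> x /= xr; split; first by have [] := jF x xr.
  pose W1 : normedModType R := V; pose W2 : normedModType R := 'M[R]_2.
  suff C : (jacobian F : W1 -> W2) z @[z --> (x : W1)] --> (jacobian F x : W2) by exact: C.
  apply/(@cvgrPdist_le R W2 W1 (nbhs (x : W1)) (nbhs_filter (x : W1))) => e e0.
  have [d d0 hd] := n4 (e / (L + 1)) (divr_gt0 e0 (ltr_wpDl L0 ltr01)).
  apply/nbhs_ballP; exists (Num.min d (r - `|x|)) => /=; first by rewrite lt_min d0 subr_gt0.
  move=> y; rewrite -ball_normE/= lt_min => /andP[xyd xyr].
  have yr : `|y| < r.
    by rewrite -(subrK x y) (le_lt_trans (ler_normD _ _))// distrC; lra.
  have [_ ->] := jF x xr; have [_ ->] := jF y yr.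
  apply: (le_trans (mA _ _ xr yr)); apply: (@le_trans _ _ (L * (e / (L + 1)))).
    by rewrite ler_wpM2l// (le_trans _ hd)// n2// ltW.
  rewrite mulrCA ler_piMr ?(ltW e0)// ler_pdivrMr ?ltr_wpDl//; lra.
Qed.

End Jacobian.

(** * Globalization *)

Section Cutoff.
Variable R : realType.
Local Notation V := 'rV[R]_2.

Definition pos (u : R) := Num.max 0 u.

Lemma pos_ge u : 0 <= u -> pos u = u. Proof. by move=> h; rewrite /pos max_r. Qed.
Lemma pos_le u : u <= 0 -> pos u = 0. Proof. by move=> h; rewrite /pos max_l. Qed.

Lemma pos_lip u v : `|pos u - pos v| <= `|u - v|.
Proof.
wlog uv : u v / u <= v.
  by move=> H; case: (leP u v) => uv; [exact: H|rewrite distrC (distrC u) H// ltW].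
rewrite (distrC u) (ger0_norm (_ : 0 <= v - u)) ?subr_ge0//.
case: (leP 0 u) => u0.
  by rewrite !pos_ge// ?(le_trans u0)// ler_norml; lra.
rewrite (pos_le (ltW u0)); case: (leP 0 v) => v0.
  by rewrite (pos_ge v0) ler_norml; lra.
by rewrite (pos_le (ltW v0)) ler_norml; lra.
Qed.

Lemma sq_pos_taylor u v : `|pos v ^+ 2 - pos u ^+ 2 - 2 * pos u * (v - u)| <= (v - u) ^+ 2.
Proof.
have q := sqr_ge0 (v - u); have qu := sqr_ge0 u; have qv := sqr_ge0 v.
case: (leP 0 u) => u0; [rewrite (pos_ge u0)|rewrite (pos_le (ltW u0))];
  (case: (leP 0 v) => v0; [rewrite (pos_ge v0)|rewrite (pos_le (ltW v0))]).
- have -> : v ^+ 2 - u ^+ 2 - 2 * u * (v - u) = (v - u) ^+ 2 by ring.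
  by rewrite ger0_norm.
- by rewrite ler_norml; apply/andP; split; nra.
- by rewrite expr0n/= mulr0 mul0r !subr0 ger0_norm//; nra.
- by rewrite expr0n/= mulr0 mul0r !subr0 normr0.
Qed.

Definition c11 C (f f' : R -> R) :=
  (forall u v, `|f v - f u - f' u * (v - u)| <= C * (v - u) ^+ 2) /\
  (forall u v, `|f' u - f' v| <= C * `|u - v|).

(** Piecewise quadratic functions in truncated power form: the C^{1,1} bounds follow term by term
    from [sq_pos_taylor], and on each piece an evaluation is a polynomial identity. *)
Definition spline (l : seq (R * R)) s := \sum_(p <- l) p.1 * pos (s - p.2) ^+ 2.
Definition dspline (l : seq (R * R)) s := \sum_(p <- l) p.1 * (2 * pos (s - p.2)).

Lemma c11_spline l : exists2 C, 0 <= C & c11 C (spline l) (dspline l).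
Proof.
elim: l => [|[k n] l [C C0 [h1 h2]]].
  exists 0 => //; split=> u v; rewrite /spline /dspline !big_nil !subrr ?mul0r ?subr0 normr0//.
exists (2 * `|k| + C); first by rewrite addr_ge0// mulr_ge0.
split=> u v; rewrite /spline /dspline !big_cons -!/(spline _ _) -!/(dspline _ _) /=.
  have -> : k * pos (v - n) ^+ 2 + spline l v - (k * pos (u - n) ^+ 2 + spline l u) -
     (k * (2 * pos (u - n)) + dspline l u) * (v - u) =
     k * (pos (v - n) ^+ 2 - pos (u - n) ^+ 2 - 2 * pos (u - n) * ((v - n) - (u - n))) +
     (spline l v - spline l u - dspline l u * (v - u)) by ring.
  rewrite (le_trans (ler_normD _ _))// [leRHS]mulrDl lerD// normrM.
  have := sq_pos_taylor (u - n) (v - n); have -> : v - n - (u - n) = v - u by ring.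
  move=> h; apply: (@le_trans _ _ (`|k| * (v - u) ^+ 2)); first by rewrite ler_wpM2l.
  by rewrite ler_wpM2r ?sqr_ge0//; have := normr_ge0 k; lra.
have -> : k * (2 * pos (u - n)) + dspline l u - (k * (2 * pos (v - n)) + dspline l v) =
  2 * k * (pos (u - n) - pos (v - n)) + (dspline l u - dspline l v) by ring.
rewrite (le_trans (ler_normD _ _))// [leRHS]mulrDl lerD// !normrM (ger0_norm (ler0n _ 2)).
by rewrite ler_wpM2l ?mulr_ge0// (le_trans (pos_lip _ _))//; have -> : u - n - (v - n) = u - v by ring.
Qed.

(* Pairs (coefficient, knot), solved for from the prescribed values on [-1, 1] and
   the vanishing beyond the last knot. *)
Let bump_nodes : seq (R * R) :=
  [:: (2, -2); (-4, - (3 / 2)); (2, -1); (-2, 1); (4, 3 / 2); (-2, 2)].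
Let wave_nodes : seq (R * R) :=
  [:: (- (1 / 4), -4); (5 / 4, -2); (-1, -1); (-1, 1); (5 / 4, 2); (- (1 / 4), 4)].

Ltac eval_spline := rewrite /spline /dspline !big_cons big_nil /=;
  repeat first [rewrite pos_ge; last lra | rewrite pos_le; last lra].

Lemma bump_in s : `|s| <= 1 -> spline bump_nodes s = 1.
Proof. by rewrite ler_norml => /andP[h1 h2]; eval_spline; field. Qed.

Lemma bump_out s : 4 <= `|s| -> spline bump_nodes s = 0 /\ dspline bump_nodes s = 0.
Proof.
rewrite ler_normr => /orP[] h; split; eval_spline; by field.
Qed.

Lemma wave_in s : `|s| <= 1 -> spline wave_nodes s = s.
Proof. by rewrite ler_norml => /andP[h1 h2]; eval_spline; field. Qed.

Lemma wave_out s : 4 <= `|s| -> spline wave_nodes s = 0 /\ dspline wave_nodes s = 0.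
Proof.
rewrite ler_normr => /orP[] h; split; eval_spline; by field.
Qed.

(** Expansion from the point 4, where f and f' vanish; there |s - 4| <= 8, hence the 64. *)
Lemma c11_bound C f f' : 0 <= C -> c11 C f f' -> (forall s, 4 <= `|s| -> f s = 0 /\ f' s = 0) ->
  forall s, `|f s| <= 64 * C /\ `|f' s| <= 64 * C.
Proof.
move=> C0 [h1 h2] h0 s; have [f4 f4'] : f 4 = 0 /\ f' 4 = 0 by apply: h0; rewrite ger0_norm.
case: (leP 4 `|s|) => s4; first by have [-> ->] := h0 s s4; rewrite normr0 mulr_ge0.
have := h1 4 s; have := h2 s 4; rewrite f4 f4' mul0r !subr0.
move: s4; rewrite ltr_norml => /andP[s1 s2].
have n8 : `|s - 4| <= 8 by rewrite ler_norml; lra.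
have q8 : (s - 4) ^+ 2 <= 64.
  by rewrite -real_normK ?num_real//; have := normr_ge0 (s - 4); nra.
by move=> a1 a2; split; [apply: (le_trans a2)|apply: (le_trans a1)]; nra.
Qed.

(** The identity on the unit ball and 0 beyond radius 4. The perturbation will be composed with this
    map, not multiplied by a bump: the composition stays in the ball where the original germ is
    controlled, and the chain rule gives its derivative. *)
Definition cutoff_fun (x : V) : V := \row_j (if j == 0
  then spline wave_nodes (x 0 0) * spline bump_nodes (x 0 1)
  else spline bump_nodes (x 0 0) * spline wave_nodes (x 0 1)).

Definition cutoff_der (x : V) : 'M[R]_2 := \matrix_(i, j) (if j == 0
  then if i == 0 then dspline wave_nodes (x 0 0) * spline bump_nodes (x 0 1)
       else spline wave_nodes (x 0 0) * dspline bump_nodes (x 0 1)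
  else if i == 0 then dspline bump_nodes (x 0 0) * spline wave_nodes (x 0 1)
       else spline bump_nodes (x 0 0) * dspline wave_nodes (x 0 1)).

Let bounded T (f : R -> R) := forall s, `|f s| <= T.
Let lip T (f : R -> R) := forall u v, `|u - v| <= 1 -> `|f u - f v| <= 2 * T * `|u - v|.

Let prod_lip T f g x1 x2 y1 y2 d : 1 <= T -> bounded T f -> bounded T g -> lip T f -> lip T g ->
  d <= 1 -> `|x1 - y1| <= d -> `|x2 - y2| <= d ->
  `|f x1 * g x2 - f y1 * g y2| <= 6 * T ^+ 2 * d.
Proof.
move=> T1 bf bg lf lg d1 h1 h2.
have -> : f x1 * g x2 - f y1 * g y2 = (f x1 - f y1) * g x2 + f y1 * (g x2 - g y2) by ring.
rewrite (le_trans (ler_normD _ _))// !normrM.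
have T0 : 0 <= T by lra.
have d0 : 0 <= d by apply: le_trans h1.
have a1 : `|f x1 - f y1| <= 2 * T * d.
  by apply: (le_trans (lf _ _ _)); rewrite ?(le_trans h1)// ler_wpM2l// mulr_ge0.
have a2 : `|g x2 - g y2| <= 2 * T * d.
  by apply: (le_trans (lg _ _ _)); rewrite ?(le_trans h2)// ler_wpM2l// mulr_ge0.
apply: (@le_trans _ _ (2 * T * d * T + T * (2 * T * d))).
  by apply: lerD; apply: ler_pM.
have : 0 <= T ^+ 2 * d by rewrite mulr_ge0 ?sqr_ge0.
by rewrite expr2; lra.
Qed.

Let prod_taylor T f f' g g' x1 x2 y1 y2 d : 1 <= T -> c11 T f f' -> c11 T g g' ->
  bounded T f -> bounded T g -> lip T f -> lip T g ->
  d <= 1 -> `|y1 - x1| <= d -> `|y2 - x2| <= d ->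
  `|f y1 * g y2 - f x1 * g x2 - ((y1 - x1) * (f' x1 * g x2) + (y2 - x2) * (f x1 * g' x2))|
  <= 6 * T ^+ 2 * d ^+ 2.
Proof.
move=> T1 [tf _] [tg _] bf bg lf lg d1 h1 h2.
have T0 : 0 <= T by lra.
have d0 : 0 <= d by apply: le_trans h1.
have -> : f y1 * g y2 - f x1 * g x2 - ((y1 - x1) * (f' x1 * g x2) + (y2 - x2) * (f x1 * g' x2)) =
  (f y1 - f x1 - f' x1 * (y1 - x1)) * g x2 + f x1 * (g y2 - g x2 - g' x2 * (y2 - x2)) +
  (f y1 - f x1) * (g y2 - g x2) by ring.
have sqle (u : R) : `|u| <= d -> u ^+ 2 <= d ^+ 2.
  by move=> ud; rewrite -real_normK ?num_real// lerXn2r ?nnegrE.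
have a1 : `|f y1 - f x1| <= 2 * T * d.
  by apply: (le_trans (lf _ _ _)); rewrite ?(le_trans h1)// ler_wpM2l// mulr_ge0.
have a2 : `|g y2 - g x2| <= 2 * T * d.
  by apply: (le_trans (lg _ _ _)); rewrite ?(le_trans h2)// ler_wpM2l// mulr_ge0.
have b1 : `|f y1 - f x1 - f' x1 * (y1 - x1)| <= T * d ^+ 2.
  by apply: (le_trans (tf _ _)); rewrite ler_wpM2l// sqle.
have b2 : `|g y2 - g x2 - g' x2 * (y2 - x2)| <= T * d ^+ 2.
  by apply: (le_trans (tg _ _)); rewrite ler_wpM2l// sqle.
have -> : 6 * T ^+ 2 * d ^+ 2 = T * d ^+ 2 * T + T * (T * d ^+ 2) + 2 * T * d * (2 * T * d) by ring.
rewrite (le_trans (ler_normD _ _))// lerD//; last by rewrite normrM ler_pM.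
by rewrite (le_trans (ler_normD _ _))// lerD// normrM ler_pM.
Qed.

(** The minimum with 1 records that the derivative is Lipschitz at small distances and bounded at
    large ones; after rescaling it is the left factor in [wmod_le_scale]. *)
Lemma cutoff_spec : exists T : R, [/\ 1 <= T,
  forall x, `|cutoff_fun x| <= T /\ `|cutoff_der x| <= T,
  forall x y, `|cutoff_fun y - cutoff_fun x| <= T * `|y - x|,
  forall x y, `|cutoff_der x - cutoff_der y| <= T * Num.min 1 `|x - y| &
  forall x y, `|cutoff_fun y - cutoff_fun x - (y - x) *m cutoff_der x| <=
    T * `|y - x| * Num.min 1 `|y - x|].
Proof.
have [C1 C10 cb] := c11_spline bump_nodes; have [C2 C20 cw] := c11_spline wave_nodes.
have bb := c11_bound C10 cb bump_out; have bw := c11_bound C20 cw wave_out.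
pose T := 64 * (C1 + C2) + 1.
have T1 : 1 <= T by rewrite /T; lra.
have T0 : 0 <= T by rewrite (le_trans ler01).
have weak C f f' : C <= T -> c11 C f f' -> c11 T f f'.
  move=> CT [h1 h2]; split=> u v.
    by rewrite (le_trans (h1 _ _))// ler_wpM2r// sqr_ge0.
  by rewrite (le_trans (h2 _ _))// ler_wpM2r.
have tb : c11 T (spline bump_nodes) (dspline bump_nodes) by apply: weak cb; rewrite /T; lra.
have tw : c11 T (spline wave_nodes) (dspline wave_nodes) by apply: weak cw; rewrite /T; lra.
have Bb : bounded T (spline bump_nodes).
  by move=> s; have [h _] := bb s; rewrite (le_trans h)// /T; lra.
have Bb' : bounded T (dspline bump_nodes).
  by move=> s; have [_ h] := bb s; rewrite (le_trans h)// /T; lra.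
have Bw : bounded T (spline wave_nodes).
  by move=> s; have [h _] := bw s; rewrite (le_trans h)// /T; lra.
have Bw' : bounded T (dspline wave_nodes).
  by move=> s; have [_ h] := bw s; rewrite (le_trans h)// /T; lra.
have Ld f f' : c11 T f f' -> lip T f'.
  move=> [_ h] u v _; rewrite (le_trans (h _ _))// ler_wpM2r//; lra.
have Lf f f' : c11 T f f' -> bounded T f' -> lip T f.
  move=> [h _] b' u v uv; have := h v u; have := b' v.
  have n0 := normr_ge0 (u - v).
  have e2 : (u - v) ^+ 2 <= `|u - v| by rewrite -real_normK ?num_real//; nra.
  move=> q1 q2; rewrite -(subrK (f' v * (u - v)) (f u - f v)) (le_trans (ler_normD _ _))//.
  have p1 : `|f' v * (u - v)| <= T * `|u - v| by rewrite normrM ler_wpM2r.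
  have p2 : T * (u - v) ^+ 2 <= T * `|u - v| by rewrite ler_wpM2l.
  lra.
have Lb := Lf _ _ tb Bb'; have Lw := Lf _ _ tw Bw'.
have Lb' := Ld _ _ tb; have Lw' := Ld _ _ tw.
have TT : T * T <= T ^+ 2 * 1 by rewrite expr2 mulr1.
pose Q := 12 * T ^+ 2.
have T2 : 1 <= T ^+ 2 by rewrite expr_ge1.
have Q1 : 1 <= Q by rewrite /Q; lra.
have Q0 : 0 <= Q by rewrite (le_trans ler01).
have fle x : `|cutoff_fun x| <= T ^+ 2.
  apply: mx_norm_le => [|i j]; first lra.
  by rewrite mxE; case: ifP => _; rewrite normrM expr2 ler_pM.
have dle x : `|cutoff_der x| <= T ^+ 2.
  apply: mx_norm_le => [|i j]; first lra.
  by rewrite mxE; case: ifP => _; case: ifP => _; rewrite normrM expr2 ler_pM.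
have entry (x y : V) i : `|x 0 i - y 0 i| <= `|x - y| by rewrite -subMxE le_mx_norm.
have LP f g (x y : V) := @prod_lip T f g (x 0 0) (x 0 1) (y 0 0) (y 0 1) `|x - y| T1.
exists (2 * Q); split.
- lra.
- by move=> x; have := fle x; have := dle x; rewrite /Q; lra.
- move=> x y; have n0 := normr_ge0 (y - x); case: (leP `|y - x| 1) => h.
    apply: (@le_trans _ _ (6 * T ^+ 2 * `|y - x|)); last by rewrite ler_wpM2r// /Q; lra.
    apply: mx_norm_le => [|i j]; first by rewrite mulr_ge0//; lra.
    by rewrite subMxE !mxE; case: ifP => _; apply: LP.
  rewrite (le_trans (ler_normB _ _))//; have := fle x; have := fle y.
  have : Q <= Q * `|y - x| by rewrite ler_peMr// ltW.
  by rewrite /Q; lra.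
- move=> x y; have n0 := normr_ge0 (x - y); case: (leP `|x - y| 1) => h.
    apply: (@le_trans _ _ (6 * T ^+ 2 * `|x - y|)).
      apply: mx_norm_le => [|i j]; first by rewrite mulr_ge0//; lra.
      by rewrite subMxE !mxE; case: ifP => _; case: ifP => _; apply: LP.
    by rewrite ?min_r// ler_wpM2r// /Q; lra.
  rewrite ?min_l ?mulr1 ?(ltW h)// (le_trans (ler_normB _ _))//; have := dle x; have := dle y.
  by rewrite /Q; lra.
- move=> x y; have n0 := normr_ge0 (y - x); case: (leP `|y - x| 1) => h.
    rewrite ?min_r//; apply: (@le_trans _ _ (6 * T ^+ 2 * `|y - x| ^+ 2)); last first.
      rewrite -[leRHS]mulrA -(expr2 `|y - x|) ler_wpM2r ?sqr_ge0// /Q; lra.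
    apply: mx_norm_le => [|i j]; first by rewrite mulr_ge0 ?sqr_ge0//; lra.
    rewrite (ord1 i) subMxE subMxE mul2E; case: (ord2E j) => ->; rewrite !mxE/=.
      by apply: prod_taylor => //; exact: entry.
    by apply: prod_taylor => //; exact: entry.
  rewrite ?min_l ?mulr1 ?(ltW h)// (le_trans (ler_normB _ _))//.
  have a1 : `|cutoff_fun y - cutoff_fun x| <= Q * `|y - x|.
    rewrite (le_trans (ler_normB _ _))//; have := fle x; have := fle y.
    have : Q <= Q * `|y - x| by rewrite ler_peMr// ltW.
    by rewrite /Q; lra.
  have a2 : `|(y - x) *m cutoff_der x| <= Q * `|y - x|.
    rewrite (le_trans (mx_norm_mul _ _))// mulrAC ler_wpM2r//.
    by have := dle x; rewrite /Q; lra.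
  lra.
Qed.

Lemma cutoff_in x : `|x| <= 1 -> cutoff_fun x = x.
Proof.
move=> x1; have x0 := le_trans (le_mx_norm x 0 0) x1; have x1' := le_trans (le_mx_norm x 0 1) x1.
by apply: rv2P; rewrite mxE/= !bump_in// !wave_in// ?mulr1 ?mul1r.
Qed.

Lemma cutoff_out x : 4 <= `|x| -> cutoff_fun x = 0 /\ cutoff_der x = 0.
Proof.
rewrite norm_rv2 le_max => /orP[] h; have [b1 b2] := bump_out h; have [w1 w2] := wave_out h;
  split; apply/matrixP => i j; rewrite !mxE ?b1 ?b2 ?w1 ?w2 ?mul0r ?mulr0;
  by case: ifP => //; case: ifP.
Qed.

End Cutoff.

(** * Global extensions close to a saddle and their inverses *)

Section Globalization.
Variable R : realType.
Local Notation V := 'rV[R]_2.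

Definition global_taylor (nu : R -> R) (L : R) (F : V -> V) (A : V -> 'M[R]_2) :=
  (forall x y, `|F y - F x - (y - x) *m A x| <= L * nu `|y - x| * `|y - x|) /\
  (forall x y, `|A x - A y| <= L * nu `|x - y|).

Lemma global_taylor_near nu L F A M ep : wmod nu -> 0 <= L -> global_taylor nu L F A ->
  (forall x, `|A x - M| <= ep) ->
  forall x y, `|F y - F x - (y - x) *m M| <= 2 * ep * `|y - x|.
Proof.
move=> wn L0 [tF mA] hep x y.
pose f (z : V) : V := F z - z *m M.
have tf : taylor setT (fun t => L * nu t) f (fun z v => v *m (A z - M)).
  move=> u v _ _; have -> : f v - f u - (v - u) *m (A u - M) = F v - F u - (v - u) *m A u.
    by rewrite /f; apply/matrixP => i j; rewrite !mulmxBr !mulmxBl !mxE; ring.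
  exact: tF.
have := @taylor_lip _ _ _ setT _ f _ x y (2 * ep) (wmod_scale wn L0) tf.
have -> : f y - f x = F y - F x - (y - x) *m M.
  by rewrite /f; apply/matrixP => i j; rewrite !mulmxBl !mxE; ring.
apply=> // z _ _ v; rewrite (le_trans (mx_norm_mul _ _))// mulrAC ler_wpM2r//.
by rewrite ler_wpM2l.
Qed.

Lemma mulmx_diff (M A B C D : 'M[R]_2) :
  M + A *m B - (M + C *m D) = A *m (B - D) + (A - C) *m D.
Proof.
by rewrite mulmxBr mulmxBl; apply/matrixP => i j; rewrite !mxE; ring.
Qed.

(** Near the origin F0 = M + f with a derivative of f of size nu r at scale r. Composing f with the
    cutoff at scale r costs a derivative oscillation min(1, d / r), but it multiplies nu r, and
    [wmod_le_scale] bounds the product by nu d: the modulus survives, and a small r makes the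
    deviation from M at most [ep]. *)
Lemma globalize_map nu (F0 : V -> V) (M : 'M[R]_2) (ep : R) : wmod nu -> 0 < ep ->
  C1_modulus nu F0 -> F0 0 = 0 -> jacobian F0 0 = M ->
  exists F A L rho r, [/\ 0 <= L /\ 0 < r, global_taylor nu L F A,
    forall x, `|A x - M| <= ep,
    F 0 = 0 /\ A 0 = M &
    (forall x, `|x| < r -> F x = F0 x) /\ (forall x, rho <= `|x| -> A x = M)].
Proof.
move=> wn ep0 hF F00 JM; have [n1 n2 n3 n4] := wn.
have [r0 [L [r00 L0 tF mJ]]] := C1_modulus_taylor wn hF.
have [T [T1 cb clip dlip ctay]] := cutoff_spec R.
have T0 : 0 < T by exact: lt_le_trans T1.
pose f z : V := F0 z - z *m M.
pose E z : 'M[R]_2 := jacobian F0 z - M.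
have tf x y : `|x| < r0 -> `|y| < r0 -> `|f y - f x - (y - x) *m E x| <= L * nu `|y - x| * `|y - x|.
  move=> xr yr; have -> : f y - f x - (y - x) *m E x = F0 y - F0 x - (y - x) *m jacobian F0 x.
    by rewrite /f /E; apply/matrixP => i j; rewrite !mulmxBr !mulmxBl !mxE; ring.
  exact: tF.
have mE x y : `|x| < r0 -> `|y| < r0 -> `|E x - E y| <= L * nu `|x - y|.
  move=> xr yr; have -> : E x - E y = jacobian F0 x - jacobian F0 y.
    by rewrite /E opprB addrA subrK.
  exact: mJ.
have E0 : E 0 = 0 by rewrite /E JM subrr.
have k0 : 0 < 2 * T * T * L + 1 by rewrite ltr_wpDl// !mulr_ge0// ltW.
have [d d0 hd] := n4 _ (divr_gt0 ep0 k0).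
pose r := Num.min d (r0 / (2 * T)).
have r1 : 0 < r by rewrite lt_min d0 divr_gt0// mulr_gt0.
have rT : T * r < r0.
  have : r <= r0 / (2 * T) by rewrite /r ge_min lexx orbT.
  by rewrite ler_pdivlMr ?mulr_gt0//; nra.
have nur : nu r <= ep / (2 * T * T * L + 1).
  by apply: le_trans hd; apply: n2; [exact: ltW|rewrite /r ge_min lexx].
pose th (z : V) : V := r *: cutoff_fun (r^-1 *: z).
pose Dth (z : V) := cutoff_der (r^-1 *: z).
have nr : `|r^-1| = r^-1 by rewrite ger0_norm// invr_ge0 ltW.
have nrr : `|r| = r by rewrite ger0_norm// ltW.
have thb z : `|th z| <= T * r.
  by rewrite /th normrZ nrr mulrC ler_pM2r//; have [] := cb (r^-1 *: z).
have thr z : `|th z| < r0 by exact: le_lt_trans (thb z) rT.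
have Dthb z : `|Dth z| <= T by have [] := cb (r^-1 *: z).
have sc x y : r^-1 *: y - r^-1 *: x = r^-1 *: (y - x) by rewrite scalerBr.
have thl x y : `|th y - th x| <= T * `|y - x|.
  rewrite /th -scalerBr normrZ nrr; have := clip (r^-1 *: x) (r^-1 *: y).
  rewrite sc normrZ nr => h.
  apply: (@le_trans _ _ (r * (T * (r^-1 * `|y - x|)))); first by rewrite ler_pM2l.
  have -> : r * (T * (r^-1 * `|y - x|)) = T * `|y - x| by field; rewrite gt_eqF.
  by [].
have Dthl x y : `|Dth x - Dth y| <= T * Num.min 1 (`|x - y| / r).
  by have := dlip (r^-1 *: x) (r^-1 *: y); rewrite sc normrZ nr (mulrC r^-1).
have tht x y : `|th y - th x - (y - x) *m Dth x| <= T * `|y - x| * Num.min 1 (`|y - x| / r).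
  have := ctay (r^-1 *: x) (r^-1 *: y); rewrite sc normrZ nr (mulrC r^-1) => h.
  have -> : th y - th x - (y - x) *m Dth x =
     r *: (cutoff_fun (r^-1 *: y) - cutoff_fun (r^-1 *: x) - (r^-1 *: (y - x)) *m Dth x).
    rewrite /th scalerBr scalerBr scalemxAl scalerA mulfV ?gt_eqF// scale1r//.
  rewrite normrZ nrr; apply: (@le_trans _ _ (r * (T * (`|y - x| / r) * Num.min 1 (`|y - x| / r)))).
    by rewrite ler_pM2l.
  rewrite le_eqVlt; apply/orP; left; apply/eqP; set m := Num.min _ _; field.
  by rewrite gt_eqF.
have Eb z : `|E (th z)| <= T * L * nu r.
  have := mE (th z) 0 (thr z); rewrite E0 !subr0 normr0 => /(_ r00)/le_trans; apply.
  rewrite -mulrA mulrCA ler_wpM2l//; apply: (@le_trans _ _ (nu (T * r))).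
    by apply: n2.
  by apply: n3 => //; exact: ltW.
have mu_min x y : Num.min 1 (`|y - x| / r) * nu r <= nu `|y - x|.
  exact: wmod_le_scale.
exists (fun z => z *m M + f (th z)), (fun z => M + Dth z *m E (th z)).
exists (T * T * L + 2 * T * T * L + 2 * T * T * L), (4 * r), r; split=> //.
- split=> //; by rewrite !addr_ge0// !mulr_ge0// ltW.
- split=> x y.
    have -> : y *m M + f (th y) - (x *m M + f (th x)) - (y - x) *m (M + Dth x *m E (th x)) =
      (f (th y) - f (th x) - (th y - th x) *m E (th x)) +
      (th y - th x - (y - x) *m Dth x) *m E (th x).
      rewrite [in RHS](mulmxBl (th y - th x)) mulmxDr mulmxA [(y - x) *m M]mulmxBl.
      set a := (y - x) *m Dth x *m E (th x); set c := (th y - th x) *m _.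
      by apply/matrixP => i j; rewrite !mxE; ring.
    have n0 := normr_ge0 (y - x); have nn := n1 _ n0.
    rewrite (le_trans (ler_normD _ _))// !mulrDl.
    apply: (@le_trans _ _ (T * T * L * nu `|y - x| * `|y - x| + 2 * T * T * L * nu `|y - x| * `|y - x|)).
      apply: lerD.
        apply: (le_trans (tf _ _ (thr _) (thr _))).
        have -> : T * T * L * nu `|y - x| * `|y - x| = L * (T * nu `|y - x|) * (T * `|y - x|) by ring.
        apply: ler_pM => //; first by rewrite mulr_ge0// n1.
        rewrite ler_wpM2l//; apply: (@le_trans _ _ (nu (T * `|y - x|))); first exact: n2.
        exact: n3.
      rewrite (le_trans (mx_norm_mul _ _))//.
      apply: (@le_trans _ _ (2 * (T * `|y - x| * Num.min 1 (`|y - x| / r)) * (T * L * nu r))).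
        by apply: ler_pM; rewrite ?mulr_ge0// ler_wpM2l.
      have -> : 2 * (T * `|y - x| * Num.min 1 (`|y - x| / r)) * (T * L * nu r) =
        2 * T * T * L * `|y - x| * (Num.min 1 (`|y - x| / r) * nu r) by ring.
      have -> : 2 * T * T * L * nu `|y - x| * `|y - x| = 2 * T * T * L * `|y - x| * nu `|y - x| by ring.
      by rewrite ler_wpM2l// !mulr_ge0// ltW.
    by have : 0 <= T * T * L * nu `|y - x| * `|y - x| by [rewrite !mulr_ge0// ltW]; lra.
  have n0 := normr_ge0 (x - y); have nn := n1 _ n0.
  have -> : M + Dth x *m E (th x) - (M + Dth y *m E (th y)) =
    Dth x *m (E (th x) - E (th y)) + (Dth x - Dth y) *m E (th y).
    exact: mulmx_diff.
  rewrite (le_trans (ler_normD _ _))// !mulrDl.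
  apply: (@le_trans _ _ (2 * T * T * L * nu `|x - y| + 2 * T * T * L * nu `|x - y|)).
    apply: lerD; rewrite (le_trans (mx_norm_mul _ _))//.
      have -> : 2 * T * T * L * nu `|x - y| = 2 * T * (L * (T * nu `|x - y|)) by ring.
      apply: ler_pM; rewrite ?mulr_ge0//; first by rewrite ler_wpM2l.
      apply: (le_trans (mE _ _ (thr _) (thr _))); rewrite ler_wpM2l//.
      apply: (@le_trans _ _ (nu (T * `|x - y|))); first exact: n2.
      exact: n3.
    apply: (@le_trans _ _ (2 * (T * Num.min 1 (`|x - y| / r)) * (T * L * nu r))).
      by apply: ler_pM; rewrite ?mulr_ge0// ler_wpM2l.
    have -> : 2 * (T * Num.min 1 (`|x - y| / r)) * (T * L * nu r) =
        2 * T * T * L * (Num.min 1 (`|x - y| / r) * nu r) by ring.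
    by rewrite ler_wpM2l ?mulr_ge0 ?(ltW T0)//; exact: wmod_le_scale.
  by have : 0 <= T * T * L * nu `|x - y| by [rewrite !mulr_ge0// ltW]; lra.
- move=> x; rewrite addrAC subrr add0r (le_trans (mx_norm_mul _ _))//.
  apply: (@le_trans _ _ (2 * T * (T * L * nu r))).
    by apply: ler_pM; rewrite ?mulr_ge0// ler_wpM2l.
  apply: (@le_trans _ _ (2 * T * T * L * (ep / (2 * T * T * L + 1)))).
    have -> : 2 * T * (T * L * nu r) = 2 * T * T * L * nu r by ring.
    by rewrite ler_wpM2l// !mulr_ge0// ltW.
  by rewrite mulrCA ler_piMr ?(ltW ep0)// ler_pdivrMr//; lra.
- have th0 : th 0 = 0 by rewrite /th scaler0 cutoff_in ?normr0// scaler0.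
  by rewrite th0 E0 mulmx0 addr0 /f F00 mul0mx subrr addr0.
- split=> x xr; last first.
    have xr4 : 4 <= `|r^-1 *: x| by rewrite normrZ nr mulrC ler_pdivlMr.
    by have [_ D0] := cutoff_out xr4; rewrite /Dth D0 mul0mx addr0.
  have -> : th x = x.
    rewrite /th cutoff_in ?scalerA ?mulfV ?scale1r ?gt_eqF//.
    by rewrite normrZ nr mulrC ler_pdivrMr// mul1r ltW.
  by rewrite /f addrC subrK.
Qed.

Lemma saddle_norm_le (p q k : R) : `|p| <= k -> `|q| <= k -> `|saddle p q| <= k.
Proof.
move=> pk qk; apply: mx_norm_le; first exact: le_trans pk.
move=> i j; rewrite /saddle !mxE; case: (i == j); rewrite ?mulr1n ?mulr0n ?normr0.
  by case: ifP.
exact: le_trans pk.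
Qed.

Lemma mul_saddle_norm (m : nat) (p q k : R) (v : 'M[R]_(m, 2)) : `|p| <= k -> `|q| <= k ->
  `|v *m saddle p q| <= k * `|v|.
Proof.
move=> pk qk; have k0 : 0 <= k by exact: le_trans pk.
apply: mx_norm_le => [|i j]; first by rewrite mulr_ge0.
by case: (ord2E j) => ->; rewrite ?mul_saddle0 ?mul_saddle1 normrM mulrC ler_pM// le_mx_norm.
Qed.

(** If v A = 0, then v = - v (A - M) Mi, of norm at most |v| / 2, so v = 0. The bounds on the
    inverse come from the resolvent identity invmx A - Mi = invmx A (M - A) Mi. *)
Lemma saddle_perturb_inv (p q k : R) (A : 'M[R]_2) (ep : R) : p != 0 -> q != 0 ->
  `|p^-1| <= k -> `|q^-1| <= k -> `|A - saddle p q| <= ep -> 4 * k * ep <= 1 ->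
  [/\ A \in unitmx, `|invmx A| <= 2 * k &
      `|invmx A - saddle p^-1 q^-1| <= 8 * k * k * ep].
Proof.
move=> p0 q0 pk qk Aep kep.
have k0 : 0 <= k by exact: le_trans pk.
have ep0 : 0 <= ep by exact: le_trans Aep.
set M := saddle p q in Aep *; set Mi := saddle p^-1 q^-1.
have MMi : M *m Mi = 1%:M by exact: saddleV.
have uA : A \in unitmx.
  rewrite -row_free_unit; apply: inj_row_free => v vA.
  have vM : v = - (v *m (A - M)) *m Mi.
    by rewrite mulmxBr vA sub0r opprK -mulmxA MMi mulmx1.
  have : `|v| <= 2^-1 * `|v|.
    rewrite {1}vM (le_trans (mul_saddle_norm _ pk qk))// normrN.
    apply: (@le_trans _ _ (k * (2 * `|v| * ep))).
      by rewrite ler_wpM2l// (le_trans (mx_norm_mul _ _))// ler_wpM2l// mulr_ge0.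
    have : 4 * k * ep * `|v| <= 1 * `|v| by rewrite ler_wpM2r.
    lra.
  by move=> h; apply/eqP; rewrite -normr_le0; have := normr_ge0 v; lra.
have res : invmx A - Mi = invmx A *m (M - A) *m Mi.
  by rewrite mulmxBr mulmxBl -mulmxA MMi mulmx1 mulVmx// mul1mx.
have MAep : `|M - A| <= ep by rewrite distrC.
have d1 : `|invmx A - Mi| <= k * (2 * `|invmx A| * ep).
  rewrite res (le_trans (mul_saddle_norm _ pk qk))// ler_wpM2l//.
  by rewrite (le_trans (mx_norm_mul _ _))// ler_wpM2l// mulr_ge0.
have i1 : `|invmx A| <= 2 * k.
  have Mk : `|Mi| <= k by exact: saddle_norm_le.
  have := ler_normD (invmx A - Mi) Mi; rewrite subrK => h.
  have n0 := normr_ge0 (invmx A).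
  have : 4 * k * ep * `|invmx A| <= 1 * `|invmx A| by rewrite ler_wpM2r.
  lra.
split=> //; apply: (le_trans d1).
have h : k * ep * `|invmx A| <= k * ep * (2 * k) by rewrite ler_wpM2l// mulr_ge0.
have kk : 0 <= k * k * ep by rewrite !mulr_ge0.
lra.
Qed.

(** Solving F z = w amounts to finding a fixed point of z + (w - F z) Mi, a contraction of ratio 1 /
    2; the same estimate gives injectivity. *)
Lemma near_saddle_bij (F : V -> V) (p q k ep : R) : p != 0 -> q != 0 ->
  `|p^-1| <= k -> `|q^-1| <= k -> 2 * k * ep <= 2^-1 ->
  (forall x y, `|F y - F x - (y - x) *m saddle p q| <= 2 * ep * `|y - x|) ->
  exists G, cancel F G /\ cancel G F.
Proof.
move=> p0 q0 pk qk kep hF.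
have k0 : 0 <= k by exact: le_trans pk.
set M := saddle p q in hF; set Mi := saddle p^-1 q^-1.
have MMi : M *m Mi = 1%:M by exact: saddleV.
have MiM : Mi *m M = 1%:M by rewrite mulmx1C.
have contr x y : `|(y - x) - (F y - F x) *m Mi| <= 2^-1 * `|y - x|.
  have -> : y - x - (F y - F x) *m Mi = - ((F y - F x - (y - x) *m M) *m Mi).
    by rewrite [(_ - _ *m M) *m Mi]mulmxBl -mulmxA MMi mulmx1 opprB.
  rewrite normrN (le_trans (mul_saddle_norm _ pk qk))//.
  apply: (@le_trans _ _ (k * (2 * ep * `|y - x|))); first by rewrite ler_wpM2l.
  by rewrite mulrA; apply: ler_wpM2r => //; lra.
have surj w : exists z, F z = w.
  pose T z := z + (w - F z) *m Mi.
  have TT x y : `|T y - T x| <= 2^-1 * `|y - x|.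
    apply: le_trans (contr x y); rewrite /T le_eqVlt; apply/orP; left; apply/eqP; congr (`|_|).
    by apply/matrixP => i j; rewrite !mulmxBl !mxE; ring.
  pose u n := iter n T 0.
  have us n : `|u n.+1 - u n| <= `|T 0| * 2^-1 ^+ n.
    elim: n => [|n ih]; first by rewrite /u /= subr0 expr0 mulr1.
    rewrite exprS mulrCA (le_trans (TT _ _))// ler_wpM2l//.
  have [|z hz] := @cauchyc_conv_mx R _ _ u.
    apply: (@cauchyc_series _ _ _ (fun n => `|T 0| * 2^-1 ^+ n) (`|T 0| * 2)) => //.
    move=> n; rewrite -mulr_sumr ler_wpM2l//.
    suff -> : \sum_(k < n) 2^-1 ^+ k = 2 - 2 * 2^-1 ^+ n :> R.
      by rewrite gerBl mulr_ge0// exprn_ge0.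
    elim: n => [|n ih]; first by rewrite big_ord0 expr0; lra.
    by rewrite big_ord_recr/= ih exprS; lra.
  have Tz : T z = z.
    apply: (conv_uniq (u := fun n => T (u n))); last exact: conv_shift hz.
    apply: (conv_lip (K := 2^-1)) hz => x; exact: TT.
  exists z; move: Tz; rewrite /T => /(canRL (addKr z)); rewrite addNr.
  move=> /(congr1 (fun X => X *m M)); rewrite -mulmxA MiM mulmx1 mul0mx.
  by move/eqP; rewrite subr_eq0 => /eqP.
have inj x y : F x = F y -> x = y.
  move=> Fxy; have := contr x y; rewrite Fxy subrr mul0mx subr0 => h.
  apply/esym/eqP; rewrite -subr_eq0 -normr_le0; have := normr_ge0 (y - x); lra.
have [G hG] := choice surj.
by exists G; split=> [x|//]; apply: inj; rewrite hG.
Qed.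

Lemma globalize nu (F0 : V -> V) (p q ep : R) : wmod nu -> 0 < ep -> p != 0 -> q != 0 ->
  C1_modulus nu F0 -> F0 0 = 0 -> jacobian F0 0 = saddle p q ->
  exists F G A B L rho r,
   [/\ [/\ 0 <= L, 0 < r & 0 <= rho], [/\ cancel F G, cancel G F & F 0 = 0],
       global_taylor nu L F A /\ global_taylor nu L G B,
       [/\ forall x, `|A x - saddle p q| <= ep,
           forall x, `|B x - saddle p^-1 q^-1| <= ep, A 0 = saddle p q,
           B 0 = saddle p^-1 q^-1 &
           forall x, rho <= `|x| -> A x = saddle p q /\ B x = saddle p^-1 q^-1] &
       forall x, `|x| < r -> F x = F0 x].
Proof.
move=> wn ep0 p0 q0 hF F00 J0; have [n1 n2 n3 n4] := wn.
pose k := Num.max 1 (Num.max `|p^-1| `|q^-1|).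
have k1 : 1 <= k by rewrite /k le_max lexx.
have pk : `|p^-1| <= k by rewrite /k !le_max lexx orbT.
have qk : `|q^-1| <= k by rewrite /k !le_max lexx !orbT.
have k0 : 0 < k by exact: lt_le_trans k1.
(* Chosen so that the error 8 k k e1 of [saddle_perturb_inv] is at most [ep]: the inverse is then as
   close to its linear part as the map itself. *)
pose e1 := Num.min 1 ep / (8 * k * k).
have kk : 0 < 8 * k * k by rewrite !mulr_gt0.
have e10 : 0 < e1 by rewrite divr_gt0// lt_min ltr01.
have e1k : 8 * k * k * e1 = Num.min 1 ep by rewrite /e1 mulrC divfK// gt_eqF.
have m1 : Num.min 1 ep <= 1 by rewrite ge_min lexx.
have m2 : Num.min 1 ep <= ep by rewrite ge_min lexx orbT.
have ke : 8 * k * e1 <= 1.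
  apply: le_trans m1; rewrite -e1k ler_wpM2r ?(ltW e10)//.
  by rewrite ler_peMr// mulr_ge0// ltW.
have e1ep : e1 <= ep.
  apply: le_trans m2; rewrite -e1k ler_peMl ?(ltW e10)//.
  by have : 1 <= k * k by [rewrite mulr_ege1]; lra.
have [F [A [L [rho [r [[L0 r0] tF Ae [F0' A0] [Fr Arho]]]]]]] :=
  globalize_map wn e10 hF F00 J0.
have near := global_taylor_near wn L0 tF Ae.
have [|G [FK GK]] := near_saddle_bij p0 q0 pk qk _ near; first by lra.
have ke4 : 4 * k * e1 <= 1 by lra.
have inv z := saddle_perturb_inv p0 q0 pk qk (Ae z) ke4.
pose B w := invmx (A (G w)).
have G0 : G 0 = 0 by rewrite -{1}F0' FK.
have Glip x y : `|G y - G x| <= 2 * k * `|y - x|.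
  have := near (G x) (G y); rewrite !GK => h.
  have MMi := saddleV p0 q0.
  have E : G y - G x = (y - x - (y - x - (G y - G x) *m saddle p q)) *m saddle p^-1 q^-1.
    by rewrite subKr -mulmxA MMi mulmx1.
  have n0 := normr_ge0 (y - x); have n0' := normr_ge0 (G y - G x).
  have : `|G y - G x| <= k * (`|y - x| + 2 * e1 * `|G y - G x|).
    rewrite {1}E (le_trans (mul_saddle_norm _ pk qk))// ler_wpM2l ?(ltW k0)//.
    by rewrite (le_trans (ler_normB _ _))// lerD2l.
  have : 8 * k * e1 * `|G y - G x| <= 1 * `|G y - G x| by rewrite ler_wpM2r.
  lra.
have k21 : 1 <= 2 * k by lra.
have k20 : 0 <= 2 * k by lra.
have nuG x y : nu `|G y - G x| <= 2 * k * nu `|y - x|.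
  by apply: (@le_trans _ _ (nu (2 * k * `|y - x|))); [exact: n2|exact: n3].
pose L' := L + 2 * (L * (2 * k) * (2 * k)) * (2 * k) + 4 * (2 * k) * (L * (2 * k)) * (2 * k).
have nb : forall t, 0 <= t -> 0 <= nu t by [].
have q1 : 0 <= 2 * (L * (2 * k) * (2 * k)) * (2 * k) by rewrite !mulr_ge0// ltW.
have q2 : 0 <= 4 * (2 * k) * (L * (2 * k)) * (2 * k) by rewrite !mulr_ge0// ltW.
have L'0 : 0 <= L' by rewrite /L'; lra.
(* A bound for |F z| / |z|: if |x| >= (1 + s) |rho|, then |G x| >= rho, and the derivative of G at x
   is linear too. *)
pose s := `|p| + `|q| + 2 * e1.
have s0 : 0 < s by rewrite ltr_wpDl ?addr_ge0// mulr_gt0.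
exists F, G, A, B, L', ((1 + s) * `|rho|), r; split=> //.
- by split=> //; rewrite mulr_ge0// addr_ge0// ltW.
- have [tF1 tF2] := tF; split; split=> x y.
  + apply: (le_trans (tF1 _ _)); rewrite ler_wpM2r// ler_wpM2r ?nb// /L'; lra.
  + apply: (le_trans (tF2 _ _)); rewrite ler_wpM2r ?nb// /L'; lra.
  + have [uA iA _] := inv (G x).
    have -> : G y - G x - (y - x) *m B x = - ((F (G y) - F (G x) - (G y - G x) *m A (G x)) *m B x).
      by rewrite !GK [(_ - _ *m A _) *m _]mulmxBl -mulmxA mulmxV// mulmx1 opprB.
    rewrite normrN (le_trans (mx_norm_mul _ _))//.
    apply: (@le_trans _ _ (2 * (L * (2 * k * nu `|y - x|) * (2 * k * `|y - x|)) * (2 * k))).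
      apply: ler_pM; rewrite ?mulr_ge0// ler_pM2l// (le_trans (tF1 _ _))//.
      by apply: ler_pM; rewrite ?mulr_ge0 ?nb// ler_wpM2l.
    have -> : 2 * (L * (2 * k * nu `|y - x|) * (2 * k * `|y - x|)) * (2 * k) =
      2 * (L * (2 * k) * (2 * k)) * (2 * k) * nu `|y - x| * `|y - x| by ring.
    by rewrite ler_wpM2r// ler_wpM2r ?nb// /L'; lra.
  + have [ux ix _] := inv (G x); have [uy iy _] := inv (G y).
    have -> : B x - B y = B x *m (A (G y) - A (G x)) *m B y.
      by rewrite mulmxBr mulmxBl mulVmx// mul1mx -mulmxA mulmxV// mulmx1.
    rewrite (le_trans (mx_norm_mul _ _))//.
    apply: (@le_trans _ _ (2 * (2 * (2 * k) * (L * (2 * k * nu `|x - y|))) * (2 * k))).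
      apply: ler_pM; rewrite ?mulr_ge0// ler_pM2l// (le_trans (mx_norm_mul _ _))//.
      apply: ler_pM; rewrite ?mulr_ge0//; first by rewrite ler_pM2l.
      rewrite (le_trans (tF2 _ _))// ler_wpM2l//.
      by rewrite (distrC x) nuG.
    have -> : 2 * (2 * (2 * k) * (L * (2 * k * nu `|x - y|))) * (2 * k) =
      4 * (2 * k) * (L * (2 * k)) * (2 * k) * nu `|x - y| by ring.
    by rewrite ler_wpM2r ?nb// /L'; lra.
- have Bsad w : A (G w) = saddle p q -> B w = saddle p^-1 q^-1.
    move=> E; rewrite /B E; have MMi := saddleV p0 q0.
    have [uA _ _] := inv (G w); rewrite E in uA.
    by rewrite -[LHS]mulmx1 -MMi mulmxA mulVmx// mul1mx.
  split=> //.
  + by move=> x; apply: (le_trans (Ae x)).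
  + move=> x; have [_ _] := inv (G x) => /le_trans; apply.
    by rewrite e1k.
  + by apply: Bsad; rewrite G0.
  + move=> x; rewrite mulrDl mul1r => xr; have rho0 := normr_ge0 rho; split.
      apply: Arho; apply: le_trans xr; apply: (le_trans (ler_norm rho)).
      by rewrite lerDl mulr_ge0// ltW.
    apply: Bsad; apply: Arho; apply: (le_trans (ler_norm rho)).
    rewrite -(ler_pM2l s0); apply: (@le_trans _ _ `|x|); first by apply: le_trans xr; rewrite lerDr.
    have := near 0 (G x); rewrite F0' !subr0 GK => h.
    have := ler_normD (x - G x *m saddle p q) (G x *m saddle p q); rewrite subrK => h'.
    apply: (le_trans h'); rewrite addrC mulrDl; apply: lerD => //.
    by apply: mul_saddle_norm; rewrite ?lerDl ?lerDr.
Qed.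

Lemma inverse_of_global nu (F0 F G : V -> V) A B L r : wmod nu -> 0 <= L -> 0 < r ->
  cancel F G -> cancel G F -> F 0 = 0 ->
  global_taylor nu L F A -> global_taylor nu L G B ->
  (forall x, `|x| < r -> F x = F0 x) ->
  local_C1_inverse F0 G /\ C1_modulus nu G.
Proof.
move=> wn L0 r0 FK GK F00 [tF mA] [tG mB] Fr.
have tF0 x y : `|x| < r -> `|y| < r -> `|F0 y - F0 x - (y - x) *m A x| <= L * nu `|y - x| * `|y - x|.
  by move=> xr yr; rewrite -!Fr.
have [_ _ C1F] := taylor_C1_modulus wn r0 L0 tF0 (fun x y _ _ => mA x y).
have big s : 0 < s -> [/\ C1_modulus nu G, (forall x : V, `|x| < s -> jacobian G x = B x) &
    C1_on [set z : V | `|z| < s] G].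
  by move=> s0; apply: (taylor_C1_modulus wn s0 L0) => *; [exact: tG|exact: mB].
have [CG _ _] := big 1 ltr01.
have diffG x : differentiable G x /\ {for x, continuous (jacobian G)}.
  by have [_ _] := big (`|x| + 1) (ltr_wpDl (normr_ge0 x) ltr01); apply; rewrite /= ltrDl.
split=> //; split; first by rewrite -Fr ?normr0.
pose U : set V := [set z | `|z| < r].
have oU : open U.
  have -> : U = ball_ (fun x : V => `|x|) 0 r.
    by apply/seteqP; split=> z; rewrite /U /ball_/= sub0r normrN.
  by rewrite ball_normE; exact: ball_open.
pose V' := G @^-1` U.
exists U, V'; split=> //.
- by split=> //; rewrite /U/= normr0.
- split; last by rewrite /V' /U/= -{1}F00 FK normr0.
  by apply: open_comp => // x _; apply: differentiable_continuous; have [] := diffG x.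
- split; apply/seteqP; split=> [_ [z zU <-]|z zU].
  + by rewrite /V' /preimage/= -Fr// FK.
  + by exists (G z) => //; rewrite -Fr ?GK.
  + by [].
  + by exists (F z); rewrite /V' /preimage/= ?FK.
- split=> [x xU|y yV]; first by rewrite -Fr// FK.
  by rewrite -Fr ?GK.
- by split=> // x _; exact: diffG.
Qed.

End Globalization.

(** * Linearization *)

Section Linearization.
Variable R : realType.
Local Notation V := 'rV[R]_2.

Lemma C1_modulus_le (nu nu' : R -> R) (F : V -> V) (C d : R) : 0 < d -> 0 < C ->
  (forall t, 0 <= t -> t <= d -> nu t <= C * nu' t) -> C1_modulus nu F -> C1_modulus nu' F.
Proof.
move=> d0 C0 h [U [L [nU L0 dF mF]]].
exists (U `&` [set z | `|z| < d / 2]), (L * C); split.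
- apply: filterI => //; apply/nbhs_ballP; exists (d / 2); first exact: divr_gt0.
  by move=> z; rewrite -ball_normE/= sub0r normrN.
- exact: mulr_gt0.
- by move=> x [Ux _]; exact: dF.
- move=> x y [Ux xd] [Uy yd]; rewrite (le_trans (mF _ _ Ux Uy))//= -mulrA ler_pM2l// h//.
  by rewrite (le_trans (ler_normB _ _))//; move: xd yd => /=; lra.
Qed.

Definition swap_mx : 'M[R]_2 := \matrix_(i, j) (i != j)%:R.
Local Notation J := swap_mx.

Lemma mul_swap (m : nat) (A : 'M[R]_(m, 2)) i : (A *m J) i 0 = A i 1 /\ (A *m J) i 1 = A i 0.
Proof. by rewrite !mul2E !mxE/= !mulr0 !mulr1 add0r addr0. Qed.

Lemma swap_mul (m : nat) (A : 'M[R]_(2, m)) i : (J *m A) 0 i = A 1 i /\ (J *m A) 1 i = A 0 i.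
Proof. by rewrite !mul2E !mxE/= !mul0r !mul1r add0r addr0. Qed.

Lemma swapK : J *m J = 1%:M.
Proof.
apply/matrixP => i j; have [h0 h1] := mul_swap J i.
by case: (ord2E i) (ord2E j) h0 h1 => -> [->|->] h0 h1; rewrite ?h0 ?h1 !mxE.
Qed.

Lemma mul_swapK (m : nat) (A : 'M[R]_(m, 2)) : A *m J *m J = A.
Proof. by rewrite -mulmxA swapK mulmx1. Qed.

Lemma norm_mul_swap (m : nat) (A : 'M[R]_(m, 2)) : `|A *m J| = `|A|.
Proof.
have le (B : 'M[R]_(m, 2)) : `|B *m J| <= `|B|.
  apply: mx_norm_le => // i j; have [h0 h1] := mul_swap B i.
  by case: (ord2E j) => ->; rewrite ?h0 ?h1 le_mx_norm.
by apply/eqP; rewrite eq_le le/= -{1}(mul_swapK A) le.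
Qed.

Lemma norm_swap_mul (m : nat) (A : 'M[R]_(2, m)) : `|J *m A| = `|A|.
Proof.
have le (B : 'M[R]_(2, m)) : `|J *m B| <= `|B|.
  apply: mx_norm_le => // i j; have [h0 h1] := swap_mul B j.
  by case: (ord2E i) => ->; rewrite ?h0 ?h1 le_mx_norm.
apply/eqP; rewrite eq_le le/=; have := le (J *m A).
by rewrite mulmxA swapK mul1mx.
Qed.

Lemma saddle_swap (p q : R) : J *m saddle p q *m J = saddle q p.
Proof.
apply/matrixP => i j; have [h0 h1] := mul_swap (J *m saddle p q) i.
case: (ord2E j) => ->; rewrite ?h0 ?h1; have [k0 k1] := swap_mul (saddle p q) 0;
  have [k2 k3] := swap_mul (saddle p q) 1; case: (ord2E i) => ->; rewrite ?k0 ?k1 ?k2 ?k3 !mxE//=.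
Qed.

Lemma saddle1 : saddle 1 1 = 1%:M :> 'M[R]_2.
Proof. by apply/matrixP => i j; rewrite !mxE; case: ifP. Qed.

Lemma swap_conj_diff (K : V -> V) (x y : V) (M : 'M[R]_2) :
  K (y *m J) *m J - K (x *m J) *m J - (y - x) *m (J *m M *m J) =
  (K (y *m J) - K (x *m J) - (y *m J - x *m J) *m M) *m J.
Proof. by rewrite !mulmxA !(mulmxBl _ _ J) -(mulmxBl y x J). Qed.

Lemma norm_swap_conj_sub (M N : 'M[R]_2) : `|J *m M *m J - J *m N *m J| = `|M - N|.
Proof. by rewrite -mulmxBl -mulmxBr norm_mul_swap norm_swap_mul. Qed.

Lemma norm_mul_swap_sub (x y : V) : `|y *m J - x *m J| = `|y - x|.
Proof. by rewrite -mulmxBl norm_mul_swap. Qed.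

(** The mirrored system has eigenvalues l2^-1 and l1^-1, so its admissible exponents are bounded by
    the ratio with - ln a in the numerator instead of ln b. Using one exponent for both components
    is the reason for the minimum in [delta]. *)
Theorem linearization (om S : R -> R) (kap l1 l2 : R) (F0 : V -> V) :
  0 < `|l1| -> `|l1| < 1 -> 1 < `|l2| -> wmod om -> wmod S ->
  `|l1| < kap -> `|l2|^-1 < kap -> kap < 1 ->
  (forall t, 0 <= t -> om t + S (kap * t) <= S t) ->
  C1_modulus om F0 -> F0 0 = 0 -> jacobian F0 0 = saddle l1 l2 ->
  exists Phi Psi, [/\ linearizing (saddle l1 l2) F0 Phi, local_C1_inverse Phi Psi,
    C1_modulus (fun t => S (t `^ delta l1 l2)) Phi &
    C1_modulus (fun t => S (t `^ delta l1 l2)) Psi].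
Proof.
move=> a0 a1 b1 wom wS ak bk k1 Sstep CF F00 J0.
have b0 : 0 < `|l2| by exact: lt_trans b1.
have bi0 : 0 < `|l2|^-1 by rewrite invr_gt0.
have k0 : 0 < kap by exact: lt_trans ak.
have l1N : l1 != 0 by rewrite -normr_gt0.
have l2N : l2 != 0 by rewrite -normr_gt0.
(* Both gaps are needed, since the conditions of [core_eigenfunction] must hold for the system and
   for its mirror image, where a and b^-1 are exchanged. *)
pose ep := Num.min (kap - `|l1|) (kap - `|l2|^-1) / 8.
have ep0 : 0 < ep by rewrite divr_gt0// lt_min !subr_gt0 ak bk.
have e1 : 8 * ep <= kap - `|l1| by rewrite /ep mulrC divfK// ge_min lexx.
have e2 : 8 * ep <= kap - `|l2|^-1 by rewrite /ep mulrC divfK// ge_min lexx orbT.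
have inv x : 0 < x -> x < kap -> 8 * ep <= kap - x -> 1 <= (x^-1 - 8 * ep) * kap.
  move=> x0 xk h; rewrite -(ler_pM2l x0) mulrA mulrBr mulfV ?gt_eqF//.
  have xk1 : x * kap <= 1 by rewrite mulr_ile1// ltW// (lt_trans xk).
  have : x * kap * (8 * ep) <= 1 * (8 * ep) by rewrite ler_wpM2r// mulr_ge0// ltW.
  lra.
have [F [G [A [B [L [rho [r]]]]]]] := globalize wom ep0 l1N l2N CF F00 J0.
move=> [[L0 r0 rho0] [FK GK F0'] [tF tG] [Aep Bep A0 B0 AB] Fr].
have Flip := global_taylor_near wom L0 tF Aep.
have Glip := global_taylor_near wom L0 tG Bep.
have la : ln `|l1| < 0 by rewrite ln_lt0// a0 a1.
have lb : 0 < ln `|l2| by rewrite ln_gt0.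
have ba0 : 0 < ln `|l2| - ln `|l1| by rewrite subr_gt0 (lt_trans la).
have dl0 : 0 < delta l1 l2.
  by rewrite /delta divr_gt0// lt_min lb andbT; move: la; lra.
have dlb : delta l1 l2 <= ln `|l2| / (ln `|l2| - ln `|l1|).
  by rewrite /delta ler_pM2r ?invr_gt0// ge_min lexx orbT.
have dla : delta l1 l2 <= - ln `|l1| / (ln `|l2| - ln `|l1|).
  by rewrite /delta ler_pM2r ?invr_gt0// ge_min lexx.
have dl1 : delta l1 l2 <= 1.
  by apply: (le_trans dlb); rewrite ler_pdivrMr// mul1r lerBrDl; move: la; lra.
have [|||ph1 [q1 [C1 [C10 t1 m1 [ph10 q10] ph1F]]]] :=
  @core_eigenfunction R om S kap l1 l2 L ep rho F G B wom wS k0 k1 Sstep a0 a1 b1 FK GK F0'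
   L0 tG.1 tG.2 B0 Bep (fun z h => (AB z h).2) rho0 (ltW ep0) Flip Glip _ _ _ (delta l1 l2) dl0 dlb.
- exact: inv.
- have := inv _ bi0 bk e2; rewrite invrK; exact.
- lra.
pose F' z := G (z *m J) *m J.
pose G' z := F (z *m J) *m J.
pose B' z := J *m A (z *m J) *m J.
have Jl : J *m saddle l1 l2 *m J = saddle l2 l1 by exact: saddle_swap.
have Ji : J *m saddle l1^-1 l2^-1 *m J = saddle l2^-1 l1^-1 by exact: saddle_swap.
have F'K : cancel F' G' by move=> z; rewrite /F' /G' mul_swapK GK mul_swapK.
have G'K : cancel G' F' by move=> z; rewrite /F' /G' mul_swapK FK mul_swapK.
have F'0 : F' 0 = 0 by rewrite /F' mul0mx -{1}F0' FK mul0mx.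
have tG' x y : `|G' y - G' x - (y - x) *m B' x| <= L * om `|y - x| * `|y - x|.
  by rewrite /G' /B' swap_conj_diff norm_mul_swap -(norm_mul_swap_sub x y); exact: tF.1.
have mB' x y : `|B' x - B' y| <= L * om `|x - y|.
  by rewrite /B' norm_swap_conj_sub -(norm_mul_swap_sub y x); exact: tF.2.
have B'0 : B' 0 = saddle (l2^-1)^-1 (l1^-1)^-1 by rewrite /B' mul0mx A0 Jl !invrK.
have B'ep z : `|B' z - saddle (l2^-1)^-1 (l1^-1)^-1| <= ep.
  by rewrite !invrK -Jl /B' norm_swap_conj_sub.
have B's z : rho <= `|z| -> B' z = saddle (l2^-1)^-1 (l1^-1)^-1.
  by move=> h; rewrite /B' (AB _ _).1 ?norm_mul_swap// Jl !invrK.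
have F'lip x y : `|F' y - F' x - (y - x) *m saddle l2^-1 l1^-1| <= 2 * ep * `|y - x|.
  by rewrite -Ji /F' swap_conj_diff norm_mul_swap -(norm_mul_swap_sub x y).
have G'lip x y : `|G' y - G' x - (y - x) *m saddle (l2^-1)^-1 (l1^-1)^-1| <= 2 * ep * `|y - x|.
  by rewrite !invrK -Jl /G' swap_conj_diff norm_mul_swap -(norm_mul_swap_sub x y).
have a0' : 0 < `|l2^-1| by rewrite normfV.
have a1' : `|l2^-1| < 1 by rewrite normfV invf_lt1.
have b1' : 1 < `|l1^-1| by rewrite normfV invf_gt1.
have dla' : delta l1 l2 <= ln `|l1^-1| / (ln `|l1^-1| - ln `|l2^-1|).
  by rewrite !normfV !lnV// opprK (addrC (- _)).
have [|||ph2 [q2 [C2 [C20 t2 m2 [ph20 q20] ph2F]]]] :=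
  @core_eigenfunction R om S kap l2^-1 l1^-1 L ep rho F' G' B' wom wS k0 k1 Sstep a0' a1' b1' F'K G'K F'0
   L0 tG' mB' B'0 B'ep B's rho0 (ltW ep0) F'lip G'lip _ _ _ (delta l1 l2) dl0 dla'.
- by rewrite normfV; exact: inv.
- by rewrite normfV; exact: inv.
- by rewrite normfV invrK; lra.
pose Phi z : V := \row_j (if j == 0 then ph1 z else ph2 (z *m J)).
pose D z : 'M[R]_2 := \matrix_(i, j) (if j == 0 then q1 z i 0 else (J *m q2 (z *m J)) i 0).
pose nu t := S (t `^ delta l1 l2).
have wn : wmod nu by exact: wmod_powR.
have [n1 n2 n3 n4] := wn.
have h2 : (0 : R) < 2^-1 by rewrite invr_gt0.
have tP x y : `|x| < 2^-1 -> `|y| < 2^-1 -> `|Phi y - Phi x - (y - x) *m D x| <= (C1 + C2) * nu `|y - x| * `|y - x|.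
  move=> xr yr; apply: mx_norm_le => [|i j]; first by rewrite !mulr_ge0 ?addr_ge0 ?n1.
  rewrite [i]ord1; case: (ord2E j) => ->.
    have := t1 x y xr yr; rewrite (subMxE (_ - _)) !mul2E !mxE/= => /le_trans; apply.
    by rewrite -!mulrA ler_wpM2r ?mulr_ge0 ?n1// lerDl.
  have := t2 (x *m J) (y *m J); rewrite !norm_mul_swap norm_mul_swap_sub => /(_ xr yr).
  have [w [Ew DE]] : exists w, J *m q2 (x *m J) = w /\ forall k, D x k 1 = w k 0.
    by exists (J *m q2 (x *m J)); split=> // k; rewrite mxE.
  rewrite -(mulmxBl y x J) -mulmxA Ew.
  have PE z : Phi z 0 1 = ph2 (z *m J) by rewrite mxE.
  rewrite !subMxE !mul2E !DE !PE !subMxE => /le_trans; apply.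
  by rewrite -!mulrA ler_wpM2r ?mulr_ge0 ?n1// lerDr.
have mD x y : `|x| < 2^-1 -> `|y| < 2^-1 -> `|D x - D y| <= (C1 + C2) * nu `|x - y|.
  move=> xr yr; apply: mx_norm_le => [|i j]; first by rewrite !mulr_ge0 ?addr_ge0 ?n1.
  have en : 0 <= nu `|x - y| by exact: n1.
  have DE z : D z i 1 = (J *m q2 (z *m J)) i 0 by rewrite mxE.
  rewrite subMxE; case: (ord2E j) => ->; rewrite ?DE; first rewrite !mxE/=.
    have := le_trans (le_mx_norm (q1 x - q1 y) i 0) (m1 x y xr yr).
    by rewrite subMxE => /le_trans; apply; rewrite ler_wpM2r// lerDl.
  have := m2 (x *m J) (y *m J); rewrite !norm_mul_swap norm_mul_swap_sub => /(_ xr yr) h.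
  have := le_mx_norm (J *m (q2 (x *m J) - q2 (y *m J))) i 0.
  rewrite norm_swap_mul mulmxBr subMxE => /le_trans; apply; apply: (le_trans h).
  by rewrite ler_wpM2r// lerDr.
have D0 : D 0 = 1%:M.
  have D0E i j : D 0 i j = if j == 0 then (delta_mx 0 0 : 'cV[R]_2) i 0
    else (J *m (delta_mx 0 0 : 'cV[R]_2)) i 0.
    by rewrite mxE mul0mx q10 q20.
  have [k3 k4] := swap_mul (delta_mx 0 0 : 'cV[R]_2) 0.
  apply/matrixP => i j; rewrite D0E.
  by case: (ord2E i) (ord2E j) => -> [->|->] /=; rewrite ?k3 ?k4 !mxE.
have C120 : 0 <= C1 + C2 by exact: addr_ge0.
have [CPhi jPhi _] := taylor_C1_modulus wn h2 C120 tP mD.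
have Phi0 : Phi 0 = 0 by apply: rv2P; rewrite !mxE/= ?mul0mx.
have JPhi : jacobian Phi 0 = 1%:M by rewrite jPhi ?normr0.
(* The linearization is itself globalized, around the identity viewed as [saddle 1 1], which gives
   an inverse with the same modulus. *)
have [Phi' [Psi [A1 [B1 [L1 [rho1 [s]]]]]]] :=
  globalize wn ltr01 (oner_neq0 R) (oner_neq0 R) CPhi Phi0 (etrans JPhi (esym saddle1)).
move=> [[L10 s0 _] [PK KP P0] [tPhi tPsi] _ Ps].
have [inv1 CPsi] := inverse_of_global wn L10 s0 PK KP P0 tPhi tPsi Ps.
exists Phi, Psi; split; [|exact: inv1|exact: CPhi|exact: CPsi].
split; [by exists Psi|exact: JPhi|].
apply/nbhs_ballP; exists r => // z; rewrite -ball_normE/= sub0r normrN => zr.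
rewrite -Fr//; apply: rv2P; rewrite ?mul_saddle0 ?mul_saddle1 !mxE/=; first by rewrite ph1F mulrC.
have := ph2F (F z *m J); rewrite /F' mul_swapK FK => ->.
by rewrite mulrAC mulVf ?mul1r.
Qed.

End Linearization.

(** * Consequences of concavity, and integrals over intervals *)

Section ModulusOfContinuity.
Variable R : realType.
Variable om : R -> R.
Hypothesis hom : modulus_of_continuity om.

Lemma modulus_ge0 t : 0 <= t -> 0 <= om t. Proof. by case: hom => _ h *; exact: h. Qed.

Lemma modulus0 : om 0 = 0. Proof. by case: hom. Qed.

Lemma modulus_gt0 t : 0 < t -> 0 < om t.
Proof. by case: hom => h0 _ _ h _ t0; rewrite -h0 h. Qed.

Lemma modulus_le s t : 0 <= s -> s <= t -> om s <= om t.
Proof.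
case: hom => _ _ _ h _ s0; rewrite le_eqVlt => /orP[/eqP->//|st].
by rewrite ltW// h.
Qed.

Lemma modulus_contract k t : 0 <= k -> k <= 1 -> 0 <= t -> k * om t <= om (k * t).
Proof.
case: hom => h0 _ _ _ h k0 k1 t0.
by have := h t 0 k t0 (lexx 0) k0 k1; rewrite h0 !mulr0 !addr0.
Qed.

Lemma modulus_expand C t : 1 <= C -> 0 <= t -> om (C * t) <= C * om t.
Proof.
move=> C1 t0; have C0 : 0 < C by exact: lt_le_trans C1.
rewrite -ler_pdivrMl//; apply: le_trans (modulus_contract _ _ _) _.
- by rewrite invr_ge0 ltW.
- by rewrite invf_le1.
- by rewrite mulr_ge0// ltW.
by rewrite mulKf ?gt_eqF.
Qed.

Lemma modulus_continuous : {in `]0, +oo[, continuous om} /\ om x @[x --> 0^'+] --> (0 : R).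
Proof. by case: hom => h0 _ /continuous_within_itvcyP; rewrite h0. Qed.

Lemma modulus_wmod : wmod om.
Proof.
split; [exact: modulus_ge0|exact: modulus_le|exact: modulus_expand|].
move=> e e0; have [_ /cvgrPdist_le/(_ e e0)] := modulus_continuous.
case=> d /= d0 hd; exists (d / 2); first exact: divr_gt0.
have d2 : 0 < d / 2 by exact: divr_gt0.
have := hd (d / 2); rewrite /= !sub0r !normrN !ger0_norm ?(ltW d2) ?modulus_ge0 ?(ltW d2)//.
by apply=> //; lra.
Qed.

(** Subadditivity: by concavity and om 0 = 0, the points s and t - s receive at least the shares s /
    t and (t - s) / t of om t. *)
Lemma modulusB_le s t : 0 <= s -> s <= t -> om t - om s <= om (t - s).
Proof.
move=> s0; rewrite le_eqVlt => /orP[/eqP->|st]; first by rewrite !subrr modulus0.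
have t0 : 0 < t by exact: le_lt_trans st.
have ts : 0 < t - s by rewrite subr_gt0.
have h1 := modulus_contract (divr_ge0 s0 (ltW t0)) _ (ltW t0).
have h2 := modulus_contract (divr_ge0 (ltW ts) (ltW t0)) _ (ltW t0).
move: h1 h2; rewrite !divfK ?gt_eqF// !ler_pdivrMr// !mul1r => /(_ (ltW st)) h1 h2.
have {}h2 := h2 (ltac:(lra)).
have : s / t * om t + (t - s) / t * om t = om t by field; rewrite gt_eqF.
lra.
Qed.

Lemma modulus_dist s t : 0 <= s -> 0 <= t -> `|om s - om t| <= om `|s - t|.
Proof.
wlog st : s t / s <= t => [H s0 t0|s0 t0].
  by have [/H->//|/ltW/H] := leP s t; rewrite distrC (distrC t) => ->.
have h := modulus_le s0 st.
by rewrite distrC (distrC s) !ger0_norm ?subr_ge0// modulusB_le.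
Qed.

Lemma modulus_linear t : 0 <= t -> t <= 1 -> om 1 * t <= om t.
Proof. by move=> t0 t1; have := modulus_contract t0 t1 ler01; rewrite mulr1 mulrC. Qed.

End ModulusOfContinuity.

Section IntervalIntegral.
Variable R : realType.
Local Notation mu := (@lebesgue_measure R).
Variable f : R -> R.
Hypothesis mf : measurable_fun (`]0%R, +oo[%classic : set R) f.
Hypothesis f0 : forall t, 0 < t -> 0 <= f t.

Definition itv_int (u v : R) : \bar R := (\int[mu]_(t in `]u, v]) (f t)%:E)%E.

Let sub0y u v : 0 <= u -> (`]u, v]%classic : set R) `<=` `]0%R, +oo[%classic.
Proof. by move=> u0 t /=; rewrite !in_itv/= andbT => /andP[ut _]; exact: le_lt_trans ut. Qed.

Let mfuv u v : 0 <= u -> measurable_fun (`]u, v]%classic : set R) (fun t : R => (f t)%:E).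
Proof.
move=> u0; apply/measurable_EFinP; apply: measurable_funS mf => //; exact: sub0y.
Qed.

Let f0uv u v t : 0 <= u -> t \in `]u, v] -> (0 <= (f t)%:E)%E.
Proof. by move=> u0; rewrite in_itv/= lee_fin => /andP[ut _]; apply: f0; exact: le_lt_trans ut. Qed.

Lemma itv_int_ge0 u v : 0 <= u -> (0 <= itv_int u v)%E.
Proof. by move=> u0; apply: integral_ge0 => t; exact: f0uv. Qed.

Lemma itv_int_split u v x : 0 <= u -> u <= v -> v <= x ->
  (itv_int u x = itv_int u v + itv_int v x)%E.
Proof.
move=> u0 uv vx; have v0 := le_trans u0 uv.
have E : `]u, x]%classic = `]u, v]%classic `|` `]v, x]%classic :> set R by apply: itv_bndbnd_setU; rewrite bnd_simp.
rewrite /itv_int E ge0_integral_setU//.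
- by rewrite -E; exact: mfuv.
- by rewrite -E => t; exact: f0uv.
- apply/disj_setPS => t [] /=; rewrite !in_itv/= => /andP[_ tv] /andP[vt _].
  by move: (lt_le_trans vt tv); rewrite ltxx.
Qed.

Let itv_cst u v m : u <= v -> (\int[mu]_(t in `]u, v]) (cst m%:E t) = (m * (v - u))%:E)%E.
Proof.
move=> uv; rewrite integral_cst//= lebesgue_measure_itv/= lte_fin EFinM.
by move: uv; rewrite le_eqVlt => /orP[/eqP->|->//]; rewrite ltxx subrr.
Qed.

Lemma itv_int_ge u v m : 0 <= u -> u <= v -> 0 <= m -> (forall t, u < t -> t <= v -> m <= f t) ->
  ((m * (v - u))%:E <= itv_int u v)%E.
Proof.
move=> u0 uv m0 h; rewrite -itv_cst//; apply: ge0_le_integral => //.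
- exact: mfuv.
- by move=> t /=; rewrite in_itv/= lee_fin => /andP[? ?]; exact: h.
Qed.

Lemma itv_int_le u v m : 0 <= u -> u <= v -> (forall t, u < t -> t <= v -> f t <= m) ->
  (itv_int u v <= (m * (v - u))%:E)%E.
Proof.
move=> u0 uv h; rewrite -itv_cst//; apply: ge0_le_integral => //.
- by move=> t; exact: f0uv.
- exact: mfuv.
- by move=> t /=; rewrite in_itv/= lee_fin => /andP[? ?]; exact: h.
Qed.

(** Monotone convergence along the intervals ]k^n a, a], which exhaust ]0, a]. *)
Lemma itv_int_lim a k (M : \bar R) : 0 < a -> 0 < k -> k < 1 ->
  (forall n, itv_int (k ^+ n * a) a <= M)%E -> (itv_int 0 a <= M)%E.
Proof.
move=> a0 k0 k1 h.
have E : `]0%R, a]%classic = \bigcup_n `]k ^+ n * a, a]%classic :> set R.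
  apply/seteqP; split=> t /=; last first.
    by move=> [n _] /=; rewrite !in_itv/= => /andP[nt ->]; rewrite andbT (lt_trans _ nt)// mulr_gt0// exprn_gt0.
  rewrite in_itv/= => /andP[t0 ta].
  have : (fun n => k ^+ n : R^o) @ \oo --> (0 : R^o) by apply: cvg_expr; rewrite ger0_norm// ltW.
  move=> /cvgrPdist_lt/(_ (t / a) (divr_gt0 t0 a0))[n _ /(_ n (leqnn n))] /=.
  rewrite sub0r normrN ger0_norm ?exprn_ge0 ?(ltW k0)// ltr_pdivlMr// => nt.
  by exists n => //=; rewrite in_itv/= nt.
rewrite /itv_int E.
have kn n : 0 <= k ^+ n * a by rewrite mulr_ge0 ?exprn_ge0// ltW.
apply: (@cvge_le _ _ _ _ (fun n => itv_int (k ^+ n * a) a)); last first.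
  apply: ge0_nondecreasing_set_cvg_integral => //.
  - move=> n m nm; rewrite subsetEset => t /=; rewrite !in_itv/= => /andP[nt ->].
    rewrite andbT (le_lt_trans _ nt)// ler_wpM2r// ?(ltW a0)//.
    by rewrite ler_wiXn2l// ltW.
  - by move=> n; exact: mfuv.
  - by move=> n t; exact: f0uv.
- exact: nearW.
- exact: eventually_filter.
Qed.

End IntervalIntegral.

(** * Dini sums *)

Section DiniSums.
Variable R : realType.
Variables (om : R -> R) (kap : R).
Hypothesis hom : modulus_of_continuity om.
Hypotheses (kap0 : 0 < kap) (kap1 : kap < 1).

Let f t := om t / t.
Let J a := itv_int f 0 a.

Let mf : measurable_fun (`]0%R, +oo[%classic : set R) f.
Proof.
apply: open_continuous_measurable_fun; first exact: interval_open.
move=> t; rewrite inE/= in_itv/= andbT => t0; apply: cvgM.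
  by have [h _] := modulus_continuous hom; apply: h; rewrite in_itv/= t0.
by apply: cvgV => //; rewrite gt_eqF.
Qed.

Let f0 t : 0 < t -> 0 <= f t.
Proof. by move=> t0; rewrite divr_ge0 ?(modulus_ge0 hom)// ltW. Qed.

Definition dini_psum n t := \sum_(k < n) om (kap ^+ k * t).
Local Notation P := dini_psum.

Lemma dini_psumS n t : P n.+1 t = om t + P n (kap * t).
Proof.
rewrite /P big_ord_recl expr0 mul1r; congr (_ + _); apply: eq_bigr => i _.
by rewrite /bump/= exprSr -mulrA.
Qed.

Let kt k t : 0 <= t -> 0 <= kap ^+ k * t.
Proof. by move=> t0; rewrite mulr_ge0// exprn_ge0// ltW. Qed.

Lemma dini_psum_ge0 n t : 0 <= t -> 0 <= P n t.
Proof. by move=> t0; apply: sumr_ge0 => k _; rewrite (modulus_ge0 hom)// kt. Qed.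

Lemma dini_psum_le n s t : 0 <= s -> s <= t -> P n s <= P n t.
Proof.
move=> s0 st; apply: ler_sum => k _; apply: (modulus_le hom); first exact: kt.
by rewrite ler_wpM2l// exprn_ge0 ?ltW.
Qed.

Lemma dini_psum_expand n C t : 1 <= C -> 0 <= t -> P n (C * t) <= C * P n t.
Proof.
move=> C1 t0; rewrite /P mulr_sumr; apply: ler_sum => k _.
by rewrite mulrCA; apply: (modulus_expand hom) => //; exact: kt.
Qed.

Lemma dini_psumD m n t : P (m + n) t = P m t + P n (kap ^+ m * t).
Proof.
elim: m t => [|m IH] t; first by rewrite /P big_ord0 add0r expr0 mul1r.
by rewrite addSn !dini_psumS IH addrA exprSr mulrA.
Qed.

Let ka a : 0 < a -> 0 < kap * a /\ kap * a <= a.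
Proof. by move=> a0; rewrite mulr_gt0// ger_pMl// ltW. Qed.

Let dini_split a : 0 < a -> (J a = J (kap * a) + itv_int f (kap * a) a)%E.
Proof. by move=> /ka[h1 h2]; rewrite /J (itv_int_split mf f0 _ (ltW h1) h2). Qed.

(** On ]kap a, a] one has om t >= om (kap a) >= kap om a by concavity, and 1 / t >= 1 / a; the
    interval has length (1 - kap) a. [dini_upper] bounds om t / t on the same intervals by om a /
    (kap a). *)
Lemma dini_lower n a : 0 < a -> (((1 - kap) * kap * P n a)%:E <= dini_integral om a)%E.
Proof.
elim: n a => [|n IH] a a0; first by rewrite /P big_ord0 mulr0; exact: itv_int_ge0.
have [k0 k1] := ka a0.
rewrite dini_psumS mulrDr EFinD addeC -[dini_integral om a]/(J a) dini_split//.
apply: leeD; first exact: IH.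
have := @itv_int_ge R f mf (kap * a) a (kap * om a / a) (ltW k0) k1.
have -> : kap * om a / a * (a - kap * a) = (1 - kap) * kap * om a by field; rewrite gt_eqF.
apply; first by rewrite divr_ge0 ?mulr_ge0 ?(modulus_ge0 hom) ?ltW.
move=> t kt1 ta; have t0 := lt_trans k0 kt1.
apply: ler_pM; rewrite ?invr_ge0 ?mulr_ge0 ?(modulus_ge0 hom) ?(ltW a0) ?(ltW kap0)//.
  apply: le_trans (modulus_contract hom (ltW kap0) (ltW kap1) (ltW a0)) _.
  by apply: (modulus_le hom); exact: ltW.
by rewrite lef_pV2.
Qed.

Lemma dini_upper n a : 0 < a ->
  (itv_int f (kap ^+ n * a) a <= ((1 - kap) / kap * P n a)%:E)%E.
Proof.
elim: n a => [|n IH] a a0.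
  rewrite expr0 mul1r; have := @itv_int_le R f mf f0 a a (f a) (ltW a0) (lexx a).
  rewrite subrr mulr0 /P big_ord0 mulr0; apply=> t t1 t2.
  by have := lt_le_trans t1 t2; rewrite ltxx.
have [k0 k1] := ka a0.
rewrite dini_psumS mulrDr EFinD addeC exprSr -mulrA.
rewrite (itv_int_split mf f0 _ _ k1); last 2 first.
- by rewrite kt// ltW.
- by rewrite ger_pMl// exprn_ile1 ?ltW.
apply: leeD; first exact: IH.
have := @itv_int_le R f mf f0 (kap * a) a (om a / (kap * a)) (ltW k0) k1.
have -> : om a / (kap * a) * (a - kap * a) = (1 - kap) / kap * om a.
  by field; rewrite !gt_eqF.
apply=> t kt1 ta; have t0 := lt_trans k0 kt1.
apply: ler_pM; rewrite ?invr_ge0 ?(modulus_ge0 hom) ?(ltW t0)//.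
  by apply: (modulus_le hom) => //; exact: ltW.
by rewrite lef_pV2// ltW.
Qed.

Lemma dini_le a M : 0 < a -> (forall n, P n a <= M) ->
  (dini_integral om a <= ((1 - kap) / kap * M)%:E)%E.
Proof.
move=> a0 hM; apply: (itv_int_lim mf f0 a0 kap0 kap1) => n.
apply: (le_trans (dini_upper n a0)); rewrite lee_fin ler_wpM2l// divr_ge0 ?ltW//.
by rewrite subr_gt0.
Qed.

Lemma dini_unbounded M : dini_integral om 1 = +oo%E -> exists n, M < P n 1.
Proof.
move=> doo; apply: contrapT => H.
have : (dini_integral om 1 <= ((1 - kap) / kap * M)%:E)%E.
  by apply: dini_le => // n; rewrite leNgt; apply/negP => h; apply: H; exists n.
by rewrite doo leye_eq.
Qed.

(** A supremum of partial sums, so that upper bounds are checked on partial sums; the set is bounded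
    once [Dini] is assumed. *)
Definition dini_sum t := sup (range (P^~ t)).
Local Notation S := dini_sum.

Hypothesis dini : Dini om.

Lemma dini_fin t : 0 <= t -> t <= 1 -> dini_integral om t \is a fin_num.
Proof.
move=> t0 t1; rewrite ge0_fin_numE; last exact: itv_int_ge0.
apply: le_lt_trans dini; rewrite /dini_integral -[leLHS]/(J t) -[leRHS]/(J 1).
rewrite /J (itv_int_split mf f0 _ t0 t1)// leeDl//.
by apply: itv_int_ge0.
Qed.

Let bnd t : 0 <= t -> has_ubound (range (P^~ t)).
Proof.
move=> t0; pose T := Num.max 1 t; have T1 : 1 <= T by rewrite /T le_max lexx.
have tT : t <= T by rewrite /T le_max lexx orbT.
have k10 : 0 < (1 - kap) * kap by rewrite mulr_gt0// subr_gt0.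
exists (T * (fine (dini_integral om 1) / ((1 - kap) * kap))) => _ [n _ <-].
apply: (@le_trans _ _ (T * P n 1)).
  have := @dini_psum_expand n T 1 T1 ler01; rewrite mulr1; apply: le_trans.
  exact: dini_psum_le.
rewrite ler_wpM2l ?(le_trans _ T1)// ler_pdivlMr// mulrC.
by rewrite -lee_fin fineK ?dini_fin// dini_lower.
Qed.

Lemma dini_psum_le_sum n t : 0 <= t -> P n t <= S t.
Proof. by move=> t0; apply: ub_le_sup; [exact: bnd|exists n]. Qed.

Lemma dini_sum_le t M : (forall n, P n t <= M) -> S t <= M.
Proof. by move=> h; apply: ge_sup; [exists (P 0 t); exists 0%N|move=> _ [n _ <-]]. Qed.

Lemma dini_sum_step t : 0 <= t -> om t + S (kap * t) <= S t.
Proof.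
move=> t0; rewrite -lerBrDl; apply: dini_sum_le => n.
by rewrite lerBrDl -dini_psumS dini_psum_le_sum.
Qed.

Lemma dini_sum_wmod : wmod S.
Proof.
split=> [t t0|s t s0 st|C t C1 t0|e e0].
- by apply: le_trans (dini_psum_le_sum 0 t0); rewrite /P big_ord0.
- apply: dini_sum_le => n; apply: (le_trans (dini_psum_le n s0 st)).
  by apply: dini_psum_le_sum; exact: le_trans st.
- apply: dini_sum_le => n; apply: (le_trans (dini_psum_expand n C1 t0)).
  by rewrite ler_wpM2l ?dini_psum_le_sum// (le_trans _ C1).
(* With the m-th partial sum at 1 within e of the supremum, every partial sum at kap^m is a tail and
   is at most e. *)
- have [_ [m _ <-] hm] := sup_adherent e0 (conj (ex_intro _ _ (ex_intro2 _ _ 0%N I erefl)) (bnd ler01)).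
  exists (kap ^+ m); first exact: exprn_gt0.
  apply: dini_sum_le => n; have := dini_psum_le_sum (m + n) ler01.
  by move: hm; rewrite dini_psumD mulr1 /dini_sum; lra.
Qed.

Lemma dini_sum_le_integral t : 0 <= t -> t <= 1 ->
  S t <= ((1 - kap) * kap)^-1 * fine (dini_integral om t).
Proof.
move=> t0 t1; have k10 : 0 < (1 - kap) * kap by rewrite mulr_gt0// subr_gt0.
apply: dini_sum_le => n; move: t0; rewrite le_eqVlt => /orP[/eqP <-|t0].
  rewrite /P big1 => [|k _]; last by rewrite mulr0 (modulus0 hom).
  by rewrite mulr_ge0 ?invr_ge0 ?(ltW k10)// fine_ge0//; exact: itv_int_ge0.
by rewrite ler_pdivlMl// -lee_fin fineK ?dini_fin ?dini_lower// ltW.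
Qed.

Lemma dini_integral_le_sum t : 0 < t -> t <= 1 ->
  fine (dini_integral om t) <= (1 - kap) / kap * S t.
Proof.
move=> t0 t1; rewrite -lee_fin fineK ?dini_fin ?(ltW t0)//.
by apply: dini_le => // n; exact: dini_psum_le_sum (ltW t0).
Qed.

End DiniSums.

(** * The extremal map *)

Section Primitive.
Variable R : realType.
Variable om : R -> R.
Hypothesis hom : modulus_of_continuity om.

Let mom : measurable_fun (`]0%R, +oo[%classic : set R) om.
Proof.
apply: open_continuous_measurable_fun; first exact: interval_open.
by move=> t; rewrite inE/= => t0; have [h _] := modulus_continuous hom; exact: h.
Qed.

Let om0 t : 0 < t -> 0 <= om t. Proof. by move=> t0; rewrite (modulus_ge0 hom)// ltW. Qed.

(** The interval is empty for x <= 0, so W vanishes there and is a primitive of om (pos x) on the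
    whole line. *)
Let W x := fine (itv_int om 0 x).

Let W_fin x : 0 <= x -> itv_int om 0 x \is a fin_num.
Proof.
move=> x0; rewrite ge0_fin_numE; last exact: itv_int_ge0.
apply: (@le_lt_trans _ _ (om x * (x - 0))%:E); last exact: ltry.
by apply: itv_int_le => // t t0 tx; apply: (modulus_le hom) => //; exact: ltW.
Qed.

Let W_pos u v : 0 <= u -> u <= v -> om u * (v - u) <= W v - W u /\ W v - W u <= om v * (v - u).
Proof.
move=> u0 uv; have v0 := le_trans u0 uv.
have E := itv_int_split mom om0 (lexx 0) u0 uv.
have fuv : itv_int om u v \is a fin_num.
  by have := W_fin v0; rewrite E fin_numD => /andP[].
have -> : W v - W u = fine (itv_int om u v).
  by rewrite /W E fineD// ?W_fin// addrAC subrr add0r.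
split; rewrite -lee_fin fineK//.
  apply: itv_int_ge => // [|t ut _]; first exact: modulus_ge0.
  by apply: (modulus_le hom) => //; exact: ltW.
apply: itv_int_le => // t ut tv; apply: (modulus_le hom) => //.
by rewrite (le_trans u0)// ltW.
Qed.

Let W0 x : x <= 0 -> W x = 0.
Proof.
move=> x0; rewrite /W /itv_int set_itv_ge ?integral_set0//.
by rewrite bnd_simp -leNgt.
Qed.

Let W_bounds u v : u <= v ->
  om (pos u) * (v - u) <= W v - W u /\ W v - W u <= om (pos v) * (v - u).
Proof.
move=> uv; have [u0|u0] := leP 0 u.
  by rewrite !pos_ge ?(le_trans u0)//; exact: W_pos.
rewrite (pos_le (ltW u0)) (modulus0 hom) mul0r (W0 (ltW u0)) subr0.
have [v0|v0] := leP 0 v; last by rewrite (pos_le (ltW v0)) (modulus0 hom) mul0r (W0 (ltW v0)).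
rewrite pos_ge//; have [] := W_pos (lexx 0) v0; rewrite (modulus0 hom) mul0r (W0 (lexx 0)) !subr0 => -> /le_trans h.
by split=> //; apply: h; rewrite ler_wpM2l ?(modulus_ge0 hom)// lerDl oppr_ge0 ltW.
Qed.

Let W_taylor u v : `|W v - W u - om (pos u) * (v - u)| <= om `|v - u| * `|v - u|.
Proof.
have D : `|om (pos v) - om (pos u)| <= om `|v - u|.
  apply: (le_trans (modulus_dist hom _ _)); rewrite /pos ?le_max ?lexx//.
  by apply: (modulus_le hom) => //; exact: pos_lip.
have [uv|/ltW vu] := leP u v.
  have [h1 h2] := W_bounds uv; have d0 : 0 <= v - u by rewrite subr_ge0.
  rewrite ger0_norm ?subr_ge0// (ger0_norm d0); apply: (@le_trans _ _ ((om (pos v) - om (pos u)) * (v - u))).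
    by rewrite mulrBl lerB.
  rewrite ler_wpM2r//; move: D; rewrite (ger0_norm d0); apply: le_trans; exact: ler_norm.
have [h1 h2] := W_bounds vu; have d0 : 0 <= u - v by rewrite subr_ge0.
have dn : `|v - u| = u - v by rewrite distrC ger0_norm.
rewrite dn -(opprB u v) mulrN opprK.
rewrite ger0_norm; last by move: h2; lra.
apply: (@le_trans _ _ ((om (pos u) - om (pos v)) * (u - v))); first by move: h1; lra.
rewrite ler_wpM2r//; move: D; rewrite dn distrC; apply: le_trans; exact: ler_norm.
Qed.

(** The odd primitive of om |x|; each summand sees one half-line. *)
Definition odd_primitive x := W x - W (- x).
Local Notation V := odd_primitive.

Lemma odd_primitiveN x : V (- x) = - V x.
Proof. by rewrite /V opprK opprB. Qed.

Lemma odd_primitive_bounds u v : 0 <= u -> u <= v ->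
  om u * (v - u) <= V v - V u /\ V v - V u <= om v * (v - u).
Proof.
move=> u0 uv; have v0 := le_trans u0 uv.
have [h1 h2] := W_pos u0 uv.
by rewrite /V (W0 (_ : - v <= 0)) ?oppr_le0// (W0 (_ : - u <= 0)) ?oppr_le0// !subr0.
Qed.

Lemma odd_primitive_taylor u v :
  `|V v - V u - om `|u| * (v - u)| <= 2 * om `|v - u| * `|v - u|.
Proof.
have omE : om `|u| = om (pos u) + om (pos (- u)).
  have [u0|/ltW u0] := leP 0 u.
    by rewrite ger0_norm// pos_ge// (pos_le (_ : - u <= 0)) ?oppr_le0// (modulus0 hom) addr0.
  by rewrite ler0_norm// pos_le// (pos_ge (_ : 0 <= - u)) ?oppr_ge0// (modulus0 hom) add0r.
have h1 := W_taylor u v; have := W_taylor (- u) (- v).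
rewrite -opprD normrN -[- (v + - u)]/(- (v - u)) => h2.
have -> : V v - V u - om `|u| * (v - u) = (W v - W u - om (pos u) * (v - u)) -
   (W (- v) - W (- u) - om (pos (- u)) * - (v - u)).
  by rewrite omE /V; ring.
apply: (le_trans (ler_normB _ _)); rewrite -mulrA mulr2n mulrDl mul1r.
exact: lerD.
Qed.

Lemma odd_primitive_superadd u v : 0 <= u -> 0 <= v -> V u + V v <= V (u + v).
Proof.
wlog uv : u v / u <= v => [H u0 v0|u0 v0].
  by have [/H->//|/ltW/H] := leP u v; rewrite addrC (addrC v) => ->.
have V0 : V 0 = 0 by have := odd_primitiveN 0; rewrite oppr0 => h; lra.
have [h _] := odd_primitive_bounds v0 (ltac:(lra) : v <= u + v).
have [_ h'] := odd_primitive_bounds (lexx 0) u0.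
have uu : om u * u <= om v * u by rewrite ler_wpM2r// (modulus_le hom).
move: h' h; rewrite V0 !subr0 addrK; lra.
Qed.

(* Vanishes on both axes, while its s-derivative at (0, r) is om `|r|: this is
   what makes the unstable multiplier along the stable axis equal to
   l2 * (1 + om `|x|). *)
Definition second_diff s r := (V (s + r) + V (s - r)) / 2 - V s.
Local Notation H := second_diff.

(** For r <= s this is convexity of V on the positive half-line. For r > s, V (s - r) = - V (r - s),
    and superadditivity used twice gives V (r + s) >= V r + V s >= 2 V s + V (r - s). *)
Lemma second_diff_ge0 s r : 0 <= s -> 0 <= r -> 0 <= H s r.
Proof.
move=> s0 r0; rewrite /H; have [rs|/ltW sr] := leP r s.
  have [h1 _] := odd_primitive_bounds s0 (ltac:(lra) : s <= s + r).
  have [_ h2] := odd_primitive_bounds (ltac:(lra) : 0 <= s - r) (ltac:(lra) : s - r <= s).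
  lra.
have := odd_primitive_superadd r0 s0.
have := odd_primitive_superadd s0 (ltac:(lra) : 0 <= r - s).
have -> : s + (r - s) = r by ring.
have -> : V (s - r) = - V (r - s) by rewrite -odd_primitiveN opprB.
rewrite (addrC r s); lra.
Qed.

(** The relative gain H s r / s is om r in the limit s -> 0, but at most half of it once s >= 2 r.
    This loss is the source of the lower bound on the regularity. *)
Lemma second_diff_far s r : 0 <= r -> 2 * r <= s -> H s r <= s * (om r / 2).
Proof.
move=> r0 rs; rewrite /H.
have [_ h1] := odd_primitive_bounds (ltac:(lra) : 0 <= s) (ltac:(lra) : s <= s + r).
have [h2 _] := odd_primitive_bounds (ltac:(lra) : 0 <= s - r) (ltac:(lra) : s - r <= s).
have h3 := modulusB_le hom (ltac:(lra) : 0 <= s - r) (ltac:(lra) : s - r <= s + r).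
have h4 := modulus_expand hom (ltac:(lra) : 1 <= 2) r0.
have o0 := modulus_ge0 hom r0.
have e1 : s + r - (s - r) = 2 * r by ring.
rewrite e1 in h3.
have h5 : (om (s + r) - om (s - r)) * r <= 2 * om r * r by rewrite ler_wpM2r//; lra.
have h6 : 2 * r * om r <= s * om r by rewrite ler_wpM2r.
lra.
Qed.

Lemma second_diff0l r : H 0 r = 0.
Proof.
have V0 : V 0 = 0 by have := odd_primitiveN 0; rewrite oppr0 => h; lra.
by rewrite /H add0r sub0r odd_primitiveN V0; lra.
Qed.

Lemma second_diff0r s : H s 0 = 0. Proof. by rewrite /H addr0 subr0; lra. Qed.

Lemma second_diffNr s r : H s (- r) = H s r.
Proof. by rewrite /H opprK (addrC (V (s - r))). Qed.

Lemma second_diffNl s r : H (- s) r = - H s r.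
Proof.
by rewrite /H -opprD !odd_primitiveN (_ : - s + r = - (s - r)) ?odd_primitiveN; [ring|ring].
Qed.

Definition second_diff_s (s r : R) := (om `|s + r| + om `|s - r|) / 2 - om `|s|.
Definition second_diff_r (s r : R) := (om `|s + r| - om `|s - r|) / 2.
Local Notation Hs := second_diff_s.
Local Notation Hr := second_diff_r.

Let om2 d : 0 <= d -> om (2 * d) <= 2 * om d.
Proof. by apply: (modulus_expand hom); rewrite ler1n. Qed.

Let om2_taylor u v d : `|v - u| <= 2 * d -> `|V v - V u - om `|u| * (v - u)| <= 8 * om d * d.
Proof.
move=> h; have d0 : 0 <= d by have := normr_ge0 (v - u); lra.
have o0 := modulus_ge0 hom d0; have n0 := normr_ge0 (v - u).
apply: (le_trans (odd_primitive_taylor u v)).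
have -> : 8 * om d * d = 2 * (2 * om d) * (2 * d) by ring.
apply: ler_pM => //; first by rewrite mulr_ge0 ?(modulus_ge0 hom).
by rewrite ler_pM2l//; apply: le_trans (om2 d0); exact: (modulus_le hom).
Qed.

(** The arguments s + r and s - r move by at most 2 d and contribute 8 / 2 each; the term V s
    contributes 2. *)
Lemma second_diff_taylor s r s' r' d : `|s' - s| <= d -> `|r' - r| <= d ->
  `|H s' r' - H s r - (Hs s r * (s' - s) + Hr s r * (r' - r))| <= 10 * om d * d.
Proof.
move=> hs hr; have d0 : 0 <= d by exact: le_trans hs.
have [s1 s2] : - d <= s' - s /\ s' - s <= d by apply/andP; rewrite -ler_norml.
have [r1 r2] : - d <= r' - r /\ r' - r <= d by apply/andP; rewrite -ler_norml.
have h1 := @om2_taylor (s + r) (s' + r') d (ltac:(rewrite ler_norml; lra)).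
have h2 := @om2_taylor (s - r) (s' - r') d (ltac:(rewrite ler_norml; lra)).
have h3 : `|V s' - V s - om `|s| * (s' - s)| <= 2 * om d * d.
  apply: (le_trans (odd_primitive_taylor s s')).
  by apply: ler_pM; rewrite ?mulr_ge0 ?(modulus_ge0 hom)// ler_pM2l// (modulus_le hom).
rewrite (_ : _ - _ - _ = (V (s' + r') - V (s + r) - om `|s + r| * (s' + r' - (s + r))) / 2 +
  (V (s' - r') - V (s - r) - om `|s - r| * (s' - r' - (s - r))) / 2 -
  (V s' - V s - om `|s| * (s' - s))); last by rewrite /H /Hs /Hr; field.
rewrite (le_trans (ler_normB _ _))//.
have := ler_normD ((V (s' + r') - V (s + r) - om `|s + r| * (s' + r' - (s + r))) / 2)
  ((V (s' - r') - V (s - r) - om `|s - r| * (s' - r' - (s - r))) / 2).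
rewrite !normrM (ger0_norm (_ : 0 <= 2^-1)) ?invr_ge0//; lra.
Qed.

Let om_dist (u v d : R) : `|u - v| <= 2 * d -> `|(om `|u|) - (om `|v|)| <= 2 * om d.
Proof.
move=> h; have d0 : 0 <= d by have := normr_ge0 (u - v); lra.
apply: (le_trans (modulus_dist hom (normr_ge0 _) (normr_ge0 _))).
apply: le_trans (om2 d0); apply: (modulus_le hom) => //.
by apply: le_trans h; exact: ler_dist_dist.
Qed.

Lemma second_diff_mod s r s' r' d : `|s' - s| <= d -> `|r' - r| <= d ->
  `|Hs s' r' - Hs s r| <= 4 * om d /\ `|Hr s' r' - Hr s r| <= 4 * om d.
Proof.
move=> hs hr; have d0 : 0 <= d by exact: le_trans hs.
have [s1 s2] : - d <= s' - s /\ s' - s <= d by apply/andP; rewrite -ler_norml.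
have [r1 r2] : - d <= r' - r /\ r' - r <= d by apply/andP; rewrite -ler_norml.
have h1 := @om_dist (s' + r') (s + r) d (ltac:(rewrite ler_norml; lra)).
have h2 := @om_dist (s' - r') (s - r) d (ltac:(rewrite ler_norml; lra)).
have h3 := @om_dist s' s d (ltac:(rewrite ler_norml; lra)).
move: h1 h2 h3; rewrite /Hs /Hr !ler_norml => /andP[? ?] /andP[? ?] /andP[? ?].
by split; lra.
Qed.

Lemma second_diff_s_le s r : `|Hs s r| <= om `|r|.
Proof.
have h1 := modulus_dist hom (normr_ge0 (s + r)) (normr_ge0 s).
have h2 := modulus_dist hom (normr_ge0 (s - r)) (normr_ge0 s).
have k1 : om `|(`|s + r|) - (`|s|)| <= om `|r|.
  apply: (modulus_le hom) => //; apply: (le_trans (ler_dist_dist _ _)).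
  by rewrite addrAC subrr add0r.
have k2 : om `|(`|s - r|) - (`|s|)| <= om `|r|.
  apply: (modulus_le hom) => //; apply: (le_trans (ler_dist_dist _ _)).
  by rewrite addrAC subrr add0r normrN.
have := le_trans h1 k1; have := le_trans h2 k2.
by rewrite /Hs !ler_norml => /andP[? ?] /andP[? ?]; lra.
Qed.

Lemma second_diff_le s r : `|H s r| <= `|s| * om `|r|.
Proof.
have wn : wmod (fun t : R => 10 * om t) by apply: wmod_scale => //; exact: modulus_wmod.
have := @taylor_lip R R^o R^o setT (fun t : R => 10 * om t) (H^~ r) (fun s v => Hs s r * v) 0 s (om `|r|) wn.
rewrite second_diff0l !subr0 mulrC; apply=> //.
- move=> u v _ _; have := @second_diff_taylor u r v r `|v - u| (lexx _).
  by rewrite subrr normr0 mulr0 addr0; apply.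
- by move=> z _ _ v; rewrite [`|_|]normrM ler_wpM2r// second_diff_s_le.
Qed.

Lemma second_diff_s0 r : Hs 0 r = om `|r|.
Proof. by rewrite /Hs add0r sub0r normrN normr0 (modulus0 hom); lra. Qed.

End Primitive.

Section PlanePoints.
Variable R : realType.
Local Notation V := 'rV[R]_2.

Definition pt (x y : R) : V := \row_j (if j == 0 then x else y).

Lemma pt0 x y : pt x y 0 0 = x. Proof. by rewrite mxE. Qed.
Lemma pt1 x y : pt x y 0 1 = y. Proof. by rewrite mxE. Qed.

Lemma ptB x y x' y' : pt x y - pt x' y' = pt (x - x') (y - y').
Proof. by apply: rv2P; rewrite subMxE ?pt0 ?pt1. Qed.

Lemma norm_pt x y : `|pt x y| = Num.max `|x| `|y|.
Proof. by rewrite norm_rv2 pt0 pt1. Qed.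

Lemma pt00 : pt 0 0 = 0. Proof. by apply: rv2P; rewrite ?pt0 ?pt1 mxE. Qed.

Lemma C1_modulus_diffeo_saddle nu (F : V -> V) (p q : R) : wmod nu -> p != 0 -> q != 0 ->
  C1_modulus nu F -> F 0 = 0 -> jacobian F 0 = saddle p q -> C1_modulus_diffeo nu F.
Proof.
move=> wn p0 q0 CF F0 JF; split=> //.
have [F' [G [A [B [L [rho [r]]]]]]] := globalize wn ltr01 p0 q0 CF F0 JF.
move=> [[L0 r0 _] [FK GK F'0] [tF tG] _ Fr].
by exists G; have [] := inverse_of_global wn L0 r0 FK GK F'0 tF tG Fr.
Qed.

Lemma geom_small (k C e : R) : 0 <= k -> k < 1 -> 0 < e -> 0 <= C ->
  exists N, forall n, (N <= n)%N -> k ^+ n * C <= e.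
Proof.
move=> k0 k1 e0 C0.
have : (fun n => k ^+ n : R^o) @ \oo --> (0 : R^o) by apply: cvg_expr; rewrite ger0_norm.
move=> /cvgrPdist_le/(_ (e / (C + 1)) (divr_gt0 e0 (ltr_wpDl C0 ltr01)))[N _ hN].
exists N => n Nn; have /= := hN n Nn.
rewrite sub0r normrN ger0_norm ?exprn_ge0// => h.
apply: (@le_trans _ _ (e / (C + 1) * C)); first by rewrite ler_wpM2r.
by rewrite mulrAC ler_pdivrMr ?ltr_wpDl// ler_wpM2l ?(ltW e0)// lerDl.
Qed.

End PlanePoints.

(** * Linearizations of the extremal map *)

Section Example.
Variable R : realType.
Local Notation V := 'rV[R]_2.
Variables (om : R -> R) (l1 l2 : R).
Hypothesis hom : modulus_of_continuity om.
Hypotheses (l10 : 0 < `|l1|) (l11 : `|l1| < 1) (l21 : 1 < `|l2|).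
Local Notation H := (second_diff om).
Local Notation Hs := (second_diff_s om).
Local Notation Hr := (second_diff_r om).
Local Notation a := `|l1|.
Local Notation b := `|l2|.

Definition example (z : V) : V := pt (l1 * z 0 0) (l2 * (z 0 1 + H (z 0 1) (z 0 0))).

Let exD (z : V) : 'M[R]_2 := \matrix_(i, j) (if j == 0 then l1 * (i == 0)%:R
  else l2 * (if i == 0 then Hr (z 0 1) (z 0 0) else 1 + Hs (z 0 1) (z 0 0))).

Let b0 : 0 < b. Proof. exact: lt_trans l21. Qed.
Let l1N : l1 != 0. Proof. by rewrite -normr_gt0. Qed.
Let l2N : l2 != 0. Proof. by rewrite -normr_gt0. Qed.
Let om_ge t : 0 <= t -> 0 <= om t. Proof. exact: modulus_ge0. Qed.

Lemma example_spec : [/\ C1_modulus_diffeo om example, jacobian example 0 = saddle l1 l2 &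
  example 0 = 0].
Proof.
have wom := modulus_wmod hom.
have dx (x y : V) i : `|y 0 i - x 0 i| <= `|y - x| by rewrite -subMxE le_mx_norm.
have L0 : 0 <= 10 * b by rewrite mulr_ge0.
have tF x y : `|x| < 1 -> `|y| < 1 ->
    `|example y - example x - (y - x) *m exD x| <= 10 * b * om `|y - x| * `|y - x|.
  move=> _ _; have o0 := om_ge (normr_ge0 (y - x)).
  apply: mx_norm_le => [|i j]; first by rewrite !mulr_ge0.
  rewrite [i]ord1; case: (ord2E j) => ->.
    rewrite (subMxE (_ - _)) mul2E subMxE !pt0 !mxE/= mulr1 mulr0 mulr0 addr0.
    by rewrite (_ : _ - _ = 0) ?normr0 ?mulr_ge0//; ring.
  have := second_diff_taylor hom (dx x y 1) (dx x y 0); set u := H _ _ - _ - _ => hu.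
  rewrite (_ : _ 0 1 = l2 * u); first by rewrite normrM -!mulrA mulrCA ler_wpM2l// !mulrA.
  by rewrite (subMxE (_ - _)) mul2E subMxE !pt1 !mxE/= /u; ring.
have mD x y : `|x| < 1 -> `|y| < 1 -> `|exD x - exD y| <= 10 * b * om `|x - y|.
  move=> _ _; have o0 := om_ge (normr_ge0 (x - y)).
  have [h1 h2] := second_diff_mod hom (dx y x 1) (dx y x 0).
  apply: mx_norm_le => [|i j]; first by rewrite !mulr_ge0.
  have k : b * (4 * om `|x - y|) <= 10 * b * om `|x - y|.
    by have : 0 <= b * om `|x - y| by [rewrite mulr_ge0]; lra.
  rewrite subMxE !mxE; case: (ord2E j) => ->/=; first by rewrite subrr normr0 !mulr_ge0.
  rewrite -mulrBr normrM; apply: le_trans k; rewrite ler_wpM2l//; case: ifP => // _.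
  by rewrite opprD addrACA subrr add0r.
have [CF JF _] := taylor_C1_modulus wom ltr01 L0 tF mD.
have F0 : example 0 = 0.
  by rewrite /example !mxE second_diff0r !(addr0, mulr0) pt00.
have J0 : jacobian example 0 = saddle l1 l2.
  rewrite JF ?normr0//; apply/matrixP => i j; rewrite !mxE.
  rewrite /second_diff_s /second_diff_r !(addr0, subr0, normr0) subrr mul0r (modulus0 hom).
  by case: (ord2E i) (ord2E j) => -> [->|->]/=;
    rewrite !(mulr1, mulr0, addr0, subr0, mul0r, mulr0n, mulr1n).
by split=> //; exact: (C1_modulus_diffeo_saddle wom l1N l2N CF F0 J0).
Qed.

Variables (Phi : V -> V) (r : R).
Hypotheses (r0 : 0 < r) (Phi0 : Phi 0 = 0).
Hypothesis dPhi : forall z, `|z| < r -> differentiable Phi z.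
Hypothesis JPhi : forall z, `|z| < r -> `|jacobian Phi z - 1%:M| <= 6^-1.
Hypothesis JPhic : forall e, 0 < e -> exists2 d, 0 < d &
  forall z, `|z| < d -> `|jacobian Phi z - 1%:M| <= e.
Hypothesis conj : forall z, `|z| < r -> Phi (example z) = Phi z *m saddle l1 l2.

Let phi x y := Phi (pt x y) 0 1.
Let q x := jacobian Phi (pt x 0) 1 1.

(** An oscillation 2 e of the Jacobian costs 4 e, and its distance e to the identity costs 2 e more.
    With e = 1 / 6, as assumed on the ball of radius r, Phi is 2-Lipschitz. *)
Let near_id e d (x y : V) : d <= r -> (forall z, `|z| < d -> `|jacobian Phi z - 1%:M| <= e) ->
  `|x| < d -> `|y| < d -> `|Phi y - Phi x - (y - x)| <= 6 * e * `|y - x|.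
Proof.
move=> dr hd xd yd.
have dPhi' z : `|z| < d -> differentiable Phi z by move=> zd; apply: dPhi; exact: lt_le_trans dr.
have := @mean_value_ball _ Phi d x y (2 * e) dPhi' xd yd.
move=> /(_ _)/le_trans h.
have {}h : `|Phi y - Phi x - (y - x) *m jacobian Phi x| <= 2 * (2 * e) * `|y - x|.
  apply: h => // s s01; have sd : `|x + s *: (y - x)| < d by exact: seg_in_ball.
  have BB (M N : 'M[R]_2) : M - N = (M - 1%:M) - (N - 1%:M) by rewrite opprB addrA subrK.
  rewrite BB; apply: (le_trans (ler_normB _ _)).
  by rewrite mulr2n mulrDl mul1r; apply: lerD; exact: hd.
have E : Phi y - Phi x - (y - x) = Phi y - Phi x - (y - x) *m jacobian Phi x +
    (y - x) *m (jacobian Phi x - 1%:M).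
  by rewrite mulmxBr mulmx1 addrA subrK.
rewrite E (le_trans (ler_normD _ _))//.
have h2 : `|(y - x) *m (jacobian Phi x - 1%:M)| <= 2 * `|y - x| * e.
  by rewrite (le_trans (mx_norm_mul _ _))// ler_wpM2l ?mulr_ge0// hd.
have -> : 6 * e * `|y - x| = 2 * (2 * e) * `|y - x| + 2 * `|y - x| * e by ring.
exact: lerD.
Qed.

Let Phi_lip x y : `|x| < r -> `|y| < r -> `|Phi y - Phi x| <= 2 * `|y - x|.
Proof.
move=> xr yr; have := near_id (lexx r) JPhi xr yr; rewrite mulfV ?mul1r// => h.
by have := ler_normD (Phi y - Phi x - (y - x)) (y - x); rewrite subrK; lra.
Qed.

Let pt_lt (x y d : R) : `|x| < d -> `|y| < d -> `|pt x y| < d.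
Proof. by move=> h1 h2; rewrite norm_pt gt_max h1. Qed.

Let phi_lip x y x' y' : `|x| < r -> `|y| < r -> `|x'| < r -> `|y'| < r ->
  `|phi x' y' - phi x y| <= 2 * Num.max `|x' - x| `|y' - y|.
Proof.
move=> xr yr xr' yr'; rewrite -norm_pt -ptB.
apply: le_trans (Phi_lip (pt_lt xr yr) (pt_lt xr' yr')).
by rewrite /phi -subMxE le_mx_norm.
Qed.

Let phi_conj x y : `|x| < r -> `|y| < r -> phi (l1 * x) (l2 * (y + H y x)) = l2 * phi x y.
Proof.
move=> xr yr; have := conj (pt_lt xr yr); rewrite /example pt0 pt1 /phi => ->.
by rewrite mul_saddle1 mulrC.
Qed.

Let phi00 : phi 0 0 = 0. Proof. by rewrite /phi pt00 Phi0 mxE. Qed.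

Let l1n_lt n x : `|x| < r -> `|l1 ^+ n * x| < r.
Proof.
by move=> xr; rewrite (le_lt_trans _ xr)// normrM normrX ler_piMl// exprn_ile1// ltW.
Qed.

(** The stable axis is invariant; along it phi is multiplied by l2 at each step while the orbit,
    hence phi, stays bounded. *)
Let phi_x0 x : `|x| < r -> phi x 0 = 0.
Proof.
move=> xr.
have it n : phi (l1 ^+ n * x) 0 = l2 ^+ n * phi x 0.
  elim: n => [|n IH]; first by rewrite !expr0 !mul1r.
  rewrite exprS -mulrA -[LHS](_ : phi (l1 * (l1 ^+ n * x)) (l2 * (0 + H 0 (l1 ^+ n * x))) = _).
    by rewrite phi_conj ?normr0 ?l1n_lt// IH exprS mulrA.
  by rewrite second_diff0l addr0 mulr0.
apply/eqP; rewrite -normr_le0; apply/ler_addgt0Pl => e e0; rewrite addr0.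
have bi0 : 0 <= b^-1 by rewrite invr_ge0 ltW.
have bi1 : b^-1 < 1 by rewrite invf_lt1.
have r20 : 0 <= 2 * r by rewrite mulr_ge0// ltW.
have [N hN] := geom_small bi0 bi1 e0 r20.
apply: le_trans (hN N (leqnn N)); rewrite exprVn ler_pdivlMl ?exprn_gt0//.
rewrite -normrX -normrM -it.
have := @phi_lip 0 0 (l1 ^+ N * x) 0; rewrite phi00 !subr0 normr0 => /(_ r0 r0 (l1n_lt N xr) r0).
move=> /le_trans; apply; rewrite ler_pM2l// ge_max (ltW r0) andbT ltW//; exact: l1n_lt.
Qed.

(** On the unstable axis the map is linear, so phi (0, y) = l2^n phi (0, l2^-n y); tangency to the
    identity at the origin then leaves only y. *)
Let phi_0y y : `|y| < r -> phi 0 y = y.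
Proof.
move=> yr; pose s n := l2^-1 ^+ n * y.
have bi0 : 0 <= b^-1 by rewrite invr_ge0 ltW.
have bi1 : b^-1 < 1 by rewrite invf_lt1.
have sr n : `|s n| < r.
  by rewrite (le_lt_trans _ yr)// normrM normrX normfV ler_piMl// exprn_ile1// ltW.
have it n : phi 0 y = l2 ^+ n * phi 0 (s n).
  elim: n => [|n IH]; first by rewrite /s !expr0 !mul1r.
  have := @phi_conj 0 (s n.+1); rewrite normr0 => /(_ r0 (sr _)).
  rewrite second_diff0r addr0 mulr0 {1}/s exprS -mulrA mulVKf// -/(s n) => h.
  by rewrite IH h exprSr mulrA.
apply/eqP; rewrite -subr_eq0 -normr_le0; apply/ler_addgt0Pl => e e0; rewrite addr0.
have e1 : 0 < e / (6 * r) by rewrite divr_gt0// mulr_gt0.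
have [d d0 hd] := JPhic e1.
pose d' := Num.min d r; have d'0 : 0 < d' by rewrite lt_min d0.
have hd' z : `|z| < d' -> `|jacobian Phi z - 1%:M| <= e / (6 * r).
  by rewrite lt_min => /andP[zd _]; exact: hd.
have d'r : d' <= r by rewrite ge_min lexx orbT.
have [N hN] := @geom_small R _ r (d' / 2) bi0 bi1 (divr_gt0 d'0 (ltr0Sn _ 1)) (ltW r0).
have sd : `|s N| < d'.
  apply: (@le_lt_trans _ _ (d' / 2)); last by lra.
  apply: le_trans (hN N (leqnn N)); rewrite /s normrM normrX normfV.
  by rewrite ler_wpM2l ?exprn_ge0// ltW.
have h := near_id d'r hd' (_ : `|0 : V| < d') (pt_lt _ sd : `|pt 0 (s N)| < d').
have {}h : `|phi 0 (s N) - s N| <= e / r * `|s N|.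
  have {}h := h (ltac:(by rewrite normr0)) (ltac:(by rewrite normr0)).
  have := le_mx_norm (Phi (pt 0 (s N)) - Phi 0 - (pt 0 (s N) - 0)) 0 1.
  rewrite Phi0 !subr0 subMxE pt1 => /le_trans; apply; move: h; rewrite Phi0 !subr0 norm_pt normr0.
  rewrite max_r// => /le_trans; apply; rewrite ler_wpM2r// le_eqVlt; apply/orP; left; apply/eqP.
  by field; rewrite gt_eqF.
have -> : phi 0 y - y = l2 ^+ N * (phi 0 (s N) - s N).
  by rewrite mulrBr -it /s mulrA exprVn mulfV ?mul1r// expf_neq0.
rewrite normrM; apply: (@le_trans _ _ (`|l2 ^+ N| * (e / r * `|s N|))); first by rewrite ler_wpM2l.
rewrite mulrCA -normrM /s mulrA exprVn mulfV ?expf_neq0// mul1r.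
by rewrite mulrAC ler_pdivrMr// ler_wpM2l ?ltW.
Qed.

Let q_taylor x : `|x| < r -> forall e, 0 < e ->
  exists2 d, 0 < d & forall t, `|t| < d -> `|phi x t - t * q x| <= e * `|t|.
Proof.
move=> xr e e0; have xr' : `|pt x 0| < r by apply: pt_lt; rewrite ?normr0.
have [d d0 hd] := differentiable_taylor (dPhi xr') e0.
exists d => // t td; have tn : `|pt 0 t| = `|t| by rewrite norm_pt normr0 max_r.
have := hd (pt 0 t); rewrite tn => /(_ td).
have -> : pt x 0 + pt 0 t = pt x t.
  by apply: rv2P; rewrite addMxE ?pt0 ?pt1 ?addr0 ?add0r.
apply: le_trans; apply: le_trans (le_mx_norm _ 0 1).
by rewrite (subMxE (_ - _)) mul2E subMxE pt0 pt1 mul0r add0r -/(phi x t) -/(phi x 0) phi_x0// subr0.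
Qed.

(** The derivative of [phi_conj] in the second variable at 0, where H t x = om |x| t + o(t), taken
    through difference quotients at a single small t. *)
Let q_rec x : `|x| < r -> q x = (1 + om `|x|) * q (l1 * x).
Proof.
move=> xr; have xr1 : `|l1 * x| < r by have := l1n_lt 1 xr; rewrite expr1.
set c := 1 + om `|x|; set q' := q (l1 * x).
have c0 : 0 < c by rewrite ltr_wpDr// om_ge.
apply/eqP; rewrite -subr_eq0 -normr_le0; apply/ler_addgt0Pl => e e0; rewrite addr0.
have k0 : 0 < 1 + c + `|q'| by rewrite ltr_wpDr// ltr_wpDl.
pose e1 := e / (1 + c + `|q'|); have e10 : 0 < e1 by rewrite divr_gt0.
have [d1 d10 h1] := q_taylor xr e10.
have [d2 d20 h2] := q_taylor xr1 e10.
have [d3 d30 h3] : exists2 d, 0 < d & om d <= e1 / 10.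
  by have [_ _ _] := modulus_wmod hom; apply; rewrite divr_gt0.
pose m := Num.min (Num.min d1 (d2 / (b * c))) (Num.min d3 r).
have m0 : 0 < m by rewrite !lt_min d10 d30 r0 divr_gt0// mulr_gt0.
pose t := m / 2.
have t0 : 0 < t by rewrite divr_gt0.
have : t < m by rewrite /t; lra.
rewrite !lt_min => /andP[/andP[td1 td2] /andP[td3 tr]].
have tn : `|t| = t by rewrite ger0_norm// ltW.
pose s := l2 * (t + H t x).
have hH : `|H t x - om `|x| * t| <= e1 * t.
  have := @second_diff_taylor _ _ hom 0 x t x t.
  rewrite !subr0 subrr normr0 mulr0 addr0 second_diff0l second_diff_s0// subr0 tn.
  move=> /(_ (lexx _) (ltW t0))/le_trans; apply; rewrite ler_wpM2r ?(ltW t0)//.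
  by have := modulus_le hom (ltW t0) (ltW td3); lra.
have hH2 : `|t + H t x| <= c * t.
  apply: (le_trans (ler_normD _ _)); rewrite mulrDl mul1r tn lerD2l mulrC.
  by apply: (le_trans (second_diff_le hom t x)); rewrite tn.
have sb : `|s| <= b * c * t by rewrite normrM -mulrA ler_pM2l.
have sd : `|s| < d2 by apply: (le_lt_trans sb); rewrite mulrC -ltr_pdivlMr// mulr_gt0.
have {h1} := h1 t; rewrite tn => /(_ td1) h1.
have {}h2 := h2 s sd.
have := @phi_conj x t xr; rewrite tn => /(_ tr) hc; rewrite -/s in hc.
have E : l2 * t * (q x - c * q') = - (l2 * (phi x t - t * q x)) + (phi (l1 * x) s - s * q') +
    l2 * (H t x - om `|x| * t) * q' by rewrite hc /s /c; ring.
have bt0 : 0 < b * t by rewrite mulr_gt0.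
rewrite -(ler_pM2l bt0) -{1}tn -!normrM E.
apply: (le_trans (ler_normD _ _)); apply: (@le_trans _ _ (b * (e1 * t) + e1 * (b * c * t) + b * (e1 * t) * `|q'|)).
  apply: lerD; last by rewrite !normrM ler_wpM2r// ler_pM2l.
  apply: (le_trans (ler_normD _ _)); rewrite normrN normrM; apply: lerD; first by rewrite ler_pM2l.
  by apply: (le_trans h2); rewrite ler_pM2l.
rewrite le_eqVlt; apply/orP; left; apply/eqP; rewrite /e1; field; rewrite gt_eqF//.
Qed.

Let wprod n x := \prod_(k < n) (1 + om (a ^+ k * x)).

Let wprodS n x : wprod n.+1 x = wprod n x * (1 + om (a ^+ n * x)).
Proof. by rewrite /wprod big_ord_recr. Qed.

Let an_ge n x : 0 <= x -> 0 <= a ^+ n * x.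
Proof. by move=> x0; rewrite mulr_ge0// exprn_ge0. Qed.

Let wprod_ge n x : 0 <= x -> 1 + dini_psum om a n x <= wprod n x.
Proof.
move=> x0; elim: n => [|n IH]; first by rewrite /dini_psum /wprod !big_ord0 addr0.
have o0 := om_ge (an_ge n x0); have p0 := dini_psum_ge0 hom l10 n x0.
rewrite wprodS /dini_psum big_ord_recr/= -/(dini_psum om a n x) mulrDr mulr1 addrA lerD//.
by rewrite ler_peMl// (le_trans _ IH)// lerDl.
Qed.

Let q_prod n x : `|x| < r -> q x = wprod n `|x| * q (l1 ^+ n * x).
Proof.
move=> xr; elim: n => [|n IH]; first by rewrite /wprod big_ord0 expr0 !mul1r.
rewrite IH wprodS (q_rec (l1n_lt n xr)) normrM normrX (mulrA l1) -exprS.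
exact: mulrA.
Qed.

Let wprod_ge1 n x : 0 <= x -> 1 <= wprod n x.
Proof. by move=> x0; apply: le_trans (wprod_ge n x0); rewrite lerDl (dini_psum_ge0 hom l10). Qed.

Let wprod_mono n m x : 0 <= x -> wprod n x <= wprod (n + m) x.
Proof.
move=> x0; elim: m => [|m IH]; first by rewrite addn0.
rewrite addnS wprodS; apply: (le_trans IH); rewrite ler_peMr ?lerDl ?om_ge ?an_ge//.
by rewrite (le_trans _ (wprod_ge1 _ x0)).
Qed.

(** The product [q_prod] is continued up to a large m: its last factor tends to 1, and the partial
    products increase with m. *)
Let q_ge n x : `|x| < r -> wprod n `|x| <= q x.
Proof.
move=> xr; apply/ler_addgt0Pl => e e0.
have w1 := wprod_ge1 n (normr_ge0 x).
have w0 : 0 < wprod n `|x| by exact: lt_le_trans w1.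
pose e1 := Num.min 1 (e / wprod n `|x|).
have e10 : 0 < e1 by rewrite lt_min ltr01 divr_gt0.
have [d d0 hd] := JPhic e10.
have [N hN] := geom_small (normr_ge0 l1) l11 (divr_gt0 d0 (ltr0Sn _ 1)) (normr_ge0 x).
pose m := (n + N)%N.
have xm : `|pt (l1 ^+ m * x) 0| < d.
  apply: pt_lt; rewrite ?normr0// normrM normrX (le_lt_trans (hN _ (leq_addl _ _)))//; lra.
have q1 : 1 - e1 <= q (l1 ^+ m * x).
  have E11 : (1%:M : 'M[R]_2) 1 1 = 1 by rewrite mxE.
  have := le_trans (le_mx_norm _ 1 1) (hd _ xm); rewrite subMxE E11 -/(q (l1 ^+ m * x)).
  by rewrite ler_norml => /andP[]; lra.
have e1w : e1 * wprod n `|x| <= e by rewrite -ler_pdivlMr// ge_min lexx orbT.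
have e11 : 0 <= 1 - e1 by rewrite subr_ge0 ge_min lexx.
rewrite (q_prod m xr); apply: (@le_trans _ _ (e + wprod n `|x| * (1 - e1))); first by lra.
by rewrite lerD2l ler_pM// ?(ltW w0)// wprod_mono.
Qed.

Lemma example_not_linearizable : dini_integral om 1 = +oo%E -> False.
Proof.
move=> doo; pose x := Num.min (r / 2) 1.
have x0 : 0 < x by rewrite lt_min ltr01 andbT divr_gt0.
have xn : `|x| = x by rewrite ger0_norm// ltW.
have xr : `|x| < r.
  by rewrite xn (@le_lt_trans _ _ (r / 2))//; [rewrite ge_min lexx|have := r0; lra].
have [n hn] := dini_unbounded hom l10 l11 (x^-1 * q x) doo.
have := q_ge n xr; rewrite xn => h.
have hw := wprod_ge n (ltW x0).
have := @dini_psum_expand _ om a hom l10 n x^-1 x _ (ltW x0).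
rewrite mulVf ?gt_eqF// invf_ge1// ge_min lexx orbT => /(_ isT) h2.
have : x^-1 * dini_psum om a n x <= x^-1 * q x by rewrite ler_pM2l ?invr_gt0//; lra.
by move: hn h2; lra.
Qed.

(** H is odd in its first argument and even in its second, so everything reduces to nonnegative
    arguments; the last bound is the halving of [second_diff_far]. *)
Let th_bounds y x : y != 0 -> [/\ 0 <= H y x / y, H y x / y <= om `|x| &
  2 * `|x| <= `|y| -> H y x / y <= om `|x| / 2].
Proof.
move=> yN.
have E : H y x / y = H `|y| `|x| / `|y|.
  have Ex z : H z x = H z `|x|.
    have [x0|x0] := leP 0 x; first by rewrite ger0_norm.
    by rewrite (ltr0_norm x0) second_diffNr.
  rewrite Ex; have [y0|y0] := leP 0 y; first by rewrite (ger0_norm y0).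
  by rewrite (ltr0_norm y0) second_diffNl invrN mulrNN.
have y0 : 0 < `|y| by rewrite normr_gt0.
rewrite E; split=> [||h].
- by rewrite divr_ge0// (second_diff_ge0 hom).
- rewrite ler_pdivrMr// mulrC; apply: (le_trans (ler_norm _)).
  by have := second_diff_le hom `|y| `|x|; rewrite !normr_id.
- by rewrite ler_pdivrMr// mulrC (second_diff_far hom).
Qed.

Let geom_between (k u v : R) : 1 < k -> 0 < u -> u <= v ->
  exists n, k ^+ n * u <= v /\ v < k ^+ n.+1 * u.
Proof.
move=> k1 u0 uv; have k0 : 0 < k by exact: lt_trans k1.
have v0 : 0 < v by exact: lt_le_trans uv.
have ki0 : 0 <= k^-1 by rewrite invr_ge0 ltW.
have ki1 : k^-1 < 1 by rewrite invf_lt1.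
have ex : exists n, v < k ^+ n * u.
  have [N hN] := geom_small ki0 ki1 (divr_gt0 u0 (ltr0Sn _ 1)) (ltW v0).
  exists N; have := hN N (leqnn N); rewrite exprVn ler_pdivrMl ?exprn_gt0//.
  by have := mulr_gt0 (exprn_gt0 N k0) u0; lra.
case: (ex_minnP ex) => -[|n] hn hmin; first by move: hn; rewrite expr0 mul1r ltNge uv.
exists n; split=> //; rewrite leNgt; apply/negP => /hmin; by rewrite ltnn.
Qed.

(** The orbit of (x, t) is followed for fixed x and small t. It crosses the diagonal at about time
    K, and at time n it has left to distance of order r close to the unstable axis, where phi is the
    second coordinate; this identifies phi (x, t) / t with p n up to an error of order a^n. The
    Taylor bound compares phi (x, t) / t with Q instead, so that Q - p n is essentially at most L *
    eta t. *)
Theorem example_lower_bound (eta : R -> R) (L : R) : Dini om -> r <= 1 -> 0 <= L ->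
  (forall t, 0 <= t -> 0 <= eta t) ->
  (forall x y, `|x| < r -> `|y| < r ->
     `|Phi y - Phi x - (y - x) *m jacobian Phi x| <= L * eta `|y - x| * `|y - x|) ->
  exists C t0, [/\ 0 <= C, 0 < t0 & forall t, 0 < t -> t < t0 ->
    dini_sum om a (t `^ (- ln a / (ln b - ln a))) <= C * eta t].
Proof.
move=> dini r1 L0 eta0 tay.
have a0' := ltW l10; have lna : ln a < 0 by rewrite ln_lt0// l10 l11.
have lnb : 0 < ln b by rewrite ln_gt0.
pose x := r / 2; have x0 : 0 < x by rewrite divr_gt0.
have xlt : x < r by rewrite /x; have := r0; lra.
have x1 : x <= 1 by apply: le_trans r1; exact: ltW.
have xn : `|x| = x by rewrite ger0_norm// ltW.
have xr : `|x| < r by rewrite xn.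
pose Q := q x.
have wQ n : wprod n x <= Q by have := q_ge n xr; rewrite xn.
have Q1 : 1 <= Q by apply: le_trans (wQ 0%N); rewrite /wprod big_ord0.
have Q0 : 0 < Q by exact: lt_le_trans Q1.
have bQ0 : 0 < 2 * Q * b by rewrite !mulr_gt0.
have om1 := modulus_gt0 hom (@ltr01 R).
(* A quarter of the linear lower bound om 1 * (a^(K+1) x) of the Dini sum, per a^K: the error at
   time n can then be absorbed. N1 makes n - K large enough for this, and N2 makes K large enough to
   force n >= K + N1. *)
pose c1 := om 1 * a * x / 4; have c10 : 0 < c1 by rewrite !mulr_gt0.
have [N1 hN1] := geom_small a0' l11 c10 (ltW bQ0).
have [N2 hN2] : exists N, forall n, (N <= n)%N -> a ^+ n * (2 * Q * b ^+ N1) <= 2^-1.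
  by apply: geom_small => //; rewrite !mulr_ge0 ?exprn_ge0// ltW.
(* In the linear part, the ratio of the second to the first coordinate grows by g at each step. *)
pose g := b / a.
have g1 : 1 < g by rewrite /g ltr_pdivlMr// mul1r (lt_trans l11).
have g0 : 0 < g by exact: lt_trans g1.
have ax0 : 0 < a * x by rewrite mulr_gt0.
exists (4 * L / (a * x)), (Num.min (r / (2 * Q)) (r / g ^+ N2)); split.
- by rewrite divr_ge0 ?mulr_ge0// ltW.
- by rewrite lt_min !divr_gt0 ?mulr_gt0 ?exprn_gt0.
move=> t t0; rewrite lt_min => /andP[tQ tN2].
have tQ' : Q * t <= r / 2 by move: tQ; rewrite ltr_pdivlMr ?mulr_gt0//; lra.
have tr2 : t <= r / 2.
  by apply: le_trans tQ'; rewrite ler_peMl// ltW.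
have tr : t < r by have := r0; lra.
have [n [n1 n2]] := geom_between l21 (mulr_gt0 Q0 t0) tQ'.
have [K [K1 K2]] := geom_between g1 t0 (ltW tr).
have bn0 : 0 < b ^+ n by exact: exprn_gt0.
have K_ge : (N2 <= K)%N.
  rewrite leqNgt; apply/negP => KN; move: K2; apply/negP; rewrite -leNgt.
  move: tN2; rewrite ltr_pdivlMr ?exprn_gt0// mulrC => /ltW; apply: le_trans.
  by rewrite ler_pM2r// ler_eXn2l.
pose y := fix y k := if k is k'.+1 then l2 * (y k' + H (y k') (l1 ^+ k' * x)) else t.
pose xs k := l1 ^+ k * x.
have xsn k : `|xs k| = a ^+ k * x by rewrite normrM normrX xn.
(* The accumulated gain of the second coordinate over its linear growth, a product of the factors 1
   + th. *)
pose p k := y k / (l2 ^+ k * t).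
have l2t k : l2 ^+ k * t != 0 by rewrite mulf_neq0// ?expf_neq0// gt_eqF.
have yE k : y k = l2 ^+ k * t * p k by rewrite /p mulrC divfK.
pose th k := H (y k) (xs k) / y k.
have p0 : p 0%N = 1 by rewrite /p /= expr0 mul1r mulfV// gt_eqF.
have pS k : y k != 0 -> p k.+1 = p k * (1 + th k).
  rewrite /p /= -/(xs k) /th exprS; move: (y k) (H _ _) => u h uN.
  by field; rewrite uN l2N expf_neq0// gt_eqF.
have inv k : 1 <= p k /\ y k != 0.
  elim: k => [|k [IH yk]]; first by rewrite p0 /= gt_eqF.
  have [h _ _] := th_bounds (xs k) yk.
  have p1 : 1 <= p k.+1.
    rewrite pS//; apply: (le_trans IH); rewrite ler_peMr ?lerDl//.
    exact: le_trans IH.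
  by split=> //; rewrite yE mulf_neq0// gt_eqF// (lt_le_trans _ p1).
have th_le k : th k <= om (a ^+ k * x).
  by have [_ yk] := inv k; have [_ + _] := th_bounds (xs k) yk; rewrite xsn.
have th_ge k : 0 <= th k by have [_ yk] := inv k; have [] := th_bounds (xs k) yk.
have pS' k : p k.+1 = p k * (1 + th k) by apply: pS; have [] := inv k.
have pp k : 0 <= p k by have [h _] := inv k; exact: le_trans h.
have pw k : p k <= wprod k x.
  elim: k => [|k IH]; first by rewrite p0 /wprod big_ord0.
  by rewrite pS' wprodS ler_pM ?addr_ge0// lerD2l.
have yn k : `|y k| = b ^+ k * t * p k.
  by rewrite yE normrM (normrM (l2 ^+ k)) normrX (ger0_norm (ltW t0)) (ger0_norm (pp k)).
have p_mono k m : p k <= p (k + m)%N.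
  elim: m => [|m IH]; first by rewrite addn0.
  by rewrite addnS pS'; apply: (le_trans IH); rewrite ler_peMr// lerDl.
(* After time K, r < g^k t means b^k t >= a^k r = 2 a^k x: the orbit is in the region where the gain
   is halved. *)
have far k : (K < k)%N -> th k <= om (a ^+ k * x) / 2.
  move=> Kk; have [p1 yk] := inv k; have [_ _] := th_bounds (xs k) yk; rewrite xsn yn; apply.
  apply: (@le_trans _ _ (b ^+ k * t)); last by rewrite ler_peMr// mulr_ge0 ?exprn_ge0 ?ltW.
  have : r < g ^+ k * t by apply: (lt_le_trans K2); rewrite ler_pM2r// ler_eXn2l.
  rewrite /g expr_div_n mulrAC ltr_pdivlMr ?exprn_gt0// => /ltW; apply: le_trans.
  by rewrite /x; have : a ^+ k * r = r * a ^+ k by [exact: mulrC]; lra.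
have gap N : dini_psum om a N (a ^+ K.+1 * x) / 2 <= wprod (K.+1 + N) x - p (K.+1 + N)%N.
  elim: N => [|N IH]; first by rewrite /dini_psum big_ord0 mul0r addn0 subr_ge0.
  rewrite addnS wprodS pS' /dini_psum big_ord_recr/= -/(dini_psum om a N (a ^+ K.+1 * x)).
  have -> : a ^+ N * (a ^+ K.+1 * x) = a ^+ (K.+1 + N) * x by rewrite mulrA -exprD addnC.
  set k := (K.+1 + N)%N in IH *; set o := om _; set D := dini_psum _ _ _ _ in IH *.
  have o0 : 0 <= o by rewrite om_ge// an_ge// ltW.
  have hth : th k <= o / 2 by apply: far; rewrite ltnS leq_addr.
  have h1 : p k * th k <= p k * (o / 2) by rewrite ler_wpM2l.
  have h2 : p k * o <= wprod k x * o by rewrite ler_wpM2r.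
  have h3 : 1 * o <= wprod k x * o by rewrite ler_wpM2r// wprod_ge1// ltW.
  lra.
have ax k : 0 <= a ^+ k * x by rewrite an_ge// ltW.
(* Each step after K loses at least half of om (a^k x) against the full product; the supremum over N
   collects half of the Dini tail. Since p increases, stopping at n only enlarges the gap. *)
have gapS : dini_sum om a (a ^+ K.+1 * x) / 2 <= Q - p n.
  rewrite ler_pdivrMr//; apply: dini_sum_le => N.
  rewrite -ler_pdivrMr//; apply: (@le_trans _ _ (dini_psum om a (n + N) (a ^+ K.+1 * x) / 2)).
    rewrite ler_pM2r ?invr_gt0// addnC dini_psumD// lerDl.
    by apply: (dini_psum_ge0 hom l10); rewrite mulr_ge0// exprn_ge0.
  apply: (le_trans (gap _)); apply: lerB; first exact: wQ.
  by rewrite addnCA; exact: p_mono.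
have orbit k : (k <= n)%N -> phi (xs k) (y k) = l2 ^+ k * phi x t.
  elim: k => [|k IH kn]; first by rewrite /xs !expr0 !mul1r.
  have ykr : `|y k| < r.
    rewrite yn; apply: (@le_lt_trans _ _ (b ^+ n * (Q * t))); last by have := r0; lra.
    rewrite -mulrA (mulrC t); apply: ler_pM; [exact: exprn_ge0|exact: mulr_ge0 (pp k) (ltW t0)| |].
      by rewrite ler_eXn2l// ltnW.
    by rewrite ler_pM2r//; exact: le_trans (pw k) (wQ k).
  have := phi_conj (l1n_lt k xr) ykr; rewrite -/(xs k) (IH (ltnW kn)) mulrA -exprS => <-.
  by rewrite /xs exprS -mulrA.
have ynr : `|y n| < r.
  rewrite yn; apply: (@le_lt_trans _ _ (b ^+ n * (Q * t))); last by have := r0; lra.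
  by rewrite -mulrA (mulrC t) ler_pM2l// ler_pM2r//; exact: le_trans (pw n) (wQ n).
have nr0 : `|0 : R| < r by rewrite normr0.
(* At time n the point is at distance a^n x from the unstable axis, where phi is known. Dividing by
   l2^n uses b^(n+1) Q t > r / 2. *)
have h1 : `|phi x t - t * p n| <= a ^+ n * (2 * Q * b) * t.
  have := phi_lip nr0 ynr (l1n_lt n xr) ynr.
  rewrite phi_0y// (orbit n (leqnn n)) yE -/(xs n) subrr normr0 subr0 xsn max_l//.
  rewrite -(mulrA (l2 ^+ n)) -mulrBr normrM normrX => h; rewrite -(ler_pM2l bn0) (le_trans h)//.
  have : r * a ^+ n <= 2 * (b ^+ n.+1 * (Q * t)) * a ^+ n.
    by rewrite ler_wpM2r ?exprn_ge0//; move: n2; lra.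
  by rewrite exprS /x; lra.
have h3 : `|phi x t - t * Q| <= L * eta t * t.
  have tn : `|t| = t by rewrite ger0_norm// ltW.
  have := tay (pt x 0) (pt x t) (pt_lt xr nr0) (pt_lt xr (_ : `|t| < r)).
  rewrite ptB subrr subr0 norm_pt normr0 tn max_r ?(ltW t0)// => /(_ tr); apply: le_trans.
  apply: le_trans (le_mx_norm _ 0 1); rewrite (subMxE (_ - _)) mul2E subMxE pt0 pt1.
  by rewrite mul0r add0r -/(phi x t) -/(phi x 0) phi_x0// subr0.
have h4 : Q - p n <= L * eta t + a ^+ n * (2 * Q * b).
  rewrite -(ler_pM2r t0) [leRHS]mulrDl.
  have -> : (Q - p n) * t = (phi x t - t * p n) - (phi x t - t * Q) by ring.
  rewrite [leRHS]addrC; apply: (le_trans (ler_norm _)); apply: (le_trans (ler_normB _ _)); exact: lerD.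
(* Otherwise b^(K + N1) Q t would exceed r / 2, whereas b^K t <= r a^K and a^K is small. *)
have nK : (K + N1 <= n)%N.
  rewrite leqNgt; apply/negP => nK.
  have e1 : b ^+ n.+1 <= b ^+ K * b ^+ N1 by rewrite -exprD ler_eXn2l.
  have aK : 0 < a ^+ K by exact: exprn_gt0.
  have bK : 0 < b ^+ K by exact: exprn_gt0.
  have e2 := hN2 K K_ge.
  have e3 : b ^+ K * t <= r * a ^+ K.
    by move: K1; rewrite /g expr_div_n mulrAC ler_pdivrMr.
  have e4 : r / 2 < b ^+ K * b ^+ N1 * (Q * t).
    by apply: (lt_le_trans n2); rewrite ler_pM2r// mulr_gt0.
  have e5 : b ^+ K * t * (b ^+ N1 * Q) <= r * a ^+ K * (b ^+ N1 * Q).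
    by rewrite ler_wpM2r// mulr_ge0 ?exprn_ge0// ltW.
  have e6 : r * (a ^+ K * (2 * Q * b ^+ N1)) <= r * 2^-1 by rewrite ler_pM2l.
  have : b ^+ K * b ^+ N1 * (Q * t) = b ^+ K * t * (b ^+ N1 * Q) by ring.
  have := r0; lra.
have h5 : a ^+ n * (2 * Q * b) <= c1 * a ^+ K.
  have -> : n = (K + (n - K))%N by rewrite subnKC// (leq_trans (leq_addr N1 K)).
  rewrite exprD -mulrA mulrC ler_wpM2r ?exprn_ge0//; apply: hN1.
  by rewrite -(leq_add2l K) subnKC// (leq_trans (leq_addr N1 K)).
have aKx1 : a ^+ K.+1 * x <= 1 by rewrite mulr_ile1// ?exprn_ge0 ?exprn_ile1 ?ltW.
have S_ge : om 1 * (a ^+ K.+1 * x) <= dini_sum om a (a ^+ K.+1 * x).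
  apply: (le_trans (modulus_linear hom (ax _) aKx1)).
  have := dini_psum_le_sum hom l10 l11 dini 1 (ax K.+1).
  by rewrite /dini_psum big_ord1 expr0 mul1r.
have [S1 S2 S3 _] := dini_sum_wmod hom l10 l11 dini.
(* Half of the Dini sum is at most L * eta t plus the error, and the error is at most a quarter of
   the Dini sum. *)
have S4 : dini_sum om a (a ^+ K.+1 * x) <= 4 * L * eta t.
  have : om 1 * (a ^+ K.+1 * x) = 4 * (c1 * a ^+ K) by rewrite /c1 exprS; field.
  lra.
set dl := _ / (_ - _).
(* The exponent satisfies g^dl = a^-1, so this is g^K t <= 1 raised to the power dl. *)
have tdl : t `^ dl <= a ^+ K.
  have gK : g ^+ K * t <= 1 by exact: le_trans r1.
  have ba : 0 < ln b - ln a by lra.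
  rewrite -ler_ln ?posrE ?powR_gt0 ?exprn_gt0// ln_powR lnXn// /dl mulrAC ler_pdivrMr//.
  have : ln (g ^+ K * t) <= 0 by rewrite ln_le0.
  rewrite lnM ?posrE ?exprn_gt0// lnXn// /g ln_div ?posrE// => h.
  have : - ln a * (((ln b - ln a) *+ K) + ln t) <= 0 by rewrite pmulr_rle0// oppr_gt0.
  rewrite -(mulr_natr (_ - _)) -(mulr_natr (ln a)) => h6; rewrite -subr_le0; apply: le_trans h6.
  by rewrite le_eqVlt; apply/orP; left; apply/eqP; ring.
apply: (@le_trans _ _ (dini_sum om a ((a * x)^-1 * (a ^+ K.+1 * x)))).
  apply: S2; first exact: powR_ge0.
  by apply: (le_trans tdl); rewrite exprS le_eqVlt; apply/orP; left; apply/eqP; field; rewrite !gt_eqF.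
have ax1 : 1 <= (a * x)^-1 by rewrite invf_ge1// mulr_ile1// ltW.
apply: (le_trans (S3 _ _ ax1 (ax _))).
by rewrite mulrAC [leRHS]mulrC ler_pM2l ?invr_gt0.
Qed.

End Example.

(** * The dichotomy and the optimality of the modulus *)

Section Assembly.
Variable R : realType.
Local Notation V := 'rV[R]_2.
Local Notation J := (swap_mx R).
Implicit Types F Phi : V -> V.

Lemma linearizing_near F Phi (l1 l2 s : R) : 0 < s -> linearizing (saddle l1 l2) F Phi ->
  exists r, [/\ 0 < r /\ r <= s,
    Phi 0 = 0 /\ (forall z, `|z| < r -> differentiable Phi z),
    forall z, `|z| < r -> `|jacobian Phi z - 1%:M| <= 6^-1,
    forall e, 0 < e -> exists2 d, 0 < d & forall z, `|z| < d -> `|jacobian Phi z - 1%:M| <= e &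
    forall z, `|z| < r -> Phi (F z) = Phi z *m saddle l1 l2].
Proof.
move=> s0 [[Psi [Phi0 [U [U' [oU _ _ _ [C1 _]]]]]] JPhi cj].
have nU : nbhs (0 : V) U by exact: open_nbhs_nbhs.
have JPhic e : 0 < e -> exists2 d, 0 < d & forall z, `|z| < d -> `|jacobian Phi z - 1%:M| <= e.
  move=> e0; have [_ cJ] := C1 _ (nbhs_singleton nU).
  pose W1 : normedModType R := V; pose W2 : normedModType R := 'M[R]_2.
  have C : (jacobian Phi : W1 -> W2) z @[z --> (0 : W1)] --> (jacobian Phi 0 : W2) by exact: cJ.
  move/(@cvgrPdist_le R W2 W1 (nbhs (0 : W1)) (nbhs_filter (0 : W1))) : C => /(_ e e0).
  move=> /nbhs_ballP[d /= d0 hd]; exists d => // z zd; rewrite -JPhi distrC; apply: hd.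
  by rewrite -ball_normE/= sub0r normrN.
have [d d0 hd] := JPhic 6^-1 (ltac:(by rewrite invr_gt0)).
move: nU cj => /nbhs_ballP[r1 /= r10 h1] /nbhs_ballP[r2 /= r20 h2].
exists (Num.min (Num.min d s) (Num.min r1 r2)); split=> //.
- by rewrite !lt_min d0 s0 r10 r20 !ge_min lexx !orbT.
- split=> // z; rewrite !lt_min => /andP[_ /andP[zr _]].
  by have [] // := C1 z (h1 z _); rewrite -ball_normE/= sub0r normrN.
- by move=> z; rewrite !lt_min => /andP[/andP[zd _] _]; exact: hd.
- move=> z; rewrite !lt_min => /andP[_ /andP[_ zr]].
  by apply: h2; rewrite -ball_normE/= sub0r normrN.
Qed.

Lemma C1_modulus_swap nu F : wmod nu -> C1_modulus nu F ->
  C1_modulus nu (fun z => F (z *m J) *m J) /\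
  jacobian (fun z => F (z *m J) *m J) 0 = J *m jacobian F 0 *m J.
Proof.
move=> wn CF; have [r [L [r0 L0 tF mF]]] := C1_modulus_taylor wn CF.
have [||CF' JF' _] := @taylor_C1_modulus _ nu (fun z => F (z *m J) *m J)
  (fun z => J *m jacobian F (z *m J) *m J) r L wn r0 L0.
- move=> x y xr yr; rewrite swap_conj_diff norm_mul_swap -(norm_mul_swap_sub x y).
  by apply: tF; rewrite /= norm_mul_swap.
- move=> x y xr yr; rewrite norm_swap_conj_sub -(norm_mul_swap_sub y x).
  by apply: mF; rewrite norm_mul_swap.
split; first exact: CF'.
have n0 : `|0 : V| < r by rewrite normr0.
by rewrite (JF' 0 n0) (mul0mx _ J : (0 : V) *m J = 0).
Qed.

Lemma mul_swap_saddle (m : nat) (A : 'M[R]_(m, 2)) p q :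
  A *m J *m saddle p q = A *m saddle q p *m J.
Proof. by rewrite -(saddle_swap p q) !mulmxA mul_swapK. Qed.

(* Exchanging the coordinates and inverting the map exchanges the stable and
   unstable directions. *)
Lemma mirror nu F1 (l1 l2 : R) : wmod nu -> l1 != 0 -> l2 != 0 ->
  C1_modulus nu F1 -> F1 0 = 0 -> jacobian F1 0 = saddle l2^-1 l1^-1 ->
  exists F, [/\ C1_modulus_diffeo nu F, jacobian F 0 = saddle l1 l2 &
    forall (eta : R -> R) Phi, wmod eta -> linearizing (saddle l1 l2) F Phi -> C1_modulus eta Phi ->
      linearizing (saddle l2^-1 l1^-1) F1 (fun z => Phi (z *m J) *m J) /\
      C1_modulus eta (fun z => Phi (z *m J) *m J)].
Proof.
move=> wn l1N l2N CF1 F10 JF1.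
have l1N' : l1^-1 != 0 by rewrite invr_eq0.
have l2N' : l2^-1 != 0 by rewrite invr_eq0.
have [Fg [G [A [B [L [rho [r]]]]]]] := globalize wn ltr01 l2N' l1N' CF1 F10 JF1.
move=> [[L0 r0 _] [FK GK Fg0] [tF tG] [Aep _ A0 B0 _] Fr].
have [CG JG _] := @taylor_C1_modulus _ nu G B 1 L wn ltr01 L0 (fun x y _ _ => tG.1 x y) (fun x y _ _ => tG.2 x y).
have G0 : G 0 = 0 by rewrite -{1}Fg0 FK.
have [CF JF] := C1_modulus_swap wn CG.
have {}JF : jacobian (fun z => G (z *m J) *m J) 0 = saddle l1 l2.
  by rewrite JF JG ?normr0// B0 !invrK saddle_swap.
exists (fun z => G (z *m J) *m J); split; [|exact: JF|].
  apply: (C1_modulus_diffeo_saddle wn l1N l2N CF _ JF).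
  by rewrite mul0mx G0 mul0mx.
move=> eta Phi we [lPhi JPhi cj] CPhi.
have [CP JP] := C1_modulus_swap we CPhi.
split; last exact: CP.
have [r1 [[r10 _] [Phi0 _] _ _ cj1]] := linearizing_near ltr01 (And3 lPhi JPhi cj).
have {}JP : jacobian (fun z => Phi (z *m J) *m J) 0 = 1%:M.
  by rewrite JP JPhi mulmx1 swapK.
split; [|exact: JP|].
  have P0 : Phi (0 *m J) *m J = 0 by rewrite mul0mx Phi0 mul0mx.
  have [] := C1_modulus_diffeo_saddle we (oner_neq0 R) (oner_neq0 R) CP P0 (etrans JP (esym (saddle1 R))).
  by [].
pose K := `|l2^-1| + `|l1^-1| + 2.
have K0 : 0 < K by rewrite ltr_wpDl// addr_ge0.
(* The conjugacy for Phi is used at w = F1 z *m J, which the new map sends to z *m J; the growth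
   bound K keeps w in the ball of radius r1 where it holds. *)
have Flip z : `|Fg z| <= K * `|z|.
  have := global_taylor_near wn L0 tF Aep 0 z; rewrite Fg0 !subr0 => h.
  rewrite -(subrK (z *m saddle l2^-1 l1^-1) (Fg z)) (le_trans (ler_normD _ _))//.
  rewrite /K mulrDl addrC lerD//; last by move: h; rewrite mulr1.
  by apply: mul_saddle_norm; rewrite ?lerDl ?lerDr.
apply/nbhs_ballP; exists (Num.min r (r1 / K)); first by rewrite /= lt_min r0 divr_gt0.
move=> z; rewrite -ball_normE/= sub0r normrN lt_min => /andP[zr zr1].
have w1 : `|F1 z *m J| < r1.
  rewrite norm_mul_swap -Fr// (le_lt_trans (Flip z))// mulrC -ltr_pdivlMr//.
have := cj1 _ w1; rewrite mul_swapK -Fr// FK => ->.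
rewrite mul_swap_saddle -!mulmxA; congr (_ *m _).
by rewrite mulmxA saddleV// mul1mx.
Qed.

Lemma delta_bounds (l1 l2 : R) : 0 < `|l1| -> `|l1| < 1 -> 1 < `|l2| ->
  0 < delta l1 l2 /\ delta l1 l2 <= 1 / 2.
Proof.
move=> a0 a1 b1; have la : ln `|l1| < 0 by rewrite ln_lt0// a0 a1.
have lb : 0 < ln `|l2| by rewrite ln_gt0.
have d0 : 0 < ln `|l2| - ln `|l1| by rewrite subr_gt0 (lt_trans la).
split; first by rewrite /delta divr_gt0// lt_min oppr_gt0 la.
rewrite /delta ler_pdivrMr//.
by have [h|h] := leP (- ln `|l1|) (ln `|l2|); lra.
Qed.

Section Moduli.
Variables (om : R -> R) (l1 l2 : R).
Hypothesis hom : modulus_of_continuity om.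
Hypotheses (l10 : 0 < `|l1|) (l11 : `|l1| < 1) (l21 : 1 < `|l2|).

Theorem dini_linearization F : Dini om -> C1_modulus_diffeo om F -> jacobian F 0 = saddle l1 l2 ->
  exists Phi Psi, [/\ linearizing (saddle l1 l2) F Phi, local_C1_inverse Phi Psi,
    C1_modulus (omegaD l1 l2 om) Phi & C1_modulus (omegaD l1 l2 om) Psi].
Proof.
move=> dini [[G [F0 _]] CF] JF.
have b0 : 0 < `|l2| by exact: lt_trans l21.
have bi1 : `|l2|^-1 < 1 by rewrite invf_lt1.
pose m := Num.max `|l1| `|l2|^-1.
have m1 : m < 1 by rewrite gt_max l11.
have ma : `|l1| <= m by rewrite le_max lexx.
have mb : `|l2|^-1 <= m by rewrite le_max lexx orbT.
(* A rate strictly above a and b^-1 leaves room for the perturbation; below 1, Dini sums with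
   different rates are comparable through the integral. *)
pose kap := (1 + m) / 2.
have k1 : kap < 1 by rewrite /kap; lra.
have ak : `|l1| < kap by rewrite /kap; lra.
have bk : `|l2|^-1 < kap by rewrite /kap; lra.
have k0 : 0 < kap by exact: lt_trans ak.
have [dl0 _] := delta_bounds l10 l11 l21.
have [Phi [Psi [lin inv CPhi CPsi]]] := linearization l10 l11 l21 (modulus_wmod hom)
  (dini_sum_wmod hom k0 k1 dini) ak bk k1 (dini_sum_step hom k0 k1 dini) CF F0 JF.
have kk : 0 < ((1 - kap) * kap)^-1 by rewrite invr_gt0 mulr_gt0// subr_gt0.
have le t : 0 <= t -> t <= 1 ->
    dini_sum om kap (t `^ delta l1 l2) <= ((1 - kap) * kap)^-1 * omegaD l1 l2 om t.
  move=> t0 t1; apply: dini_sum_le_integral => //; first exact: powR_ge0.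
  have -> : 1 = 1 `^ delta l1 l2 by rewrite powR1.
  by rewrite ge0_ler_powR// ?nnegrE// ltW.
exists Phi, Psi; split; [exact: lin|exact: inv| |].
  exact: (C1_modulus_le ltr01 kk le CPhi).
exact: (C1_modulus_le ltr01 kk le CPsi).
Qed.

Theorem divergent_not_linearizable : dini_integral om 1 = +oo%E ->
  exists F, [/\ C1_modulus_diffeo om F, jacobian F 0 = saddle l1 l2 &
    ~ C1_linearizable (saddle l1 l2) F].
Proof.
move=> doo; have [CF JF _] := example_spec hom l10 l21.
exists (example om l1 l2); split; [exact: CF|exact: JF|move=> [Phi lin]].
have [r [[r0 _] [Phi0 dPhi] h1 h2 h3]] := linearizing_near ltr01 lin.
exact: (example_not_linearizable hom l10 l11 l21 r0 Phi0 dPhi h1 h2 h3 doo).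
Qed.

End Moduli.

Lemma bigO_right (f g : R -> R) (C t0 : R) : 0 < t0 ->
  (forall t, 0 < t -> t < t0 -> `|f t| <= C * g t) -> (f : R -> R^o) =O_ (0^'+) (g : R -> R^o).
Proof.
move=> t00 h; apply/eqO_exP; exists (`|C| + 1); first by rewrite /= ltr_wpDl.
near=> t; have tt : t < t0 by near: t; exact: nbhs_right_lt.
have t0' : 0 < t by near: t; exact: nbhs_right_gt.
apply: (le_trans (h t t0' tt)); apply: (le_trans (ler_norm _)).
by rewrite normrM ler_wpM2r// lerDl.
Unshelve. all: by end_near.
Qed.

Lemma omegaD_bigO (om eta : R -> R) (l1 l2 kap C t0 : R) : modulus_of_continuity om -> Dini om ->
  0 < `|l1| -> `|l1| < 1 -> 1 < `|l2| -> 0 < kap -> kap < 1 -> 0 <= C -> 0 < t0 ->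
  (forall t, 0 < t -> t < t0 -> dini_sum om kap (t `^ delta l1 l2) <= C * eta t) ->
  (omegaD l1 l2 om : R -> R^o) =O_ (0^'+) (eta : R -> R^o).
Proof.
move=> hom dini a0 a1 b1 k0 k1 C0 t00 h.
have [dl0 _] := delta_bounds a0 a1 b1.
apply: (@bigO_right _ _ ((1 - kap) / kap * C) (Num.min t0 1)); first by rewrite lt_min t00 ltr01.
move=> t tp; rewrite lt_min => /andP[tt t1].
have p0 : 0 < t `^ delta l1 l2 by exact: powR_gt0.
have p1 : t `^ delta l1 l2 <= 1.
  have -> : 1 = 1 `^ delta l1 l2 by rewrite powR1.
  by rewrite ge0_ler_powR// ?nnegrE// ltW.
have o0 : 0 <= omegaD l1 l2 om t.
  apply: fine_ge0; apply: integral_ge0 => s /=; rewrite in_itv/= => /andP[s0 _].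
  by rewrite lee_fin divr_ge0 ?(modulus_ge0 hom)// ltW.
rewrite (ger0_norm o0) -[leRHS]mulrA; apply: (le_trans (dini_integral_le_sum hom k0 k1 dini p0 p1)).
rewrite ler_wpM2l//.
  by apply: divr_ge0; rewrite ?subr_ge0 ltW.
exact: h.
Qed.

(** [example_lower_bound] always produces the exponent with - ln |l1| in the numerator. When ln |l2|
    is the smaller one, the extremal map for l2^-1 and l1^-1 is taken and carried back by
    [mirror]. *)
Theorem omegaD_optimal (om : R -> R) (l1 l2 : R) : modulus_of_continuity om ->
  0 < `|l1| -> `|l1| < 1 -> 1 < `|l2| -> Dini om ->
  exists F, [/\ C1_modulus_diffeo om F, jacobian F 0 = saddle l1 l2 &
    forall (eta : R -> R) Phi, modulus_of_continuity eta ->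
      linearizing (saddle l1 l2) F Phi -> C1_modulus eta Phi ->
      (omegaD l1 l2 om : R -> R^o) =O_ (0^'+) (eta : R -> R^o)].
Proof.
move=> hom a0 a1 b1 dini.
have wom := modulus_wmod hom.
have b0 : 0 < `|l2| by exact: lt_trans b1.
have lower p1 p2 (eta : R -> R) Phi : 0 < `|p1| -> `|p1| < 1 -> 1 < `|p2| ->
    - ln `|p1| / (ln `|p2| - ln `|p1|) = delta l1 l2 -> modulus_of_continuity eta ->
    linearizing (saddle p1 p2) (example om p1 p2) Phi -> C1_modulus eta Phi ->
    (omegaD l1 l2 om : R -> R^o) =O_ (0^'+) (eta : R -> R^o).
  move=> p10 p11 p21 pd he lin CPhi; have we := modulus_wmod he.
  have [s [L [s0 L0 tP _]]] := C1_modulus_taylor we CPhi.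
  have m0 : 0 < Num.min s 1 by rewrite lt_min s0 ltr01.
  have [r [[r0]]] := linearizing_near m0 lin.
  rewrite le_min => /andP[rs r1] [Phi0 dPhi] h1 h2 h3.
  have [|C [t0 [C0 t00 ht]]] := @example_lower_bound _ om p1 p2 hom p10 p11 p21 Phi r r0 Phi0 dPhi h1 h2 h3
    eta L dini r1 L0 (modulus_ge0 he).
    by move=> x y xr yr; apply: tP; exact: lt_le_trans rs.
  by rewrite pd in ht; exact: (omegaD_bigO hom dini a0 a1 b1 p10 p11 C0 t00 ht).
have [ab|ba] := leP (- ln `|l1|) (ln `|l2|).
  have [CF JF _] := example_spec hom a0 b1.
  exists (example om l1 l2); split; [exact: CF|exact: JF|move=> eta Phi].
  by apply: (lower _ _ _ _ a0 a1 b1); rewrite /delta (elimT min_idPl ab).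
have l1N : l1 != 0 by rewrite -normr_gt0.
have l2N : l2 != 0 by rewrite -normr_gt0.
have a0' : 0 < `|l2^-1| by rewrite normfV invr_gt0.
have a1' : `|l2^-1| < 1 by rewrite normfV invf_lt1.
have b1' : 1 < `|l1^-1| by rewrite normfV invf_gt1.
have [[_ CF] JF F0] := example_spec hom a0' b1'.
have [F [dF JF' hF]] := mirror wom l1N l2N CF F0 JF.
exists F; split; [exact: dF|exact: JF'|move=> eta Phi he lin CPhi].
have [lin' CPhi'] := hF eta Phi (modulus_wmod he) lin CPhi.
apply: lower a0' a1' b1' _ he lin' CPhi'.
by rewrite /delta !normfV !lnV ?posrE// opprK (elimT min_idPr (ltW ba)) (addrC (- ln `|l1|)).
Qed.

End Assembly.

Unset Implicit Arguments.

Theorem theorem6 (R : realType) (omega : R -> R) (l1 l2 : R)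
  (homega : modulus_of_continuity omega)
  (hl1 : 0 < `|l1|) (hl1' : `|l1| < 1) (hl2 : 1 < `|l2|) :
  (* (I) *)
  (Dini omega ->
    forall F : 'rV[R]_2 -> 'rV[R]_2,
      C1_modulus_diffeo omega F -> jacobian F 0 = saddle l1 l2 ->
      C1_linearizable (saddle l1 l2) F) /\
  (* (II) *)
  (dini_integral omega 1 = +oo%E ->
    exists F : 'rV[R]_2 -> 'rV[R]_2,
      [/\ C1_modulus_diffeo omega F, jacobian F 0 = saddle l1 l2 &
          ~ C1_linearizable (saddle l1 l2) F]) /\
  (* equivalent form of (I) and (II) *)
  ((forall F : 'rV[R]_2 -> 'rV[R]_2,
      C1_modulus_diffeo omega F -> jacobian F 0 = saddle l1 l2 ->
      C1_linearizable (saddle l1 l2) F) <-> Dini omega) /\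
  (* regularity of the linearization and of its inverse *)
  (0 < delta l1 l2 <= 1 / 2) /\
  (Dini omega ->
    forall F : 'rV[R]_2 -> 'rV[R]_2,
      C1_modulus_diffeo omega F -> jacobian F 0 = saddle l1 l2 ->
      exists Phi Psi : 'rV[R]_2 -> 'rV[R]_2,
        [/\ linearizing (saddle l1 l2) F Phi, local_C1_inverse Phi Psi,
            C1_modulus (omegaD l1 l2 omega) Phi &
            C1_modulus (omegaD l1 l2 omega) Psi]) /\
  (* optimality *)
  (Dini omega ->
    exists F : 'rV[R]_2 -> 'rV[R]_2,
      [/\ C1_modulus_diffeo omega F, jacobian F 0 = saddle l1 l2 &
          forall (eta : R -> R) (Phi : 'rV[R]_2 -> 'rV[R]_2),
            modulus_of_continuity eta ->
            linearizing (saddle l1 l2) F Phi -> C1_modulus eta Phi ->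
            (omegaD l1 l2 omega : R -> R^o) =O_ (0^'+) (eta : R -> R^o)]).
Proof.
have [d0 d1] := delta_bounds hl1 hl1' hl2.
have lin := dini_linearization homega hl1 hl1' hl2.
have nonlin := divergent_not_linearizable homega hl1 hl1' hl2.
have linI : Dini omega -> forall F, C1_modulus_diffeo omega F -> jacobian F 0 = saddle l1 l2 ->
    C1_linearizable (saddle l1 l2) F.
  by move=> dini F CF JF; have [Phi [Psi [hPhi _ _ _]]] := lin F dini CF JF; exists Phi.
split; first exact: linI.
split; first exact: nonlin.
split; first last.
  split; first by rewrite d0 d1.
  split; first by move=> dini F; exact: lin.
  exact: omegaD_optimal.
split=> [all_lin|]; last exact: linI.
rewrite /Dini ltey; apply/eqP => doo.
have [F [CF JF]] := nonlin doo; apply; exact: all_lin.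
Qed.
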